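(* Let $e(u)=\frac12(\nabla u+(\nabla u)^t)$, $e(u):\mathbb T^3\to\mathbb R^{3\times 3}_{sym}$, be a $\mathbb T^3$-periodic symmetrized gradient, and assume that $e(u)\in\{e^{(1)},e^{(2)},e^{(3)},e^{(4)}\}$ almost everywhere. Then the following holds. (i) There exists $j\in\{1,2,3\}$ such that $\partial_j e(u)=0$ (in the sense of distributions). (ii) Assuming that $j=2$ (i.e. $\partial_2 e(u)=0$), there exist functions $f_1:\mathbb T_1\to\mathbb R$ and $f_3:\mathbb T_3\to\mathbb R$ with $f_1,f_3\in\{-1,1\}$ such that either $e_{13}(u)(x)=f_1(x_1)$ for a.e. $x\in\mathbb T^3$ or $e_{13}(u)(x)=f_3(x_3)$ for a.e. $x\in\mathbb T^3$. (iii) Assuming that $j=2$ and that $e_{13}(u)(x)=f_3(x_3)$ for a.e. $x$, with $f_3$ as in (ii), extend $f_3$ periodically to $\mathbb R$, regard $e_{12}:=e_{12}(u)$ and $e_{23}:=e_{23}(u)$ as periodic functions of $(x_1,x_3)\in\mathbb R^2$, and let $\Phi(s,t):=(t-F_3(s),s)$, where $F_3$ is the Lipschitz function with $F_3'(s)=f_3(s)$ for a.e. $s$ and $F_3(0)=0$. Then there exists a function $g$ of the single variable $t$ such that for a.e. $(s,t)$ $$(e_{12}\circ\Phi)(s,t)=g(t),\qquad (e_{23}\circ\Phi)(s,t)=f_3(s)\,g(t).$$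
   Context: Fix $\lambda_1,\lambda_2,\lambda_3>0$, let $\mathbb T_i:=[0,\lambda_i)$ and $\mathbb T^3:=\mathbb T_1\times\mathbb T_2\times\mathbb T_3$ (a torus). Fix real constants $d_1,d_2,d_3$ and set $$e^{(1)}=\begin{pmatrix} d_1&1&1\\1&d_2&1\\1&1&d_3\end{pmatrix},\quad e^{(2)}=\begin{pmatrix} d_1&-1&-1\\-1&d_2&1\\-1&1&d_3\end{pmatrix},\quad e^{(3)}=\begin{pmatrix} d_1&1&-1\\1&d_2&-1\\-1&-1&d_3\end{pmatrix},\quad e^{(4)}=\begin{pmatrix} d_1&-1&1\\-1&d_2&-1\\1&-1&d_3\end{pmatrix}.$$ A $\mathbb T^3$-periodic symmetrized gradient is a measurable function $e(u)$ on $\mathbb R^3$ that is $\lambda_i$-periodic in $x_i$ for $i=1,2,3$ and is of the form $e(u)=\frac12(\nabla u+(\nabla u)^t)$ for some $u\in W^{1,p}_{loc}(\mathbb R^3;\mathbb R^3)$, $p\in(1,\infty)$ ($u$ itself need not be periodic); it is identified with a function on $\mathbb T^3$. The components of $e(u)$ are denoted $e_{ij}(u)$. *)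

(* Defs.v *)
From HB Require Import structures.
From mathcomp Require Import all_boot all_order all_algebra.
From mathcomp Require Import all_classical all_reals all_analysis.

Set Implicit Arguments.
Unset Strict Implicit.
Unset Printing Implicit Defensive.

Import Order.TTheory GRing.Theory Num.Theory.
Import numFieldNormedType.Exports.

Local Open Scope classical_set_scope.
Local Open Scope ring_scope.

Definition i1 : 'I_3 := @Ordinal 3 0 isT.
Definition i2 : 'I_3 := @Ordinal 3 1 isT.
Definition i3 : 'I_3 := @Ordinal 3 2 isT.

(** A point of R^3 is a pair ((x_1, x_2), x_3): iterated products carry both
    the product topology and the product sigma-algebra, which is the Borel
    one.  The Lebesgue measure of the library lives on Borel sets, so
    "measurable" means Borel measurable throughout; "almost everywhere" means
    outside a subset of a Borel null set. *)
Definition xcoord (R : realType) (i : 'I_3) (x : R * R * R) : R :=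
  [:: x.1.1; x.1.2; x.2]`_i.

Definition basis (R : realType) (i : 'I_3) : R * R * R :=
  ((i == i1)%:R, (i == i2)%:R, (i == i3)%:R).
Arguments basis : clear implicits.

Notation leb R := (@lebesgue_measure R).

(** The library's sigma-finite instance on product measures is shadowed by the
    one on pairs of subprobabilities and is never inferred; it is attached by
    hand to [leb2] and [leb3], so that the Fubini theorems apply to them. *)
Definition leb2 (R : realType) := (leb R \x leb R)%E.
Arguments leb2 : clear implicits.

HB.instance Definition _ (R : realType) := Measure.on (leb2 R).

Lemma leb2_sigma_finite (R : realType) : sigma_finite setT (leb2 R).
Proof.
exact: (@isSigmaFinite.sigma_finiteT _ _ _ _
  (lebesgue_integral_fubini.measure_function_Measure_isSigmaFinite__to__measure_function_isSigmaFinite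
    (leb R) (leb R))).
Qed.

HB.instance Definition _ (R : realType) :=
  Measure_isSigmaFinite.Build _ _ _ (leb2 R) (@leb2_sigma_finite R).

Definition leb3 (R : realType) := (leb2 R \x leb R)%E.
Arguments leb3 : clear implicits.

HB.instance Definition _ (R : realType) := Measure.on (leb3 R).

Lemma leb3_sigma_finite (R : realType) : sigma_finite setT (leb3 R).
Proof.
exact: (@isSigmaFinite.sigma_finiteT _ _ _ _
  (lebesgue_integral_fubini.measure_function_Measure_isSigmaFinite__to__measure_function_isSigmaFinite
    (leb2 R) (leb R))).
Qed.

HB.instance Definition _ (R : realType) :=
  Measure_isSigmaFinite.Build _ _ _ (leb3 R) (@leb3_sigma_finite R).

Definition pderiv (R : realType) (i : 'I_3) (f : R * R * R -> R) :
  R * R * R -> R := fun x => 'D_(basis R i) f x.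

(** All iterated partial derivatives are Frechet differentiable (in particular
    continuous) everywhere: this is C^oo. *)
Definition smooth (R : realType) (f : R * R * R -> R) : Prop :=
  forall (s : seq 'I_3) (x : R * R * R),
    differentiable (foldr (@pderiv R) f s) x.

Definition test_function (R : realType) (phi : R * R * R -> R) : Prop :=
  smooth phi /\ compact (closure [set x | phi x != 0]).

(** [D_i f = g] in the sense of distributions on R^3. *)
Definition weak_pderiv (R : realType) (i : 'I_3) (f g : R * R * R -> R) :
  Prop :=
  forall phi, test_function phi ->
    \int[leb3 R]_x (f x * pderiv i phi x) = - \int[leb3 R]_x (g x * phi x).

Definition Lp_loc (R : realType) (p : R) (f : R * R * R -> R) : Prop :=
  forall K : set (R * R * R), compact K ->
    (f \* \1_K) \in Lfun (leb3 R) p%:E.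

(** [u] belongs to W^{1,p}_loc(R^3; R^3) and [Du] is (a representative of) its
    gradient, [Du x i j] being the derivative of the i-th component along the
    j-th coordinate. *)
Definition W1p_loc (R : realType) (p : R) (u : R * R * R -> 'rV[R]_3)
    (Du : R * R * R -> 'M[R]_3) : Prop :=
  (forall i, Lp_loc p (fun x => u x 0 i)) /\
  (forall i j, Lp_loc p (fun x => Du x i j) /\
               weak_pderiv j (fun x => u x 0 i) (fun x => Du x i j)).

Definition sym_part (R : realType) (A : 'M[R]_3) : 'M[R]_3 :=
  2^-1 *: (A + A^T).

Definition periodic_sym_grad (R : realType) (lambda : 'I_3 -> R)
    (e : R * R * R -> 'M[R]_3) : Prop :=
  [/\ forall i j, measurable_fun [set: R * R * R] (fun x => e x i j),
      forall i x, e (x + lambda i *: basis R i) = e x &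
      exists (p : R) (u : R * R * R -> 'rV[R]_3) (Du : R * R * R -> 'M[R]_3),
        [/\ 1 < p, W1p_loc p u Du &
            {ae leb3 R, forall x, e x = sym_part (Du x)}]].

(** The fundamental cell [0, lambda_1) x [0, lambda_2) x [0, lambda_3). *)
Definition torus (R : realType) (lambda : 'I_3 -> R) : set (R * R * R) :=
  [set x | forall i, 0 <= xcoord i x < lambda i].

(** [D_j e = 0] in the sense of distributions, entrywise. *)
Definition pderiv_zero (R : realType) (j : 'I_3) (e : R * R * R -> 'M[R]_3) :
  Prop :=
  forall i k, weak_pderiv j (fun x => e x i k) (cst 0).

Definition mx3 (R : realType) (rows : seq (seq R)) : 'M[R]_3 :=
  \matrix_(i, j) (nth [::] rows i)`_j.

Definition strain1 (R : realType) (d1 d2 d3 : R) : 'M[R]_3 :=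
  mx3 [:: [:: d1; 1; 1]; [:: 1; d2; 1]; [:: 1; 1; d3]].

Definition strain2 (R : realType) (d1 d2 d3 : R) : 'M[R]_3 :=
  mx3 [:: [:: d1; -1; -1]; [:: -1; d2; 1]; [:: -1; 1; d3]].

Definition strain3 (R : realType) (d1 d2 d3 : R) : 'M[R]_3 :=
  mx3 [:: [:: d1; 1; -1]; [:: 1; d2; -1]; [:: -1; -1; d3]].

Definition strain4 (R : realType) (d1 d2 d3 : R) : 'M[R]_3 :=
  mx3 [:: [:: d1; -1; 1]; [:: -1; d2; -1]; [:: 1; -1; d3]].

(** A function on [0, l) is a function on [R] of which only the values on
    [0, l) matter. *)
Definition sign_valued (R : realType) (l : R) (f : R -> R) : Prop :=
  forall t, 0 <= t < l -> f t = -1 \/ f t = 1.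

(** The [l]-periodic extension to [R] of the restriction of [f] to [0, l). *)
Definition periodize (R : realType) (l : R) (f : R -> R) : R -> R :=
  fun t => f (t - (Num.floor (t / l))%:~R * l).

(** [F] is the Lipschitz function with [F' = f] a.e. and [F 0 = 0]. *)
Definition lipschitz_primitive (R : realType) (f F : R -> R) : Prop :=
  [/\ lipschitz F,
      {ae leb R, forall s : R, is_derive s (1 : R) F (f s)} &
      F 0 = 0].

(** [h], measurable and periodic on R^2, is the function [f] of x regarded as a
    function of (x_1, x_3). *)
Definition planar_version (R : realType) (lambda : 'I_3 -> R)
    (f : R * R * R -> R) (h : R * R -> R) : Prop :=
  [/\ measurable_fun [set: R * R] h,
      forall z, h (z.1 + lambda i1, z.2) = h z,
      forall z, h (z.1, z.2 + lambda i3) = h z &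
      {ae leb3 R, forall x, f x = h (xcoord i1 x, xcoord i3 x)}].

Definition Phi (R : realType) (F3 : R -> R) (z : R * R) : R * R :=
  (z.2 - F3 z.1, z.1).

(* Main.v *)
Require Import Defs.
From mathcomp Require Import all_boot all_order all_algebra.
From mathcomp Require Import all_classical all_reals all_analysis.
From mathcomp Require Import measurable_realfun ring lra.
Set Implicit Arguments.
Unset Strict Implicit.
Unset Printing Implicit Defensive.
Import Order.TTheory GRing.Theory Num.Theory.
Import numFieldNormedType.Exports.
Local Open Scope classical_set_scope.
Local Open Scope ring_scope.

(** Write a = e_23, b = e_13, c = e_12, so that a, b, c = +-1 and abc = 1, while the
    diagonal entries are constant.  Saint-Venant's compatibility conditions then
    read d_2 d_3 a = d_1 d_3 b = d_1 d_2 c = 0 and d_1^2 a = d_1 d_2 b + d_1 d_3 c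
    (and cyclically).  The first ones split a into a12(x1, x2) + a13(x1, x3) - m,
    with a12 and a13 the averages of a over a period; averaging the others gives
    planar relations such as d_1 a12 = d_2 b12.  As a takes two values, on almost
    every slice x1 = const one of a12, a13 is constant.  The planar relations
    propagate this alternative from slice to slice: if a12 vanishes, up to its
    mean, on a non-null set of lines and b12 on a non-null set of transversal ones,
    then a12 vanishes everywhere; and if both alternatives occurred for a, then
    b12 would be an affine function of a12 on each slice, so that a12 would be
    transported along characteristics and vanish on all slices anyway.  Comparing
    a, b, c, two of them lose the same variable, and abc = 1 takes care of the
    third.  When d_2 e = 0, the sum b = b1(x1) + b3(x3) - m takes two values only if
    b1 or b3 is constant, and a = f_3 c turns d_1 a = d_3 c into a transport
    equation with characteristics x_1 + F_3(x_3) = const. *)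

(** * Bounded functions and Fubini *)

(** The equation d_2 d_3 a = 0 alone gives a = a12 + a13 minus a function of x1, and the averaged
    relations hold a priori only up to an additive constant. Periodicity of e removes both defects,
    although u need not be periodic: an average over a period does not see derivatives in the
    averaging variable. The averaging weight is smooth, so that averages are again pairings with
    test functions.

    The means m = +-1 need separate treatment, because the crossing argument ends in the conclusion
    m = +-1 and not in a plain contradiction; a function bounded by 1 with such a mean is constant.

    When both alternatives occur for a, the components e_13 and e_12 have already lost x3 and x2, so
    that a b21(x2, x1) c31(x3, x1) = 1. This is what makes b21 affine in a12 with coefficients
    depending on x1 only. These coefficients are merely bounded and measurable; hence the
    characteristics come from a Lipschitz primitive, and the transport argument works on a Lipschitz
    potential of a12 and not on a12 itself. *)

Section bounded_support.
Context {R : realType} {d : measure_display} {T : measurableType d}.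
Implicit Types (nrm f g : T -> R) (mu : {measure set T -> \bar R}).

(* [bnd], [lbd] and [bms] stand for bounded, locally bounded and boundedly
   supported (and measurable); [nrm] is only a gauge, so that the same notions
   serve on R, R^2 and R^3. *)
Definition lbd nrm f : Prop := measurable_fun [set: T] f /\
  forall N, exists C, forall x, nrm x <= N -> `|f x| <= C.

Definition bms nrm f : Prop := measurable_fun [set: T] f /\
  exists N, (forall x, `|f x| <= N) /\ (forall x, N < nrm x -> f x = 0).

Definition finite_balls nrm mu : Prop := measurable_fun [set: T] nrm /\
  forall N, (mu [set x | (nrm x <= N)%R] < +oo)%E.

Definition bnd f : Prop := measurable_fun [set: T] f /\
  exists C, forall x, `|f x| <= C.

Lemma bnd_lbd nrm f : bnd f -> lbd nrm f.
Proof. by move=> [mf [C fC]]; split => // N; exists C => x _. Qed.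

Lemma bms_bnd nrm f : bms nrm f -> bnd f.
Proof. by move=> [mf [C [fC _]]]; split => //; exists C. Qed.

Lemma bnd_cst c : bnd (cst c).
Proof. by split; [exact: measurable_cst|exists `|c|]. Qed.

Lemma bndM f g : bnd f -> bnd g -> bnd (fun x => f x * g x).
Proof.
move=> [mf [C fC]] [mg [D gD]]; split; first exact: measurable_funM.
by exists (C * D) => x; rewrite normrM ler_pM.
Qed.

Lemma bndD f g : bnd f -> bnd g -> bnd (fun x => f x + g x).
Proof.
move=> [mf [C fC]] [mg [D gD]]; split; first exact: measurable_funD.
by exists (C + D) => x; rewrite (le_trans (ler_normD _ _)) ?lerD.
Qed.

Lemma bndN f : bnd f -> bnd (fun x => - f x).
Proof.
move=> [mf [C fC]]; split; first exact: measurableT_comp.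
by exists C => x; rewrite normrN.
Qed.

Lemma bndB f g : bnd f -> bnd g -> bnd (fun x => f x - g x).
Proof. by move=> bf bg; apply: bndD => //; exact: bndN. Qed.

Lemma lbdD nrm f g : lbd nrm f -> lbd nrm g -> lbd nrm (fun x => f x + g x).
Proof.
move=> [mf fC] [mg gC]; split; first exact: measurable_funD.
move=> N; have [C hC] := fC N; have [D hD] := gC N; exists (C + D) => x xN.
by rewrite (le_trans (ler_normD _ _)) ?lerD ?hC ?hD.
Qed.

Lemma lbdN nrm f : lbd nrm f -> lbd nrm (fun x => - f x).
Proof.
move=> [mf fC]; split; first exact: measurableT_comp.
by move=> N; have [C hC] := fC N; exists C => x xN; rewrite normrN hC.
Qed.

Lemma lbdB nrm f g : lbd nrm f -> lbd nrm g -> lbd nrm (fun x => f x - g x).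
Proof. by move=> bf bg; apply: lbdD => //; exact: lbdN. Qed.

Lemma bmsD nrm f g : bms nrm f -> bms nrm g -> bms nrm (fun x => f x + g x).
Proof.
move=> [mf [N [fN f0]]] [mg [M [gM g0]]]; split; first exact: measurable_funD.
have N0 : 0 <= N by rewrite (le_trans _ (fN point)).
have M0 : 0 <= M by rewrite (le_trans _ (gM point)).
exists (N + M); split=> x; first by rewrite (le_trans (ler_normD _ _)) ?lerD.
by move=> xM; rewrite f0 ?g0 ?addr0//; lra.
Qed.

Lemma bmsN nrm f : bms nrm f -> bms nrm (fun x => - f x).
Proof.
move=> [mf [N [fN f0]]]; split; first exact: measurableT_comp.
by exists N; split=> x; [rewrite normrN|move=> /f0 ->; rewrite oppr0].
Qed.

Lemma bmsB nrm f g : bms nrm f -> bms nrm g -> bms nrm (fun x => f x - g x).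
Proof. by move=> bf bg; apply: bmsD => //; exact: bmsN. Qed.

Lemma bmsMl nrm f g : lbd nrm f -> bms nrm g -> bms nrm (fun x => f x * g x).
Proof.
move=> [mf fC] [mg [M [gM g0]]]; split; first exact: measurable_funM.
have M0 : 0 <= M by rewrite (le_trans _ (gM point)).
have [C hC] := fC M; exists (`|C| * M + M); split => x.
  have [xM|xM] := leP (nrm x) M.
    rewrite normrM (@le_trans _ _ (`|C| * M)) ?lerDl// ler_pM//.
    by rewrite (le_trans (hC _ _)) ?ler_norm.
  by rewrite g0// mulr0 normr0 addr_ge0// mulr_ge0.
move=> xM; rewrite g0 ?mulr0// (le_lt_trans _ xM)// lerDr.
by rewrite mulr_ge0.
Qed.

Lemma measurable_ball_nrm nrm N : measurable_fun [set: T] nrm ->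
  measurable [set x | nrm x <= N].
Proof.
move=> mnrm; rewrite (_ : [set x | _] = [set: T] `&` nrm @^-1` `]-oo, N]%classic).
  exact: mnrm.
by apply/seteqP; split=> x /=; rewrite in_itv/= => // -[].
Qed.

Lemma bms_integrable nrm mu f : finite_balls nrm mu -> bms nrm f ->
  mu.-integrable [set: T] (EFin \o f).
Proof.
move=> [mnrm fnrm] [mf [N [fN f0]]].
pose B := [set x | nrm x <= N].
have mB : measurable B by exact: measurable_ball_nrm.
have -> : EFin \o f = (EFin \o f) \_ B.
  apply/funext => x; rewrite patchE/=; case: ifPn => // /negP.
  by rewrite inE/= => /negP; rewrite -ltNge => /f0 ->.
apply/(integrable_mkcond _ mB).
apply: measurable_bounded_integrable => //.
  exact: fnrm.
  exact: (measurable_funS measurableT).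
exists N; split; first by rewrite num_real.
by move=> y Ny x _ /=; rewrite (le_trans (fN x))// ltW.
Qed.

End bounded_support.

Definition nrmX {R : realType} {T1 T2 : Type} (n1 : T1 -> R) (n2 : T2 -> R)
  (z : T1 * T2) : R := Num.max (n1 z.1) (n2 z.2).

Section fubini_bounded.
Context {R : realType} {d1 d2 : measure_display}
  {T1 : measurableType d1} {T2 : measurableType d2}.
Context (m1 : {sigma_finite_measure set T1 -> \bar R})
  (m2 : {sigma_finite_measure set T2 -> \bar R}).
Context (n1 : T1 -> R) (n2 : T2 -> R).
Hypotheses (fb1 : finite_balls n1 m1) (fb2 : finite_balls n2 m2).
Let n12 := nrmX n1 n2.

Lemma nrmX_le z N : (n12 z <= N) = (n1 z.1 <= N) && (n2 z.2 <= N).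
Proof. by rewrite /n12 /nrmX ge_max. Qed.

Lemma nrmX_lt z N : (N < n12 z) = (N < n1 z.1) || (N < n2 z.2).
Proof. by rewrite /n12 /nrmX lt_max. Qed.

Lemma finite_ballsX : finite_balls n12 (m1 \x m2)%E.
Proof.
move: fb1 fb2 => [mn1 f1] [mn2 f2]; split.
  by apply: (@measurable_maxr _ _ _ _ (n1 \o fst) (n2 \o snd)); exact: measurableT_comp.
move=> N; rewrite (_ : [set x | _] =
    [set x | n1 x <= N] `*` [set y | n2 y <= N]); last first.
  by apply/seteqP; split => -[x y]; rewrite /= nrmX_le => /andP.
rewrite [X in (X < _)%E](@product_measure1E _ _ _ _ _ m1 m2); [|exact: measurable_ball_nrm|exact: measurable_ball_nrm].
by apply: lte_mul_pinfty => //; [rewrite ge0_fin_numE//; exact: f1|exact: f2].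
Qed.

Lemma measurable_slice1 d (T : measurableType d) (f : T1 * T2 -> T) x :
  measurable_fun [set: T1 * T2] f -> measurable_fun [set: T2] (fun y => f (x, y)).
Proof. by move=> mf; apply: measurableT_comp. Qed.

Lemma measurable_slice2 d (T : measurableType d) (f : T1 * T2 -> T) y :
  measurable_fun [set: T1 * T2] f -> measurable_fun [set: T1] (fun x => f (x, y)).
Proof. by move=> mf; apply: measurableT_comp. Qed.

Lemma bms_slice1 f x : bms n12 f -> bms n2 (fun y => f (x, y)).
Proof.
move=> [mf [N [fN f0]]]; split; first exact: measurable_slice1.
by exists N; split => // y yN; rewrite f0// nrmX_lt yN orbT.
Qed.

Lemma bms_slice2 f y : bms n12 f -> bms n1 (fun x => f (x, y)).
Proof.
move=> [mf [N [fN f0]]]; split; first exact: measurable_slice2.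
by exists N; split => // x xN; rewrite f0// nrmX_lt xN.
Qed.

(** The constant depends on [f] only through [N], so that integrals over slices are bounded
    uniformly in the slice. *)
Lemma bms_int_bound d (T : measurableType d) (m : {measure set T -> \bar R})
    (n : T -> R) (N : R) : finite_balls n m -> exists C, forall f : T -> R,
    measurable_fun [set: T] f -> (forall x, `|f x| <= N) ->
    (forall x, N < n x -> f x = 0) -> `|\int[m]_x f x| <= C.
Proof.
move=> fb; have [N0|N0] := ltP N 0.
  by exists 0 => f mf /(_ point) h; have := le_lt_trans h N0; rewrite normr_lt0.
pose g := N \o* \1_[set x | n x <= N].
have mg : measurable_fun [set: T] g.
  apply: measurable_funM => //; apply: measurable_indic.
  by apply: measurable_ball_nrm; exact: fb.1.
have bg : bms n g.
  split => //; exists N; split => x.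
    rewrite /g/= indicE; case: (_ \in _).
      by rewrite mul1r ger0_norm.
    by rewrite mul0r normr0.
  by move=> xN; rewrite /g/= indicE memNset ?mul0r//= leNgt xN.
exists (\int[m]_x g x) => f mf fN f0.
have bf : bms n f by split => //; exists N.
apply: le_trans (le_normr_Rintegral _ _) _ => //; first exact: bms_integrable bf.
apply: le_Rintegral => //.
- apply: (bms_integrable fb); split; first exact: measurableT_comp.
  by exists N; split => x; [rewrite normr_id|move=> /f0 ->; rewrite normr0].
- exact: bms_integrable bg.
- move=> x _; rewrite /g/= indicE.
  have [nx|nx] := leP (n x) N; first by rewrite mem_set// mul1r.
  by rewrite f0// normr0 mulr_ge0.
Qed.

Lemma Rintegral_EFin d (T : measurableType d) (m : {measure set T -> \bar R})
    (f : T -> R) : m.-integrable [set: T] (EFin \o f) ->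
  (\int[m]_x f x)%:E = (\int[m]_x (f x)%:E)%E.
Proof. by move=> mf; rewrite /Rintegral fineK//; exact: integrable_fin_num. Qed.

(** Tonelli gives measurability for non-negative functions; the signed case passes through positive
    and negative parts. *)
Lemma measurable_int1 f :
  (forall x, m2.-integrable [set: T2] (fun y => (f (x, y))%:E)) ->
  measurable_fun [set: T1 * T2] f ->
  measurable_fun [set: T1] (fun x => \int[m2]_y f (x, y)).
Proof.
move=> intf mf.
rewrite (_ : (fun x => _) = fun x =>
   fine (\int[m2]_y (EFin \o f)^\+ (x, y))%E - fine (\int[m2]_y (EFin \o f)^\- (x, y))%E).
  apply: measurable_funB; apply: measurableT_comp => //.
    apply: measurable_fun_fubini_tonelli_F => //.
    by apply: measurable_funepos; apply/measurable_EFinP.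
  apply: measurable_fun_fubini_tonelli_F => //.
  by apply: measurable_funeneg; apply/measurable_EFinP.
apply/funext => x; rewrite /Rintegral integralE fineB.
- by congr (fine _ - fine _); apply: eq_integral => y _; rewrite ?funeposE ?funenegE.
- have := integrable_funepos measurableT (intf x).
  exact: integrable_fin_num.
- have := integrable_funeneg measurableT (intf x).
  exact: integrable_fin_num.
Qed.

Lemma bms_int1 f : bms n12 f -> bms n1 (fun x => \int[m2]_y f (x, y)).
Proof.
move=> bf; split.
  apply: measurable_int1; last by case: bf.
  by move=> x; apply: (bms_integrable fb2); exact: bms_slice1.
move: bf => [mf [N [fN f0]]].
have [C hC] := bms_int_bound N fb2; exists (Num.max C N); split => x.
  rewrite le_max hC//; first exact: measurable_slice1.
  by move=> y yN; rewrite f0// nrmX_lt yN orbT.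
rewrite gt_max => /andP[_ xN].
rewrite (_ : (fun y => _) = cst 0) ?Rintegral_cst ?mul0r//.
by apply/funext => y; rewrite f0// nrmX_lt xN.
Qed.

Lemma bms_fubini1 f : bms n12 f ->
  \int[(m1 \x m2)%E]_z f z = \int[m1]_x \int[m2]_y f (x, y).
Proof.
move=> bf; rewrite /Rintegral -integral12_prod_meas1; last first.
  exact: (bms_integrable finite_ballsX).
congr fine; apply: eq_integral => x _; rewrite /fubini_F -Rintegral_EFin//.
by apply: (bms_integrable fb2); exact: bms_slice1.
Qed.

Lemma bms_fubini2 f : bms n12 f ->
  \int[(m1 \x m2)%E]_z f z = \int[m2]_y \int[m1]_x f (x, y).
Proof.
move=> bf; rewrite /Rintegral -integral21_prod_meas1; last first.
  exact: (bms_integrable finite_ballsX).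
congr fine; apply: eq_integral => x _; rewrite /fubini_G -Rintegral_EFin//.
by apply: (bms_integrable fb1); exact: bms_slice2.
Qed.

Lemma bms_fubini f : bms n12 f ->
  \int[m1]_x \int[m2]_y f (x, y) = \int[m2]_y \int[m1]_x f (x, y).
Proof. by move=> bf; rewrite -bms_fubini1// bms_fubini2. Qed.

Lemma ae_prod (P : T1 * T2 -> Prop) : {ae (m1 \x m2)%E, forall z, P z} ->
  {ae m1, forall x, {ae m2, forall y, P (x, y)}}.
Proof.
move=> [A [mA A0 PA]].
have mx : measurable_fun [set: T1] (m2 \o xsection A).
  exact: measurable_fun_xsection.
have : ae_eq m1 [set: T1] (m2 \o xsection A) (cst 0%E).
  apply/ae_eq_integral_abs => //; rewrite -[RHS]A0.
  by apply: eq_integral => x _; rewrite gee0_abs.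
apply: filterS => x /(_ I) /= A0x.
exists (xsection A x); split => //; first exact: measurable_xsection.
by move=> y /= nP; rewrite /xsection/= inE; exact: PA.
Qed.

Lemma ae_prod_swap (P : T1 * T2 -> Prop) : {ae (m1 \x m2)%E, forall z, P z} ->
  {ae m2, forall y, {ae m1, forall x, P (x, y)}}.
Proof.
move=> [A [mA A0 PA]].
(* Both orders of integration give the product measure, by uniqueness on rectangles. *)
have A0' : (m1 \x^ m2)%E A = 0.
  rewrite -[RHS]A0; symmetry; apply: product_measure_unique => // B C mB mC.
  by rewrite /= product_measure2E.
have mx : measurable_fun [set: T2] (m1 \o ysection A).
  exact: measurable_fun_ysection.
have : ae_eq m2 [set: T2] (m1 \o ysection A) (cst 0%E).
  apply/ae_eq_integral_abs => //; rewrite -[RHS]A0'.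
  by apply: eq_integral => x _; rewrite gee0_abs.
apply: filterS => x /(_ I) /= A0x.
exists (ysection A x); split => //; first exact: measurable_ysection.
by move=> y /= nP; rewrite /ysection/= inE; exact: PA.
Qed.

(** Tonelli for the exceptional set: measurability of [P] is what allows its measure to be computed
    slice by slice. *)
Lemma prod_ae (P : T1 * T2 -> Prop) : measurable [set z | P z] ->
  {ae m1, forall x, {ae m2, forall y, P (x, y)}} ->
  {ae (m1 \x m2)%E, forall z, P z}.
Proof.
move=> mP aeP; pose A := ~` [set z | P z].
have mA : measurable A by exact: measurableC.
exists A; split => //.
have mx : measurable_fun [set: T1] (m2 \o xsection A).
  exact: measurable_fun_xsection.
rewrite /product_measure1.
transitivity (\int[m1]_x `|(m2 \o xsection A) x|)%E.
  by apply: eq_integral => x _; rewrite gee0_abs.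
apply/ae_eq_integral_abs => //.
move: aeP; apply: filterS => x [B [mB B0 PB]] _ /=.
apply/eqP; rewrite -measure_le0 -B0 le_measure ?inE//.
  exact: measurable_xsection.
by move=> y; rewrite /xsection/= inE => nP; exact: PB.
Qed.

Lemma ae_swap (P : T1 * T2 -> Prop) : measurable [set z | P z] ->
  {ae m1, forall x, {ae m2, forall y, P (x, y)}} ->
  {ae m2, forall y, {ae m1, forall x, P (x, y)}}.
Proof. by move=> mP /prod_ae => /(_ mP) /ae_prod_swap. Qed.

End fubini_bounded.

Section ae.
Context {R : realType} {d : measure_display} {T : measurableType d}.
Variable m : {measure set T -> \bar R}.
Implicit Types P Q S : T -> Prop.

Lemma aeS P Q : (forall x, P x -> Q x) ->
  {ae m, forall x, P x} -> {ae m, forall x, Q x}.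
Proof. by move=> PQ; apply: filterS. Qed.

Lemma aeS2 P Q S : (forall x, P x -> Q x -> S x) ->
  {ae m, forall x, P x} -> {ae m, forall x, Q x} -> {ae m, forall x, S x}.
Proof. by move=> PQ; apply: filterS2. Qed.

Lemma aeS3 P Q S U : (forall x, P x -> Q x -> S x -> U x) ->
  {ae m, forall x, P x} -> {ae m, forall x, Q x} -> {ae m, forall x, S x} ->
  {ae m, forall x, U x}.
Proof. by move=> PQ; apply: filterS3. Qed.

Lemma ae_countable (I : countType) (P : I -> T -> Prop) :
  (forall i, {ae m, forall x, P i x}) -> {ae m, forall x, forall i, P i x}.
Proof.
move=> aeP.
pose F k := ~` [set x | if unpickle k is Some i then P i x else True].
apply: (@negligibleS _ _ _ m (\bigcup_k F k)).
  move=> x /= /existsNP[i nP]; exists (pickle i) => //.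
  by rewrite /F/= pickleK.
apply: negligible_bigcup => k; rewrite /F; case: (unpickle k) => [i|].
  exact: aeP.
have -> : ~` [set _ : T | True] = set0 by apply/seteqP; split => // x; exact.
exact: negligible_set0.
Qed.

End ae.

Definition nrm1 {R : realType} : measurableTypeR R -> R := fun x : R => `|x|.
Definition nrm2 {R : realType} := nrmX (@nrm1 R) (@nrm1 R).
Definition nrm3 {R : realType} := nrmX (@nrm2 R) (@nrm1 R).

(** * Lipschitz functions and primitives *)

Section translation.
Context {R : realType}.
Implicit Types (f g : R -> R) (c : R).

Let shiftR c : measurableTypeR R -> measurableTypeR R := fun x : R => x + c.

Lemma measurable_shift c : measurable_fun [set: R]
  (shiftR c : R -> measurableTypeR R).
Proof. by apply: measurable_funD. Qed.

Lemma lebesgue_measure_shift c (A : set R) : measurable A ->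
  pushforward (leb R) (shiftR c) A = leb R A.
Proof.
have ms := measurable_shift c.
move=> mA; apply/esym/lebesgue_measure_unique => //= X [[a b] _ <-].
rewrite /pushforward (_ : shiftR c @^-1` `]a, b]%classic = `](a - c), (b - c)]%classic); last first.
  by apply/seteqP; split => x /=; rewrite !in_itv/= ltrBlDr lerBrDr.
rewrite !lebesgue_measure_itv/= !lte_fin ltrD2r.
by case: ifPn => // _; rewrite -!EFinB; congr EFin; ring.
Qed.

Lemma ae_shift c (P : R -> Prop) : {ae leb R, forall x, P x} ->
  {ae leb R, forall x, P (x + c)}.
Proof.
move=> [A [mA A0 PA]]; exists ((fun x => x + c) @^-1` A); split.
- by rewrite -[X in measurable X]setTI; exact: measurable_shift.
- by rewrite -A0; exact: lebesgue_measure_shift.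
- by move=> x /= nP; exact: PA.
Qed.

Lemma finite_balls1 : finite_balls nrm1 (leb R).
Proof.
split; first exact: measurableT_comp.
move=> N; rewrite (_ : [set x | _] = `[- N, N]%classic).
  rewrite -[X in (X < _)%E]/(leb R (`[- N, N]%classic : set R)) lebesgue_measure_itv/=; case: ifPn => // _.
  by rewrite -EFinB ltry.
by apply/seteqP; split => x /=; rewrite in_itv/= ler_norml.
Qed.

Lemma integrable_bms f : bms nrm1 f ->
  (leb R).-integrable [set: R] (EFin \o f).
Proof. by move=> bf; exact: (bms_integrable finite_balls1 bf). Qed.

Lemma bms_shift f c : bms nrm1 f ->
  bms nrm1 (fun x => f (x + c)).
Proof.
move=> [mf [N [fN f0]]]; split.
  by apply: measurableT_comp => //; exact: measurable_shift.
exists (N + `|c|); split => x.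
  by rewrite (le_trans (fN _))// lerDl.
move=> xN; apply: f0; rewrite -(ltrD2r `|c|) (lt_le_trans xN)//.
by rewrite -{1}(addrK c x) (le_trans (ler_normB _ _)).
Qed.

Lemma Rintegral_shift f c : bms nrm1 f ->
  \int[leb R]_x f (x + c) = \int[leb R]_x f x.
Proof.
move=> bf; rewrite /Rintegral; congr fine.
pose m := pushforward (leb R) (shiftR c).
transitivity (\int[m]_x (f x)%:E)%E.
  rewrite /m integral_pushforward//.
  - exact: measurable_shift.
  - by apply/measurable_EFinP; case: bf.
  - by rewrite preimage_setT; apply: integrable_bms; exact: bms_shift.
apply: eq_measure_integral; first exact: measurable_shift.
by move=> ms A mA _; exact: lebesgue_measure_shift.
Qed.

Definition Lip f := exists L, forall x y, `|f x - f y| <= L * `|x - y|.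

Lemma Lip_ge0 f : Lip f -> exists2 L, 0 <= L & forall x y, `|f x - f y| <= L * `|x - y|.
Proof.
move=> [L fL]; exists `|L| => // x y; rewrite (le_trans (fL _ _))//.
by rewrite ler_wpM2r// ler_norm.
Qed.

Lemma LipD f g : Lip f -> Lip g -> Lip (fun x => f x + g x).
Proof.
move=> [L fL] [M gM]; exists (L + M) => x y; rewrite opprD addrACA mulrDl.
by rewrite (le_trans (ler_normD _ _))// lerD.
Qed.

Lemma Lip_cst c : Lip (cst c).
Proof. by exists 0 => x y; rewrite subrr normr0 mul0r. Qed.

Lemma Lip_continuous f : Lip f -> continuous f.
Proof.
move=> /Lip_ge0[L L0 fL] x; apply/cvgrPdist_le => e e0.
have L1 : 0 < L + 1 by rewrite ltr_wpDl.
exists (e / (L + 1)); first by rewrite /= divr_gt0.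
move=> y /= /ltW; rewrite ler_pdivlMr// => xy.
by rewrite (le_trans (fL _ _))// (le_trans _ xy)// mulrC ler_wpM2l// lerDl.
Qed.

Lemma Lip_measurable f : Lip f -> measurable_fun [set: R] f.
Proof. by move=> Lf; apply: continuous_measurable_fun; exact: Lip_continuous. Qed.

Lemma Lip_bounded f : Lip f -> forall N, exists C, forall x, `|x| <= N -> `|f x| <= C.
Proof.
move=> /Lip_ge0[L L0 fL] N; exists (`|f 0| + L * N) => x xN.
rewrite -[f x](subrK (f 0)) addrC (le_trans (ler_normD _ _))// lerD2l.
by rewrite (le_trans (fL _ _))// subr0 ler_wpM2l.
Qed.

Lemma Lip_lbd f : Lip f -> lbd nrm1 f.
Proof. by move=> Lf; split; [exact: Lip_measurable|exact: Lip_bounded]. Qed.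

Lemma LipM f g : Lip f -> Lip g ->
  (exists N, forall x, N < `|x| -> g x = 0) -> Lip (fun x => f x * g x).
Proof.
move=> /[dup] Lf /Lip_ge0[L L0 fL] /[dup] Lg /Lip_ge0[M M0 gM] [N gN].
have [C fC] := Lip_bounded Lf N; have [D gD] := Lip_bounded Lg N.
have gb x : `|g x| <= `|D|.
  have [xN|/gN ->] := leP `|x| N; last by rewrite normr0.
  by rewrite (le_trans (gD _ xN))// ler_norm.
(* Only one of the two points has to lie in the ball: [f] itself is estimated at [x] alone, while
   [g] is bounded everywhere. *)
have aux x y : `|x| <= N -> `|f x * g x - f y * g y| <= (`|C| * M + `|D| * L) * `|x - y|.
  move=> xN; rewrite (_ : _ - _ = f x * (g x - g y) + g y * (f x - f y)); last by ring.
  rewrite (le_trans (ler_normD _ _))// mulrDl !normrM -!mulrA lerD// ler_pM//.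
  by rewrite (le_trans (fC _ xN))// ler_norm.
exists (`|C| * M + `|D| * L) => x y.
have [xN|xN] := leP `|x| N; first exact: aux.
have [yN|yN] := leP `|y| N; first by rewrite distrC (distrC x); exact: aux.
by rewrite !gN// !mulr0 subrr normr0 mulr_ge0// addr_ge0// mulr_ge0.
Qed.

Lemma Lip_comp f g : Lip f -> Lip g -> Lip (f \o g).
Proof.
move=> /Lip_ge0[L L0 fL] /Lip_ge0[M M0 gM]; exists (L * M) => x y /=.
by rewrite (le_trans (fL _ _))// -mulrA ler_wpM2l.
Qed.

(* Translation invariance makes the integral of every difference quotient of
   [G] vanish; dominated convergence passes to the limit. *)
Lemma Rintegral_deriv_Lip (G g : R -> R) : Lip G ->
  (exists N, forall x, N < `|x| -> G x = 0) ->
  bms nrm1 g ->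
  {ae leb R, forall x : R, is_derive x (1 : R) G (g x)} ->
  \int[leb R]_x g x = 0.
Proof.
move=> LG [N G0] bg Gg.
have bG : bms nrm1 G.
  split; first exact: Lip_measurable.
  have [C GC] := Lip_bounded LG N.
  exists (Num.max `|C| N); split=> x.
    have [xN|/G0 ->] := leP `|x| N; last by rewrite normr0 le_max normr_ge0.
    by rewrite le_max (le_trans (GC _ xN))// ler_norm.
  by rewrite gt_max => /andP[_ /G0].
have /Lip_ge0[L L0 GL] := LG.
pose h (n : nat) : R := n.+1%:R^-1.
have h0 n : 0 < h n by rewrite invr_gt0.
pose q n x := (h n)^-1 * (G (x + h n) - G x).
have bq n : bms nrm1 (q n).
  apply: bmsMl; first exact/bnd_lbd/bnd_cst.
  by apply: bmsB => //; exact: bms_shift.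
have q0 n : \int[leb R]_x q n x = 0.
  rewrite RintegralZl//; last first.
    by apply: integrable_bms; apply: bmsB => //; exact: bms_shift.
  rewrite RintegralB//; [|by apply: integrable_bms; exact: bms_shift|exact: integrable_bms].
  by rewrite Rintegral_shift// subrr mulr0.
(* The difference quotients are bounded by the Lipschitz constant and live in the support enlarged
   by 1, because [h n <= 1]. *)
pose D x := L * \1_(`[- (`|N| + 1), `|N| + 1]%classic) x.
have bD : bms nrm1 D.
  split; first exact: measurable_funM.
  exists (Num.max L (`|N| + 1)); split=> x.
    rewrite /D indicE le_max; apply/orP; left.
    by case: (_ \in _); rewrite ?mulr1 ?mulr0 ger0_norm.
  rewrite gt_max => /andP[_ xN]; rewrite /D indicE memNset ?mulr0//=.
  by rewrite in_itv/= -ler_norml leNgt xN.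
have qD n x : `|q n x| <= D x.
  rewrite /D indicE; have [xN|xN] := leP `|x| (`|N| + 1).
    rewrite mem_set/=; last by rewrite in_itv/= -ler_norml.
    rewrite mulr1 /q normrM gtr0_norm ?invr_gt0// mulrC ler_pdivrMr//.
    by rewrite (le_trans (GL _ _))// addrAC subrr add0r gtr0_norm.
  rewrite memNset/= ?mulr0; last by rewrite in_itv/= -ler_norml leNgt xN.
  have n1 : h n <= 1 by rewrite invf_le1// ler1n.
  rewrite /q !G0 ?subrr ?mulr0 ?normr0//.
    by rewrite (le_lt_trans (ler_norm _))// (lt_trans _ xN)// ltrDl.
  rewrite (le_lt_trans (ler_norm _))// -(ltrD2r 1) (lt_le_trans xN)//.
  rewrite -{1}(addrK (h n) x) (le_trans (ler_normB _ _))// lerD2l.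
  by rewrite gtr0_norm.
have [] := @dominated_convergence _ _ _ (leb R) [set: R] measurableT
    (fun n x => (q n x)%:E) (EFin \o g) (EFin \o D).
- by move=> n; apply/measurable_EFinP; case: (bq n).
- by apply/measurable_EFinP; case: bg.
- apply: aeS Gg => x [dG G'x] _; apply: cvg_EFin.
    exact: nearW.
  rewrite -G'x.
  have dGc : (fun h => h^-1 *: ((G \o shift x) (h *: 1) - G x)) @ 0^' -->
    'D_1 G x := dG.
  have /cvg_at_rightP/(_ h) H := cvg_dnbhs_at_right dGc.
  have {}H := H (conj h0 (@cvg_harmonic R)).
  rewrite (_ : fine \o _ = fun n =>
    (h n)^-1 *: ((G \o shift x) (h n *: 1) - G x)); first exact: H.
  apply/funext => n /=; rewrite /q (addrC x).
  by rewrite (_ : (h n)%:A = h n :> R) //; exact: mulr1.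
- exact: integrable_bms.
- by apply: aeW => x n _; rewrite /= lee_fin.
move=> _ _; rewrite (_ : (fun _ => _) = cst 0%E); last first.
  apply/funext => n /=; rewrite -Rintegral_EFin ?q0//; exact: integrable_bms.
move=> /cvg_lim; rewrite lim_cst// => /(_ (@ereal_hausdorff _)).
by rewrite /Rintegral => <-.
Qed.

End translation.

(** * Primitives of bounded functions and their derivatives almost everywhere *)

Section primitive.
Context {R : realType}.
Implicit Types (h : R -> R) (x y t : R).

(* [kern t x] turns the integral from 0 to x, signed when x < 0, into an integral
   over R. *)
Definition kern t x : R := (0 < t <= x)%R%:R - (x < t <= 0)%R%:R.

Definition prim h x := \int[leb R]_t (h t * kern t x).

Lemma measurable_itv_ind d (T : measurableType d) (f g k : T -> R) :
  measurable_fun [set: T] f -> measurable_fun [set: T] g ->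
  measurable_fun [set: T] k -> measurable_fun [set: T] (fun z => (f z < g z <= k z)%R%:R : R).
Proof.
move=> mf mg mk.
have mfg : measurable_fun [set: T] (fun z => f z < g z) by exact: measurable_fun_ltr.
have mgk : measurable_fun [set: T] (fun z => g z <= k z) by exact: measurable_fun_ler.
rewrite (_ : (fun z => _) = (fun b : bool => b%:R : R) \o
  (fun z => (f z < g z) && (g z <= k z)))//.
by apply: measurableT_comp => //; exact: measurable_and.
Qed.

Lemma kernB t x y : y <= x -> kern t x - kern t y = (y < t <= x)%R%:R.
Proof.
rewrite /kern !ltNge => yx.
have : (t <= y) ==> (t <= x) by apply/implyP => /le_trans; apply.
by case: (t <= 0); case: (t <= x); case: (t <= y) => //= _; lra.
Qed.

Lemma kern0 t : kern t 0 = 0.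
Proof. by rewrite /kern; case: (0 < t <= 0); rewrite subrr. Qed.

Lemma kern_le1 t x : `|kern t x| <= 1.
Proof.
rewrite /kern !ltNge; case: (t <= 0); case: (t <= x) => //=;
  by rewrite ?subrr ?subr0 ?sub0r ?normrN ?normr0 ?normr1.
Qed.

Lemma measurable_kern d (T : measurableType d) (f g : T -> R) :
  measurable_fun [set: T] f -> measurable_fun [set: T] g ->
  measurable_fun [set: T] (fun z => kern (f z) (g z)).
Proof. by move=> mf mg; apply: measurable_funB; exact: measurable_itv_ind. Qed.

Lemma kern_bms x : bms nrm1 (fun t => kern t x).
Proof.
split; first exact: measurable_kern.
exists (Num.max 1 `|x|); split => t; first by rewrite le_max kern_le1.
rewrite gt_max => /andP[_]; rewrite /nrm1 /kern !ltNge.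
have [t0|t0] := leP t 0; have [tx|tx] := leP t x; rewrite /= ?subrr//.
  rewrite ler0_norm// => /negP ht; exfalso; apply: ht.
  by rewrite -normrN (le_trans _ (ler_norm _))// lerN2 ltW.
rewrite gtr0_norm// => /negP ht; exfalso; apply: ht.
by rewrite (le_trans tx)// ler_norm.
Qed.

Lemma prim_bms h x : bnd h -> bms nrm1 (fun t => h t * kern t x).
Proof. by move=> bh; apply: bmsMl (kern_bms x); exact: bnd_lbd. Qed.

Lemma prim_int h x : bnd h ->
  (leb R).-integrable [set: R] (fun t => (h t * kern t x)%:E).
Proof. by move=> /(prim_bms x)/integrable_bms. Qed.

Lemma prim0 h : prim h 0 = 0.
Proof.
rewrite /prim (_ : (fun t => _) = cst 0) ?Rintegral_cst ?mul0r//.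
by apply/funext => t; rewrite kern0 mulr0.
Qed.

Lemma primB h x y : bnd h -> y <= x ->
  prim h x - prim h y = \int[leb R]_t (h t * (y < t <= x)%R%:R).
Proof.
move=> bh yx; rewrite /prim -RintegralB//.
- by apply: eq_Rintegral => t _; rewrite -(kernB t yx) [in RHS]mulrBr.
- exact: (prim_int x bh).
- exact: (prim_int y bh).
Qed.

Lemma prim_Lip_bound h C : measurable_fun [set: R] h -> (forall t, `|h t| <= C) ->
  forall x y, `|prim h x - prim h y| <= C * `|x - y|.
Proof.
move=> mh hC.
suff H x y : y <= x -> `|prim h x - prim h y| <= C * `|x - y|.
  move=> x y; have [|/ltW xy] := leP y x; first exact: H.
  by rewrite distrC (distrC x); exact: H.
move=> yx; rewrite primB//; last by split => //; exists C.
pose k t : R := (y < t <= x)%R%:R.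
have bk : bms nrm1 k.
  rewrite (_ : k = fun t => kern t x - kern t y).
    by apply: bmsB; exact: kern_bms.
  by apply/funext => t; rewrite kernB.
have bhk : bms nrm1 (fun t => h t * k t).
  by apply: bmsMl => //; apply: bnd_lbd; split => //; exists C.
apply: le_trans (le_normr_Rintegral _ _) _ => //; first exact: integrable_bms.
rewrite (@le_trans _ _ (\int[leb R]_t (C * k t)))//.
  apply: le_Rintegral => //.
  - apply: integrable_bms; split; first by apply: measurableT_comp => //; case: bhk.
    have [_ [N [hN h0]]] := bhk; exists N; split => t; first by rewrite normr_id.
    by move=> /h0 ->; rewrite normr0.
  - by apply: integrable_bms; apply: bmsMl => //; exact/bnd_lbd/bnd_cst.
  - by move=> t _; rewrite normrM ler_pM// /k; case: (_ && _); rewrite ?normr1 ?normr0.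
rewrite RintegralZl//; last exact: integrable_bms.
rewrite ler_wpM2l//; first by rewrite (le_trans _ (hC 0)).
rewrite (_ : k = \1_(`]y, x]%classic)); last first.
  apply/funext => t; rewrite /k indicE; congr (_%:R).
  by case: (boolP (t \in _)) => [|/negP]; rewrite inE/= in_itv/= => h'; [rewrite h'|apply/eqP; rewrite eqb0; apply/negP].
rewrite /Rintegral integral_indic// setIT.
rewrite -[X in fine X]/(leb R (`]y, x]%classic : set R)) lebesgue_measure_itv/= lte_fin.
by case: ifPn => //= _; rewrite ler_norm.
Qed.

Lemma prim_Lip h : bnd h -> Lip (prim h).
Proof. by move=> [mh [C hC]]; exists C; exact: prim_Lip_bound. Qed.


Lemma patch_itv h a b t : (h \_ `]a, b]) t = h t * (a < t <= b)%R%:R.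
Proof.
rewrite patchE; case: ifPn => [|/negP]; rewrite inE/= in_itv/=.
  by move=> ->; rewrite mulr1.
by move=> /negP/negbTE ->; rewrite mulr0.
Qed.

Lemma is_derive_near (f g : R -> R) c (df : R) :
  is_derive (c : R) (1 : R) f df -> (\forall y \near c, f y = g y) ->
  is_derive (c : R) (1 : R) g df.
Proof. by move=> fd fg; exact: near_eq_is_derive fd. Qed.

Lemma bnd_integrable h (A : set R) : bnd h -> measurable A ->
  (leb R A < +oo)%E -> (leb R).-integrable A (EFin \o h).
Proof.
move=> [mh [C hC]] mA Afin; apply: measurable_bounded_integrable => //.
  exact: (measurable_funS measurableT).
exists C; split; first by rewrite num_real.
by move=> y Cy x _ /=; apply: le_trans (hC x) _; exact: ltW.
Qed.

Lemma bnd_integrable_itv h x y : bnd h ->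
  (leb R).-integrable `]x, y] (EFin \o h).
Proof.
move=> bh; apply: bnd_integrable => //.
rewrite -[X in (X < _)%E]/(leb R (`]x, y]%classic : set R)) lebesgue_measure_itv/=.
by case: ifPn => // _; rewrite -EFinB ltry.
Qed.

Lemma bnd_locally_integrable h : bnd h -> locally_integrable [set: R] h.
Proof.
move=> bh; split => //; [by case: bh|exact: openT|].
move=> K _ cK; have mK := compact_measurable cK.
by have /integrableP[] := bnd_integrable bh mK (compact_finite_measure cK).
Qed.

Lemma prim_is_derive h (N x : R) : bnd h -> N < x ->
  (let F y := \int[leb R]_(t in `]N, y]) h t in
    derivable F x 1 /\ derive1 F x = h x) ->
  is_derive (x : R) (1 : R) (prim h) (h x).
Proof.
move=> bh Nx /= [Fd Fx].
rewrite -Fx derive1E; pose F y := \int[leb R]_(t in `]N, y]) h t.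
have dF : is_derive (x : R) (1 : R) F ('D_1 F x) by exact: derivableP.
have dF' : is_derive (x : R) (1 : R) (fun y => prim h N + F y) ('D_1 F x).
  apply: (is_derive_eq (is_deriveD (is_derive_cst (prim h N) x 1) dF)).
  exact: add0r.
apply: is_derive_near dF' _.
exists (x - N); first by rewrite /= subr_gt0.
move=> y /=; rewrite ltr_distlC => /andP[xy _].
have Ny : N <= y by rewrite ltW// (le_lt_trans _ xy)// opprB addrC subrK.
rewrite -[RHS](subrK (prim h N)) addrC primB//; congr (_ + _).
rewrite /F Rintegral_mkcond; apply: eq_Rintegral => t _.
exact: patch_itv.
Qed.

Lemma prim_ae h : bnd h ->
  {ae leb R, forall x : R, is_derive x (1 : R) (prim h) (h x)}.
Proof.
move=> bh.
(* The differentiation theorem concerns integrals from a fixed left end, here -N; countably many of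
   them cover the line. *)
have H (N : nat) : {ae leb R, forall x : R, - N%:R < x ->
    is_derive x (1 : R) (prim h) (h x)}.
  have := @FTC1 R h (BRight (- N%:R)) _ (bnd_locally_integrable bh).
  move=> /(_ (fun y => bnd_integrable_itv _ y bh)) /=; apply: aeS => x h1 Nx.
  by apply: (prim_is_derive bh Nx); exact: h1.
have /ae_countable := H; apply: aeS => x /(_ (Num.trunc (- x)).+1); apply.
by rewrite ltrNl truncnS_gt.
Qed.

Lemma prim_continuous_is_derive h : bnd h -> continuous h ->
  forall x : R, is_derive x (1 : R) (prim h) (h x).
Proof.
move=> bh ch x.
have x1 : x - 1 < x by rewrite ltrBlDr ltrDl.
apply: (prim_is_derive bh x1).
have xx1 : x < x + 1 by rewrite ltrDl.
by have := continuous_FTC1 xx1 (bnd_integrable_itv (x - 1) _ bh) x1 (ch x).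
Qed.

(** Almost every point of the level set of [prim h] is a density point at which [prim h] has
    derivative [h]. A non-zero derivative would isolate the point in its level set, and the density
    there would be 0. The density theorem is applied to the level set, which is measurable, and not
    to [S]. *)
Lemma prim_const_zero h (S : R -> Prop) K : bnd h ->
  {ae leb R, forall x, S x -> prim h x = K} ->
  {ae leb R, forall x, S x -> h x = 0}.
Proof.
move=> bh SK; pose E := prim h @^-1` [set K].
have mE : measurable E.
  by rewrite -[E]setTI; apply: Lip_measurable => //; exact: prim_Lip.
have dE := lebesgue_density mE.
apply: aeS3 SK (prim_ae bh) dE => x xK dx dE Sx; apply: contrapT => hx0.
have Ex : E x by exact: xK.
have [e /= e0 he] : exists2 e : R, 0 < e & forall z, 0 < `|z| < e -> prim h (z + x) != K.
  have [dhx Dhx] := dx.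
  have dhc : (fun z => z^-1 *: ((prim h \o shift x) (z *: 1) - prim h x)) @ (0 : R)^' -->
    'D_1 (prim h) x := dhx.
  move/cvgrPdist_lt : dhc; rewrite Dhx => /(_ `|h x|).
  rewrite normr_gt0 => /(_ (introN eqP hx0)) -[e /= e0 he]; exists e => // z /andP[z0 ze].
  have := he z; rewrite /= sub0r normrN => /(_ ze); rewrite -normr_gt0 => /(_ z0).
  rewrite [z%:A]mulr1 -(xK Sx); apply: contraTneq => ->.
  by rewrite subrr scaler0 subr0 ltxx.
have dE0 : (leb R (E `&` ball (x : R) r) * (leb R (ball (x : R) r))^-1)%E @[r --> (0 : R)^'+] --> 0%E.
  apply: cvg_near_cst; near=> r.
  have -> : E `&` ball (x : R) r = [set (x : R)].
    apply/seteqP; split => y /=; rewrite /ball/=.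
      move=> [Ey xy]; apply: contrapT => /eqP yx.
      have := he (y - x); rewrite subrK.
      have -> : 0 < `|y - x| < e.
        rewrite normr_gt0 subr_eq0 yx distrC (lt_le_trans xy)//.
        by near: r; exact: nbhs_right_le.
      by move=> /(_ isT) /eqP; apply; exact: Ey.
    move=> ->; split => //; rewrite subrr normr0.
    by near: r; exact: nbhs_right_gt.
  by rewrite lebesgue_measure_set1 mul0e.
have : (\1_E x)%:E = 0%E :> \bar R.
  by apply: (cvg_unique (@ereal_hausdorff R) dE dE0); exact: fmap_proper_filter.
by rewrite indicE mem_set// => -[/eqP]; rewrite oner_eq0.
Unshelve. all: by end_near. Qed.

Lemma measurable_prim2 (al : R * R -> R) : bnd al ->
  measurable_fun [set: R * R] (fun z => prim (fun t => al (z.1, t)) z.2).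
Proof.
move=> bal; rewrite /prim.
apply: (@measurable_int1 R _ _ _ (measurableTypeR R) (leb R)
  (fun w : (R * R) * R => al (w.1.1, w.2) * kern w.2 w.1.2)).
  move=> z; apply: (prim_int z.2 (h := fun t => al (z.1, t))).
  have [mal [C hC]] := bal; split; last by exists C.
  exact: measurable_slice1.
apply: measurable_funM.
  case: bal => mal _; apply: (measurableT_comp mal).
  by apply: measurable_fun_pair => //; exact: measurableT_comp.
by apply: measurable_kern => //; exact: measurableT_comp.
Qed.

Lemma bnd_slice1 (al : R * R -> R) x : bnd al -> bnd (fun t => al (x, t)).
Proof. by move=> [mal [C hC]]; split; [exact: measurable_slice1|exists C]. Qed.

Lemma bnd_slice2 (al : R * R -> R) y : bnd al -> bnd (fun t => al (t, y)).
Proof. by move=> [mal [C hC]]; split; [exact: measurable_slice2|exists C]. Qed.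

Lemma lbd_prim2 (al : R * R -> R) : bnd al ->
  lbd nrm2 (fun z => prim (fun t => al (z.1, t)) z.2).
Proof.
move=> bal; split; first exact: measurable_prim2.
have [mal [C hC]] := bal => N; exists (C * N) => -[x y].
rewrite nrmX_le/= => /andP[_ yN].
rewrite -[prim _ _]subr0 -(prim0 (fun t => al (x, t))).
apply: le_trans (prim_Lip_bound (C := C) _ _ _ _) _ => //.
  exact: measurable_slice1.
by rewrite subr0 ler_wpM2l// (le_trans _ (hC (0, 0))).
Qed.

End primitive.

(** * Smooth test functions of one variable *)

Section smooth1.
Context {R : realType}.
Implicit Types (f g : R -> R) (x y : R).

(** [Cn n] asks for n + 1 derivatives, so that each order, 0 included, yields derivability. *)
Fixpoint Cn n f : Prop := (forall x : R, derivable f x 1) /\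
  (if n is m.+1 then Cn m (derive1 f) else True).

Definition smooth1 f := forall n, Cn n f.

Lemma is_derive_fun f g : (forall x : R, is_derive x (1 : R) f (g x)) -> derive1 f = g.
Proof. by move=> fg; apply/funext => x; rewrite derive1E (@derive_val _ _ _ _ _ _ _ (fg x)). Qed.

Lemma derivable_is_derive f : (forall x : R, derivable f x 1) ->
  forall x : R, is_derive x (1 : R) f (derive1 f x).
Proof. by move=> df x; rewrite derive1E; exact: derivableP. Qed.

Lemma CnS n f g : (forall x : R, is_derive x (1 : R) f (g x)) -> Cn n g -> Cn n.+1 f.
Proof. by move=> fg gn; split; [move=> x; case: (fg x)|rewrite (is_derive_fun fg)]. Qed.

Lemma Cn0 f g : (forall x : R, is_derive x (1 : R) f (g x)) -> Cn 0 f.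
Proof. by move=> fg; split => // x; case: (fg x). Qed.

Lemma Cn_derivable n f : Cn n f -> forall x : R, is_derive x (1 : R) f (derive1 f x).
Proof. by case: n => [|n] [df _]; exact: derivable_is_derive. Qed.

Lemma CnW n f : Cn n.+1 f -> Cn n f.
Proof.
by elim: n f => [|n IH] f [df Cf]; split=> //; apply: IH.
Qed.

Lemma Cn_cst n c : Cn n (cst c).
Proof.
elim: n c => [|n IH] c; first exact: (Cn0 (g := cst 0)).
exact: (CnS (g := cst 0)).
Qed.

Lemma CnD n f g : Cn n f -> Cn n g -> Cn n (fun x => f x + g x).
Proof.
elim: n f g => [|n IH] f g Cf Cg;
  have fd x := Cn_derivable Cf x; have gd x := Cn_derivable Cg x.
  exact: (Cn0 (fun x => is_deriveD (fd x) (gd x))).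
apply: (CnS (fun x => is_deriveD (fd x) (gd x))).
by apply: IH; [case: Cf|case: Cg].
Qed.

Lemma is_deriveMR f g x (df dg : R) : is_derive (x : R) (1 : R) f df ->
  is_derive (x : R) (1 : R) g dg ->
  is_derive (x : R) (1 : R) (fun y => f y * g y) (df * g x + f x * dg).
Proof.
move=> fd gd; apply: (is_derive_eq (is_deriveM fd gd)).
by rewrite addrC; congr (_ + _); rewrite -mulrC.
Qed.

Lemma CnM n f g : Cn n f -> Cn n g -> Cn n (fun x => f x * g x).
Proof.
elim: n f g => [|n IH] f g Cf Cg;
  have fd x := Cn_derivable Cf x; have gd x := Cn_derivable Cg x.
  exact: (Cn0 (fun x => is_deriveMR (fd x) (gd x))).
apply: (CnS (fun x => is_deriveMR (fd x) (gd x))).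
apply: CnD; apply: IH; do ?exact: CnW; by [case: Cf|case: Cg].
Qed.

Lemma is_derive_affine f a b x (df : R) : is_derive (a * x + b : R) (1 : R) f df ->
  is_derive (x : R) (1 : R) (fun y => f (a * y + b)) (a * df).
Proof.
move=> fd.
have gd : is_derive (x : R) (1 : R) (fun y : R => a * y + b) a.
  apply: (is_derive_eq (is_deriveD (is_deriveZ a (is_derive_id x 1)) (is_derive_cst b x 1))).
  by rewrite addr0; exact: mulr1.
apply: (is_derive_eq (is_derive1_comp (g := fun y => a * y + b) fd gd)).
exact: mulrC.
Qed.

Lemma Cn_affine n f a b : Cn n f -> Cn n (fun x => f (a * x + b)).
Proof.
elim: n f => [|n IH] f Cf; have fd x := Cn_derivable Cf x.
  exact: (Cn0 (fun x => is_derive_affine (fd (a * x + b)))).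
apply: (CnS (fun x => is_derive_affine (fd (a * x + b)))).
by apply: (@CnM _ (cst a)); [exact: Cn_cst|apply: IH; case: Cf].
Qed.

Lemma smooth1_deriv f : smooth1 f -> smooth1 (derive1 f).
Proof. by move=> Cf n; case: (Cf n.+1). Qed.

Lemma smooth1D f g : smooth1 f -> smooth1 g -> smooth1 (fun x => f x + g x).
Proof. by move=> Cf Cg n; exact: CnD. Qed.

Lemma smooth1M f g : smooth1 f -> smooth1 g -> smooth1 (fun x => f x * g x).
Proof. by move=> Cf Cg n; exact: CnM. Qed.

Lemma smooth1_cst c : smooth1 (cst c).
Proof. by move=> n; exact: Cn_cst. Qed.

Lemma smooth1_affine f a b : smooth1 f -> smooth1 (fun x => f (a * x + b)).
Proof. by move=> Cf n; exact: Cn_affine. Qed.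

Lemma smooth1_is_derive f : smooth1 f -> forall x : R, is_derive x (1 : R) f (derive1 f x).
Proof. by move=> /(_ 0%N); exact: Cn_derivable. Qed.

Lemma smooth1_continuous f : smooth1 f -> continuous f.
Proof.
move=> /smooth1_is_derive fd x.
by apply: differentiable_continuous; apply/derivable1_diffP; case: (fd x).
Qed.

(* The functions x ^- k * exp (- 1 / x) (extended by 0) are closed under
   differentiation up to linear combinations. *)
Definition flat k x : R := if 0 < x then x ^- k * expR (- x^-1) else 0.

(** The Taylor term of order k + 2 of the exponential at 1/x beats the pole of order k and leaves a
    factor x^2, which gives derivative 0 at the origin. *)
Lemma flat_bound k x : `|flat k x| <= (k.+2)`!%:R * x ^+ 2.
Proof.
rewrite /flat; have [x0|x0] := ltP 0 x; last first.
  by rewrite normr0 mulr_ge0// sqr_ge0.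
have ix0 : 0 < x^-1 by rewrite invr_gt0.
have xk : 0 < x ^- k by rewrite invr_gt0 exprn_gt0.
rewrite gtr0_norm ?mulr_gt0 ?expR_gt0// expRN.
rewrite ler_pdivrMr ?expR_gt0//.
apply: le_trans (_ : _ <= (k.+2)`!%:R * x ^+ 2 * (1 + x^-1 ^+ k.+2 / (k.+2)`!%:R)) _.
  have kf : (k.+2)`!%:R != 0 :> R by rewrite pnatr_eq0 -lt0n fact_gt0.
  rewrite mulrDr mulr1 [X in _ <= _ + X](_ : _ = x ^- k).
    by rewrite lerDr mulr_ge0// sqr_ge0.
  rewrite -addn2 exprD -exprVn [_ / _]mulrC [x^-1 ^+ 2]exprVn.
  by field; rewrite gt_eqF//= addn2.
apply: ler_wpM2l; first by rewrite mulr_ge0 ?sqr_ge0.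
exact: (@expR_ge1Dxn R _ k.+1 (ltW ix0)).
Qed.

Lemma is_derive_sqr0 f C : (forall x, `|f x| <= C * x ^+ 2) ->
  is_derive (0 : R) (1 : R) f 0.
Proof.
move=> fC.
have f0 : f 0 = 0.
  by apply/normr0_eq0/eqP; rewrite eq_le normr_ge0 andbT (le_trans (fC 0))// expr0n mulr0.
have fc : (fun h => h^-1 *: ((f \o shift 0) (h *: 1) - f 0)) @ (0 : R)^' --> (0 : R).
  apply/cvgrPdist_le => e e0; exists (e / (`|C| + 1)); first by rewrite /= divr_gt0// ltr_wpDl.
  move=> h /=; rewrite !sub0r !normrN => he h0.
  rewrite [h%:A]mulr1 addr0 f0 subr0 [_ *: _]/(h^-1 * _) normrM normfV.
  rewrite ler_pdivrMl ?normr_gt0// (le_trans (fC h))//.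
  have -> : h ^+ 2 = `|h| * `|h| by rewrite -normrM -expr2 ger0_norm ?sqr_ge0.
  rewrite mulrA [leLHS]mulrC; apply: ler_wpM2l => //.
  rewrite (@le_trans _ _ ((`|C| + 1) * `|h|))//.
    by rewrite ler_wpM2r// (le_trans (ler_norm _))// lerDl.
  by rewrite mulrC -ler_pdivlMr ?ltr_wpDl// ltW.
apply: DeriveDef; first by apply/cvg_ex; exists 0.
exact: (cvg_lim (@Rhausdorff R) fc).
Qed.

Lemma is_derive_flat k x :
  is_derive (x : R) (1 : R) (flat k) (- k%:R * flat k.+1 x + flat k.+2 x).
Proof.
have [x0|x0|->] := ltrgtP x 0.
- apply: (@is_derive_near R (cst 0)).
    rewrite /flat ltNge ltW//= mulr0 addr0; exact: is_derive_cst.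
  exists (- x); first by rewrite /= oppr_gt0.
  move=> y /=; rewrite ltr_distlC => /andP[_]; rewrite subrr => y0.
  by rewrite /flat ltNge ltW.
- have dV : is_derive (x : R) (1 : R) (fun y => y^-1) (- x ^- 2).
    have := @is_deriveV R id x 1 1; rewrite gt_eqF// => /(_ isT) d.
    apply: (is_derive_eq (d _)).
    by rewrite -[RHS]mulr1.
  have dE : is_derive (x : R) (1 : R) (fun y => expR (- y^-1)) (expR (- x^-1) * x ^- 2).
    apply: (is_derive_eq (is_derive1_comp (g := fun y => - y^-1) (is_derive_expR _) (is_deriveN dV))).
    by rewrite opprK.
  have dX : is_derive (x : R) (1 : R) (fun y => y^-1 ^+ k) (- k%:R * x ^- k.+1).
    have -> : (fun y : R => y^-1 ^+ k) = (fun y : R => y^-1) ^+ k.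
      by apply/funext => y; rewrite exprfctE.
    apply: (is_derive_eq (is_deriveX k dV)).
    transitivity (k%:R * x^-1 ^+ k.-1 * (- x ^- 2) : R); first by [].
    case: k => [|n]; first by rewrite oppr0 !mul0r.
    rewrite mulrN mulNr -mulrA; congr (- (_ * _)).
    by rewrite /= -!exprVn -exprD addn2.
  apply: (@is_derive_near R (fun y => y^-1 ^+ k * expR (- y^-1))).
    apply: (is_derive_eq (is_deriveMR dX dE)).
    rewrite /flat x0; congr (_ + _); first by rewrite mulrA.
    by rewrite mulrCA [RHS]mulrC exprVn -invfM -exprD addn2.
  exists x; first by [].
  move=> y /=; rewrite ltr_distlC => /andP[+ _]; rewrite subrr => y0.
  by rewrite /flat y0 exprVn.
- rewrite /flat ltxx mulr0 addr0; apply: (@is_derive_sqr0 _ (k.+2)`!%:R).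
  exact: flat_bound.
Qed.

Lemma Cn_flat n k : Cn n (flat k).
Proof.
elim: n k => [|n IH] k; first exact: (Cn0 (is_derive_flat k)).
apply: (CnS (is_derive_flat k)); apply: CnD => //.
by apply: (@CnM _ (cst _)) => //; exact: Cn_cst.
Qed.

Definition test1 f := smooth1 f /\ exists N : R, forall x, N < `|x| -> f x = 0.

(* For p < q these smooth functions increase to the indicator of ]p, q[ as n
   tends to infinity. *)
Definition eta (n : nat) (p q : R) : R -> R :=
  fun x => flat 0 (n.+1%:R * (x - p)) * flat 0 (n.+1%:R * (q - x)).

Lemma flat0E x : flat 0 x = if 0 < x then expR (- x^-1) else 0.
Proof. by rewrite /flat expr0 invr1 mul1r. Qed.

Lemma flat0_ge0 x : 0 <= flat 0 x.
Proof. by rewrite flat0E; case: ifPn => // _; exact: expR_ge0. Qed.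

Lemma flat0_le1 x : flat 0 x <= 1.
Proof.
rewrite flat0E; case: ifPn => // x0; rewrite -expR0 ler_expR oppr_le0 invr_ge0.
exact: ltW.
Qed.

Lemma eta_ge0 n p q x : 0 <= eta n p q x.
Proof. by rewrite mulr_ge0 ?flat0_ge0. Qed.

Lemma eta_le1 n p q x : eta n p q x <= 1.
Proof. by rewrite mulr_ile1 ?flat0_ge0 ?flat0_le1. Qed.

Lemma eta_gt0 n p q x : p < x < q -> 0 < eta n p q x.
Proof.
move=> /andP[px xq].
by rewrite mulr_gt0// flat0E mulr_gt0 ?expR_gt0 ?subr_gt0.
Qed.

Lemma flat0_le0 x : x <= 0 -> flat 0 x = 0.
Proof. by move=> x0; rewrite flat0E ltNge x0. Qed.

Lemma eta_out n p q x : ~~ (p < x < q) -> eta n p q x = 0.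
Proof.
rewrite negb_and -!leNgt /eta => /orP[xp|qx].
  by rewrite flat0_le0 ?mul0r// mulr_ge0_le0// subr_le0.
by rewrite [X in _ * X]flat0_le0 ?mulr0// mulr_ge0_le0// subr_le0.
Qed.

Lemma eta_test n p q : test1 (eta n p q).
Proof.
split.
  apply: smooth1M.
    rewrite (_ : (fun x => _) = fun x => flat 0 (n.+1%:R * x + (- (n.+1%:R * p)))).
      by apply: smooth1_affine => m; exact: Cn_flat.
    by apply/funext => x; rewrite mulrBr.
  rewrite (_ : (fun x => _) = fun x => flat 0 ((- n.+1%:R) * x + n.+1%:R * q)).
    by apply: smooth1_affine => m; exact: Cn_flat.
  by apply/funext => x; rewrite mulrBr mulNr addrC.
exists (Num.max `|p| `|q|) => x; rewrite gt_max => /andP[px qx].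
apply: eta_out; apply/negP => /andP[h1 h2].
have [x0|x0] := leP 0 x.
  move: qx; rewrite (ger0_norm x0) ltNge => /negP; apply.
  by rewrite (le_trans (ltW h2))// ler_norm.
move: px; rewrite (ltr0_norm x0) ltNge => /negP; apply.
by rewrite -normrN (le_trans _ (ler_norm _))// lerN2 ltW.
Qed.

Lemma eta_cvg p q x : eta n p q x @[n --> \oo] --> ((p < x < q)%R%:R : R).
Proof.
have [/[dup] pxq /andP[px xq]|h] := boolP (p < x < q); last first.
  by under eq_fun do rewrite eta_out//; exact: cvg_cst.
have H (a : R) : 0 < a -> flat 0 (n.+1%:R * a) @[n --> \oo] --> (1 : R).
  move=> a0.
  have -> : (fun n => flat 0 (n.+1%:R * a)) =
      expR \o (fun n : nat => - (a^-1 * n.+1%:R^-1)).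
    by apply/funext => n; rewrite flat0E ifT ?mulr_gt0//= invfM mulrC.
  have c0 : (fun n => - (a^-1 * (n.+1%:R)^-1)) @ \oo --> (0 : R).
    rewrite -[X in _ --> X]oppr0; apply: cvgN; rewrite -(mulr0 a^-1).
    by apply: cvgMr; exact: cvg_harmonic.
  have := @continuous_cvg _ _ _ _ _ _ _ _ (@continuous_expR R 0) c0.
  by rewrite expR0; apply.
by rewrite /= -(mulr1 1); apply: cvgM; apply: H; rewrite subr_gt0.
Qed.

Lemma test1_deriv f : test1 f -> test1 (derive1 f).
Proof.
move=> [Cf [N f0]]; split; first exact: smooth1_deriv.
exists N => x Nx; rewrite derive1E.
rewrite (@near_eq_derive _ _ _ _ (cst 0)) ?derive_cst//.
exists (`|x| - N); first by rewrite /= subr_gt0.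
move=> y /= xy; apply: f0.
have := ler_normD (x - y) y; rewrite subrK; lra.
Qed.

Lemma continuous_supp_bms f (N : R) : continuous f -> (forall x, N < `|x| -> f x = 0) ->
  bms nrm1 f.
Proof.
move=> cf f0; split; first exact: continuous_measurable_fun.
have NN : - `|N| <= `|N| by rewrite -subr_ge0 opprK addr_ge0.
have [|c _ fc] := @EVT_max R (fun x => `|f x|) _ _ NN.
  apply: continuous_subspaceT => x; apply: continuous_comp; first exact: cf.
  exact: norm_continuous.
exists (Num.max `|f c| `|N|); split => x.
  have [xN|xN] := leP `|x| `|N|.
    by rewrite le_max fc// in_itv/= -ler_norml.
  by rewrite f0 ?normr0 ?le_max ?normr_ge0// (le_lt_trans _ xN)// ler_norm.
rewrite gt_max => /andP[_ xN]; apply: f0.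
by rewrite (le_lt_trans _ xN)// ler_norm.
Qed.

Lemma test1_bms f : test1 f -> bms nrm1 f.
Proof. by move=> [/smooth1_continuous cf [N f0]]; exact: continuous_supp_bms f0. Qed.

Lemma test1_bnd f : test1 f -> bnd f.
Proof. by move/test1_bms/bms_bnd. Qed.

Lemma test1_Lip f : test1 f -> Lip f.
Proof.
move=> tf; have [_ [C hC]] := test1_bnd (test1_deriv tf).
have fd := smooth1_is_derive tf.1.
exists C.
have H x y : x <= y -> `|f x - f y| <= C * `|x - y|.
  move=> xy; have [|c _] := @MVT_segment R f (derive1 f) x y xy.
    by apply: continuous_subspaceT; exact: smooth1_continuous tf.1.
  rewrite distrC => ->; rewrite normrM (distrC x) ler_wpM2r//; exact: hC.
move=> x y; have [|/ltW yx] := leP x y; first exact: H.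
by rewrite distrC (distrC x); exact: H.
Qed.

Lemma test1_integrable f : test1 f -> (leb R).-integrable [set: R] (EFin \o f).
Proof. by move/test1_bms/integrable_bms. Qed.

Lemma test1_int_deriv f : test1 f -> \int[leb R]_x derive1 f x = 0.
Proof.
move=> tf; apply: (@Rintegral_deriv_Lip R f) => //.
- exact: test1_Lip.
- by case: tf.
- by apply: test1_bms; exact: test1_deriv.
- by apply: aeW; exact: smooth1_is_derive tf.1.
Qed.

Lemma smooth1_prim f g : smooth1 g -> (forall x : R, is_derive x (1 : R) f (g x)) ->
  smooth1 f.
Proof. by move=> Cg fg [|n]; [exact: (Cn0 fg)|apply: (CnS fg)]. Qed.

Lemma test1_prim k : test1 k -> \int[leb R]_x k x = 0 ->
  exists2 f, test1 f & derive1 f = k.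
Proof.
move=> tk k0; have [Ck [N kN]] := tk.
pose M := `|N| + 1; have bk := test1_bnd tk.
have NM : N < M by rewrite (le_lt_trans (ler_norm _))// ltrDl.
(* -M lies to the left of the support of [k], so [f] vanishes on the left; the zero mean of [k]
   makes it vanish on the right. *)
pose f x := prim k x - prim k (- M).
have fd x : is_derive (x : R) (1 : R) f (k x).
  apply: (is_derive_eq (is_deriveB
    (prim_continuous_is_derive bk (smooth1_continuous Ck) x) (is_derive_cst (prim k (- M)) x 1))).
  exact: subr0.
exists f; last exact: is_derive_fun.
split; first exact: smooth1_prim fd.
exists M => x Mx; have [x0|x0] := leP 0 x.
  rewrite /f primB//; last by rewrite (le_trans _ x0)// oppr_le0 addr_ge0.
  rewrite -[RHS]k0; apply: eq_Rintegral => t _.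
  case: (boolP (- M < t <= x)) => [|h]; first by rewrite mulr1.
  rewrite kN ?mul0r//; move: h; apply: contraR; rewrite -leNgt => tN.
  have := le_lt_trans tN NM; rewrite ltr_norml => /andP[-> tM] /=.
  by rewrite ltW// (lt_trans tM)// -(ger0_norm x0).
rewrite /f; apply/eqP; rewrite -oppr_eq0 opprB primB//; last first.
  by rewrite lerNr -(ltr0_norm x0) ltW.
apply/eqP; rewrite (_ : (fun t => _) = cst 0) ?Rintegral_cst ?mul0r//.
apply/funext => t; case: (boolP (x < t <= - M)) => [/andP[_ tM]|_]; last by rewrite mulr0.
rewrite kN ?mul0r// (lt_le_trans NM)// -normrN.
by rewrite (le_trans _ (ler_norm _))// lerNr.
Qed.

End smooth1.

(** * The fundamental lemma for tensor tests *)

Section integral_tools.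
Context {R : realType} {d : measure_display} {T : measurableType d}.
Context (m : {measure set T -> \bar R}) (n : T -> R).
Hypothesis fb : finite_balls n m.

Lemma bms_abs f : bms n f -> bms n (fun x => `|f x|).
Proof.
move=> [mf [N [fN f0]]]; split; first exact: measurableT_comp.
by exists N; split => x; [rewrite normr_id|move=> /f0 ->; rewrite normr0].
Qed.

Lemma ae_eq_Rintegral (f g : T -> R) : measurable_fun [set: T] f -> measurable_fun [set: T] g ->
  {ae m, forall x, f x = g x} -> \int[m]_x f x = \int[m]_x g x.
Proof.
move=> mf mg fg; rewrite /Rintegral; congr fine; apply: ae_eq_integral => //.
- exact/measurable_EFinP.
- exact/measurable_EFinP.
- by move: fg; apply: aeS => x -> _.
Qed.

Lemma Rintegral_dct (f_ : nat -> T -> R) (f D : T -> R) : bms n D ->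
  (forall k, measurable_fun [set: T] (f_ k)) -> measurable_fun [set: T] f ->
  (forall k x, `|f_ k x| <= D x) ->
  (forall x, f_ k x @[k --> \oo] --> f x) ->
  \int[m]_x f_ k x @[k --> \oo] --> \int[m]_x f x.
Proof.
move=> bD mf_ mf fD fc.
have intD := bms_integrable fb bD.
have [] := @dominated_convergence _ _ _ m [set: T] measurableT
    (fun k x => (f_ k x)%:E) (EFin \o f) (EFin \o D).
- by move=> k; apply/measurable_EFinP.
- exact/measurable_EFinP.
- by apply: aeW => x _; apply: cvg_EFin; [exact: nearW|exact: fc].
- by [].
- by apply: aeW => x k _; rewrite /= lee_fin.
move=> intf _ cv; apply: fine_cvg.
by rewrite fineK//; exact: integrable_fin_num.
Qed.

Lemma Rintegral_eq0_ge0 f : bms n f -> (forall x, 0 <= f x) ->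
  \int[m]_x f x = 0 -> {ae m, forall x, f x = 0}.
Proof.
move=> bf f0 If.
have : (\int[m]_x `|(f x)%:E| = 0)%E.
  rewrite -[RHS]/(0%:E) -If Rintegral_EFin; last exact: bms_integrable bf.
  by apply: eq_integral => x _; rewrite /= ger0_norm.
move/ae_eq_integral_abs => /(_ measurableT).
have mf : measurable_fun [set: T] (EFin \o f) by apply/measurable_EFinP; case: bf.
by move=> /(_ mf); apply: aeS => x /(_ I) [].
Qed.

End integral_tools.

Section tensor.
Context {R : realType} {d1 d2 : measure_display}
  {T1 : measurableType d1} {T2 : measurableType d2}.
Context (m1 : {sigma_finite_measure set T1 -> \bar R})
  (m2 : {sigma_finite_measure set T2 -> \bar R}).
Context (n1 : T1 -> R) (n2 : T2 -> R).
Hypotheses (fb1 : finite_balls n1 m1) (fb2 : finite_balls n2 m2).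

Lemma bms_tensor (f : T1 -> R) (g : T2 -> R) : bms n1 f -> bms n2 g ->
  bms (nrmX n1 n2) (fun z => f z.1 * g z.2).
Proof.
move=> [mf [N [fN f0]]] [mg [M [gM g0]]]; split.
  by apply: measurable_funM; exact: measurableT_comp.
exists (Num.max (N * M) (Num.max N M)); split => -[x y].
  by rewrite normrM/= le_max ler_pM.
rewrite nrmX_lt/= !gt_max => /orP[/and3P[_ /f0 -> _]|/and3P[_ _ /g0 ->]].
  by rewrite mul0r.
by rewrite mulr0.
Qed.

Lemma lbd_slice1 (h : T1 * T2 -> R) x : lbd (nrmX n1 n2) h -> lbd n2 (fun y => h (x, y)).
Proof.
move=> [mh hb]; split; first exact: measurable_slice1.
move=> N; have [C hC] := hb (Num.max N (n1 x)); exists C => y yN; apply: hC.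
by rewrite nrmX_le/= !le_max lexx orbT yN.
Qed.

Lemma lbd_fst (f : T1 -> R) : lbd n1 f -> lbd (nrmX n1 n2) (fun z => f z.1).
Proof.
move=> [mf fb]; split; first exact: measurableT_comp.
by move=> N; have [C hC] := fb N; exists C => z; rewrite nrmX_le => /andP[/hC].
Qed.

Lemma lbd_snd (f : T2 -> R) : lbd n2 f -> lbd (nrmX n1 n2) (fun z => f z.2).
Proof.
move=> [mf fb]; split; first exact: measurableT_comp.
by move=> N; have [C hC] := fb N; exists C => z; rewrite nrmX_le => /andP[_ /hC].
Qed.

Lemma lbd_int (h : T1 * T2 -> R) (g : T2 -> R) : lbd (nrmX n1 n2) h -> bms n2 g ->
  lbd n1 (fun x => \int[m2]_y (h (x, y) * g y)).
Proof.
move=> lh bg; split.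
  apply: (@measurable_int1 _ _ _ _ _ m2 (fun z => h z * g z.2)).
    move=> x; apply: (bms_integrable fb2 (f := fun y => h (x, y) * g y)).
    by apply: bmsMl => //; exact: lbd_slice1.
  case: lh bg => mh _ [mg _].
  by apply: measurable_funM => //; exact: measurableT_comp.
move=> N; case: (bg) => [mg [G [gG g0]]]; have [mh hb] := lh.
have G0 : 0 <= G by rewrite (le_trans _ (gG point)).
have [C hC] := hb (Num.max N G).
have [K hK] := bms_int_bound (Num.max (`|C| * G) G) fb2.
exists K => x xN; apply: hK.
- by apply: measurable_funM => //; exact: measurable_slice1.
- move=> y; rewrite le_max; have [yG|yG] := leP (n2 y) G; last first.
    by rewrite g0// mulr0 normr0 mulr_ge0.
  rewrite normrM ler_pM//; apply: le_trans (ler_norm C).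
  by apply: hC; rewrite nrmX_le/= !le_max xN yG orbT.
- by move=> y; rewrite gt_max => /andP[_ /g0 ->]; rewrite mulr0.
Qed.

End tensor.

Section fundamental_lemma.
Context {R : realType}.

Lemma ae_neq (q : R) : {ae leb R, forall x : R, x <> q}.
Proof.
exists [set q]; split; [exact: measurable_set1|exact: lebesgue_measure_set1|].
by move=> x /= /contrapT.
Qed.

(** The bumps tend to indicators of intervals, so the primitive of the truncation of [h] takes equal
    values at rationals, hence is constant near 0 on ever larger balls, and [h] is its derivative.
    Only countably many tests enter, so that the exceptional sets met in [fundX] can be united. *)
Lemma fund1 (h : R -> R) : lbd nrm1 h ->
  (forall n (p q : rat), \int[leb R]_x (h x * eta n (ratr p) (ratr q) x) = 0) ->
  {ae leb R, forall x : R, h x = 0}.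
Proof.
move=> lh h0; have [mh hb] := lh.
pose hN (N : nat) x := h x * \1_([set x | `|x| <= N%:R]) x.
have mball (N : nat) : measurable [set x : R | `|x| <= N%:R].
  by apply: (measurable_ball_nrm (nrm := @nrm1 R)); exact: finite_balls1.1.
have bhN N : bnd (hN N).
  split; first by apply: measurable_funM => //; exact: measurable_indic.
  have [C hC] := hb N%:R; exists `|C| => x; rewrite /hN indicE.
  case: (boolP (_ \in _)) => [|_]; last by rewrite mulr0 normr0.
  by rewrite inE/= mulr1 => /hC /le_trans; apply; exact: ler_norm.
have H N (p q : rat) : `|ratr p : R| <= N%:R -> `|ratr q : R| <= N%:R -> p <= q ->
    prim (hN N) (ratr q) - prim (hN N) (ratr p) = 0.
  move=> pN qN pq; rewrite primB ?ler_rat//.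
  pose k (x : R) : R := (ratr p < x < ratr q)%R%:R.
  have mk : measurable_fun [set: R] k.
    rewrite (_ : k = \1_(`](ratr p), (ratr q)[%classic)); last first.
      apply/funext => t; rewrite /k indicE; congr (_%:R).
      case: (boolP (t \in _)) => [|/negP]; rewrite inE/= in_itv/=; first by move=> ->.
      by move=> /negP/negbTE ->.
    exact: measurable_indic.
  have cv : \int[leb R]_x (h x * eta j (ratr p) (ratr q) x) @[j --> \oo] -->
      \int[leb R]_x (h x * k x).
    apply: (@Rintegral_dct R _ _ (leb R) nrm1 finite_balls1 _ _ (fun x => `|hN N x|)).
    - apply: bms_abs; split; first by case: (bhN N).
      have [_ [C hC]] := bhN N; exists (Num.max C N%:R); split => x.
        by rewrite le_max hC.
      by rewrite gt_max => /andP[_ Nx]; rewrite /hN indicE memNset ?mulr0//= leNgt; apply/negP/negPn.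
    - move=> j; apply: measurable_funM => //; have := eta_test j (ratr p : R) (ratr q).
      by move=> /test1_bnd[].
    - exact: measurable_funM.
    - move=> j x; rewrite /hN indicE; have [pxq|pxq] := boolP (ratr p < x < ratr q).
        rewrite mem_set ?mulr1/=.
          by rewrite normrM ler_piMr// ger0_norm ?eta_le1// eta_ge0.
        move: pxq pN qN; rewrite !ler_norml => /andP[px xq] /andP[pN _] /andP[_ qN].
        by rewrite (le_trans pN (ltW px)) (le_trans (ltW xq)).
      by rewrite eta_out// mulr0 normr0 normr_ge0.
    - move=> x; apply: cvgMr; exact: eta_cvg.
  (* The right end point, which belongs to the interval of [primB] but is missed by the limit of the
     bumps, is a null set. *)
  transitivity (\int[leb R]_x (h x * k x)).
    apply: ae_eq_Rintegral.
    - apply: measurable_funM; first by case: (bhN N).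
      exact: measurable_itv_ind.
    - exact: measurable_funM.
    - move: (ae_neq (ratr q)); apply: aeS => x /eqP xq; rewrite /hN /k indicE.
      rewrite [x <= _]le_eqVlt (negbTE xq)/=.
      have [pxq|pxq] := boolP (ratr p < x < ratr q); last by rewrite !mulr0.
      rewrite mem_set ?mulr1//=.
      move: pxq pN qN; rewrite !ler_norml => /andP[px xq'] /andP[pN _] /andP[_ qN].
      by rewrite (le_trans pN (ltW px)) (le_trans (ltW xq')).
  move: cv; rewrite (_ : (fun j => _) = cst 0).
    by move=> /(cvg_lim (@Rhausdorff R)) <-; rewrite lim_cst//; exact: Rhausdorff.
  by apply/funext => j; exact: h0.
have P N x : `|x| < N%:R -> prim (hN N) x = prim (hN N) 0.
  move=> xN; apply/eqP; rewrite -subr_eq0 -normr_le0; apply/ler_addgt0Pr => e e0; rewrite add0r.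
  have [L L0 hL] := Lip_ge0 (prim_Lip (bhN N)).
  pose e' := Num.min (e / (L + 1)) (N%:R - `|x|).
  have e'0 : 0 < e' by rewrite lt_min divr_gt0//= ?subr_gt0// ltr_wpDl.
  have xe : x - e' < x + e' by rewrite ltrD2l -subr_gt0 opprK addr_gt0.
  have [r] := rat_in_itvoo xe; rewrite in_itv/= => /andP[xr rx].
  have xrd : `|x - ratr r| < e' by rewrite ltr_distlC; apply/andP; split.
  have rN : `|ratr r : R| <= N%:R.
    rewrite -(subrK x (ratr r)) (le_trans (ler_normD _ _))// distrC -lerBrDr.
    by rewrite (le_trans (ltW xrd))// ge_min lexx orbT.
  have N0 : `|ratr 0 : R| <= N%:R by rewrite rmorph0 normr0.
  have rE : prim (hN N) (ratr r) = prim (hN N) 0.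
    have Hr := H N 0 r N0 rN; have Hr' := H N r 0 rN N0.
    rewrite rmorph0 in Hr Hr'; have [r0|r0] := leP 0 r.
      by apply/eqP; rewrite -subr_eq0 Hr.
    by apply/eqP; rewrite eq_sym -subr_eq0 Hr'// ltW.
  rewrite -rE (le_trans (hL _ _))//.
  rewrite (@le_trans _ _ ((L + 1) * (e / (L + 1))))//; last first.
    by rewrite mulrC divfK// gt_eqF// ltr_wpDl.
  rewrite ler_pM// ?lerDl// (le_trans (ltW xrd))// ge_min lexx//.
have Z N : {ae leb R, forall x : R, `|x| < N%:R -> hN N x = 0}.
  apply: (prim_const_zero (K := prim (hN N) 0) (bhN N)).
  by apply: aeW => x xN; exact: P.
have /ae_countable := Z; apply: aeS => x /(_ (Num.trunc `|x|).+1).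
rewrite truncnS_gt => /(_ isT); rewrite /hN indicE mem_set ?mulr1//=.
by rewrite ltW// truncnS_gt.
Qed.

(** Adds one dimension: for each bump in the last variable, the partial integral of [h] is zero
    almost everywhere by the lemma on [T]. As the bumps are countably many, almost every slice of
    [h] satisfies the hypothesis of [fund1]. *)
Lemma fundX d (T : measurableType d) (m : {sigma_finite_measure set T -> \bar R})
    (n : T -> R) (TT : set (T -> R)) : finite_balls n m ->
  (forall f, TT f -> bms n f) ->
  (forall h, lbd n h -> (forall f, TT f -> \int[m]_x (h x * f x) = 0) ->
    {ae m, forall x, h x = 0}) ->
  forall h : T * R -> R, lbd (nrmX n nrm1) h ->
  (forall f g, TT f -> test1 g ->
    \int[(m \x leb R)%E]_z (h z * (f z.1 * g z.2)) = 0) ->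
  {ae (m \x leb R)%E, forall z, h z = 0}.
Proof.
move=> fb bTT fundT h lh h0; apply: prod_ae.
  rewrite (_ : [set z | _] = [set: T * R] `&` h @^-1` [set 0]).
    by apply: lh.1.
  by rewrite setTI.
have H j (p q : rat) :
    {ae m, forall x, \int[leb R]_y (h (x, y) * eta j (ratr p) (ratr q) y) = 0}.
  have te := eta_test j (ratr p : R) (ratr q).
  apply: fundT.
    by apply: (lbd_int finite_balls1 lh); exact: test1_bms.
  move=> f TTf; rewrite -[RHS](h0 f _ TTf te).
  rewrite (bms_fubini1 fb finite_balls1); last first.
    apply: bmsMl => //; apply: bms_tensor; [exact: bTT|exact: test1_bms].
  apply: eq_Rintegral => x _ /=; rewrite -RintegralZr//.
    by apply: eq_Rintegral => y _; rewrite -mulrA (mulrC _ (f x)).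
  apply: integrable_bms; apply: bmsMl; last exact: test1_bms.
  exact: lbd_slice1 lh.
have : {ae m, forall x, forall w : nat * (rat * rat),
    \int[leb R]_y (h (x, y) * eta w.1 (ratr w.2.1) (ratr w.2.2) y) = 0}.
  by apply: ae_countable => -[j [p q]]; exact: H.
apply: aeS => x hx; apply: fund1; first exact: lbd_slice1 lh.
by move=> j p q; exact: (hx (j, (p, q))).
Qed.

Definition test2 : set (R * R -> R) :=
  [set h | exists f g, [/\ test1 f, test1 g & h = fun z => f z.1 * g z.2]].

Lemma test2_bms h : test2 h -> bms nrm2 h.
Proof. by move=> [f [g [tf tg ->]]]; apply: bms_tensor; exact: test1_bms. Qed.

Lemma fund2 (h : R * R -> R) : lbd nrm2 h ->
  (forall f, test2 f -> \int[leb2 R]_z (h z * f z) = 0) ->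
  {ae leb2 R, forall z, h z = 0}.
Proof.
move=> lh h0.
apply: (fundX (m := leb R) (n := nrm1) (TT := [set f | test1 f]) finite_balls1) lh _.
- by move=> f; exact: test1_bms.
- move=> k lk k0; apply: fund1 => // j p q; apply: k0; exact: eta_test.
- by move=> f g tf tg; apply: (h0 (fun z => f z.1 * g z.2)); exists f, g.
Qed.

Lemma finite_balls2 : finite_balls (@nrm2 R) (leb2 R).
Proof. exact: finite_ballsX finite_balls1 finite_balls1. Qed.

Lemma finite_balls3 : finite_balls (@nrm3 R) (leb3 R).
Proof. exact: finite_ballsX finite_balls2 finite_balls1. Qed.

Lemma fund3 (h : R * R * R -> R) : lbd nrm3 h ->
  (forall f1 f2 f3, test1 f1 -> test1 f2 -> test1 f3 ->
    \int[leb3 R]_z (h z * (f1 z.1.1 * f2 z.1.2 * f3 z.2)) = 0) ->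
  {ae leb3 R, forall z, h z = 0}.
Proof.
move=> lh h0; apply: (fundX (m := leb2 R) (n := nrm2) (TT := test2) finite_balls2) lh _.
- exact: test2_bms.
- exact: fund2.
- by move=> f g [f1 [f2 [t1 t2 ->]]] tg; exact: h0.
Qed.

End fundamental_lemma.

(** * Pairings with tensor tests *)

Section linear_forms.
Context {R : realType}.
Implicit Types (L : (R -> R) -> R) (h r : R -> R) (c : R).

Lemma test1_comb h r c : test1 h -> test1 r -> test1 (fun x => h x - c * r x).
Proof.
move=> [Ch [N hN]] [Cr [M rM]]; split.
  rewrite (_ : (fun x => _) = fun x => h x + (- c) * r x).
    by apply: smooth1D => //; apply: smooth1M => //; exact: smooth1_cst.
  by apply/funext => x; rewrite mulNr.
exists (Num.max N M) => x; rewrite gt_max => /andP[/hN -> /rM ->].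
by rewrite mulr0 subrr.
Qed.

Lemma derive1_comb h r c : test1 h -> test1 r ->
  derive1 (fun x => h x - c * r x) = fun x => derive1 h x - c * derive1 r x.
Proof.
move=> [Ch _] [Cr _]; apply: is_derive_fun => x.
have hd := smooth1_is_derive Ch x; have rd := smooth1_is_derive Cr x.
exact: is_deriveB hd (is_deriveZ c rd).
Qed.

(** This single combination suffices, because linearity only serves to subtract a multiple of a test
    function. *)
Definition linform L := forall h r c, test1 h -> test1 r ->
  L (fun x => h x - c * r x) = L h - c * L r.

Lemma linform_deriv L : linform L -> linform (fun h => L (derive1 h)).
Proof.
by move=> lL h r c th tr; rewrite derive1_comb// lL//; exact: test1_deriv.
Qed.

Lemma linformB L L' : linform L -> linform L' -> linform (fun h => L h - L' h).
Proof. by move=> lL lL' h r c th tr; rewrite lL// lL'//; ring. Qed.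

Lemma linform_int : linform (fun h => \int[leb R]_x h x).
Proof.
move=> h r c th tr; rewrite RintegralB//; [|exact: test1_integrable|].
  by rewrite RintegralZl//; exact: test1_integrable.
by apply: integrable_bms; apply: bmsMl (test1_bms tr); exact/bnd_lbd/bnd_cst.
Qed.

(* [h - (\int h) r] has zero mean, hence is the derivative of a test function. *)
Lemma linform_deriv0 L r : linform L -> (forall h, test1 h -> L (derive1 h) = 0) ->
  test1 r -> \int[leb R]_x r x = 1 ->
  forall h, test1 h -> L h = (\int[leb R]_x h x) * L r.
Proof.
move=> lL L0 tr r1 h th; apply/eqP; rewrite -subr_eq0 -lL//.
have [|k tk <-] := test1_prim (test1_comb (\int[leb R]_x h x) th tr).
  by rewrite linform_int// r1 mulr1 subrr.
by rewrite L0.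
Qed.

End linear_forms.

(** * Splitting and averaging at the level of trilinear pairings *)

Section strain_algebra.
Context {R : realType}.
Local Notation F3 := ((R -> R) -> (R -> R) -> (R -> R) -> R).

(** Keeping the form abstract allows the slots to be permuted in place of the variables of a
    function on R^3. *)
Definition trilin (T : F3) : Prop := [/\
  forall h2 h3, test1 h2 -> test1 h3 -> linform (fun h => T h h2 h3),
  forall h1 h3, test1 h1 -> test1 h3 -> linform (fun h => T h1 h h3) &
  forall h1 h2, test1 h1 -> test1 h2 -> linform (fun h => T h1 h2 h)].

Definition mean_test (r : R -> R) := test1 r /\ \int[leb R]_x r x = 1.

(** With a derivative in the second slot, [T] sees [h3] only through its integral. After subtraction
    of the part proportional to that integral, the same holds for [h2]. This is the weak form of the
    splitting of a solution of d_2 d_3 f = 0, the last term being the part depending on x1 alone. *)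
Lemma mixed_decomposition (T : F3) r2 r3 : trilin T -> mean_test r2 -> mean_test r3 ->
  (forall h1 h2 h3, test1 h1 -> test1 h2 -> test1 h3 ->
    T h1 (derive1 h2) (derive1 h3) = 0) ->
  forall h1 h2 h3, test1 h1 -> test1 h2 -> test1 h3 ->
  T h1 h2 h3 = (\int[leb R]_x h2 x) * T h1 r2 h3 + (\int[leb R]_x h3 x) * T h1 h2 r3
    - (\int[leb R]_x h2 x) * (\int[leb R]_x h3 x) * T h1 r2 r3.
Proof.
move=> [_ l2 l3] [t2 i2] [t3 i3] T0 h1 h2 h3 th1 th2 th3.
have H k2 k3 : test1 k2 -> test1 k3 -> T h1 (derive1 k2) k3 =
    (\int[leb R]_x k3 x) * T h1 (derive1 k2) r3.
  move=> tk2 tk3; apply: (linform_deriv0 (L := fun h => T h1 (derive1 k2) h)) => //.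
    by apply: l3 => //; exact: test1_deriv.
  by move=> h th; exact: T0.
have lL : linform (fun h => T h1 h h3 - (\int[leb R]_x h3 x) * T h1 h r3).
  move=> h r c th tr; rewrite (l2 h1 h3)// (l2 h1 r3)//; ring.
have E : T h1 h2 h3 - (\int[leb R]_x h3 x) * T h1 h2 r3 =
    (\int[leb R]_x h2 x) * (T h1 r2 h3 - (\int[leb R]_x h3 x) * T h1 r2 r3).
  by apply: (linform_deriv0 lL) => // h th; rewrite H// subrr.
by rewrite -[LHS](subrK ((\int[leb R]_x h3 x) * T h1 h2 r3)) E; ring.
Qed.

(* Averaged in x_3, the difference d_1 e_23 - d_2 e_13 has vanishing derivatives
   in x_1 and x_2, and zero mean because e is periodic. *)
Lemma averaged_compatibility (Ta Tb Tc : F3) r1 r2 r3 :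
  trilin Ta -> trilin Tb -> mean_test r1 -> mean_test r2 -> mean_test r3 ->
  (forall h1 h2 h3, test1 h1 -> test1 h2 -> test1 h3 ->
    Ta (derive1 (derive1 h1)) h2 h3 =
    Tb (derive1 h1) (derive1 h2) h3 + Tc (derive1 h1) h2 (derive1 h3)) ->
  (forall h1 h2 h3, test1 h1 -> test1 h2 -> test1 h3 ->
    Tb h1 (derive1 (derive1 h2)) h3 =
    Ta (derive1 h1) (derive1 h2) h3 + Tc h1 (derive1 h2) (derive1 h3)) ->
  (forall h1 h2, test1 h1 -> test1 h2 -> Tc h1 h2 (derive1 r3) = 0) ->
  (forall h2 h3, test1 h2 -> test1 h3 -> Ta (derive1 r1) h2 h3 = 0) ->
  (forall h1 h3, test1 h1 -> test1 h3 -> Tb h1 (derive1 r2) h3 = 0) ->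
  forall h1 h2, test1 h1 -> test1 h2 ->
  Ta (derive1 h1) h2 r3 = Tb h1 (derive1 h2) r3.
Proof.
move=> [la1 la2 _] [lb1 lb2 _] [t1 i1] [t2 i2] [t3 i3] Sa Sb Pc Pa Pb h1 h2 th1 th2.
pose L k1 k2 := Ta (derive1 k1) k2 r3 - Tb k1 (derive1 k2) r3.
have L1 k2 : test1 k2 -> linform (L ^~ k2).
  move=> tk; apply: linformB; last by apply: lb1 => //; exact: test1_deriv.
  exact: (linform_deriv (L := fun h => Ta h k2 r3) (la1 _ _ tk t3)).
have L2 k1 : test1 k1 -> linform (L k1).
  move=> tk; apply: linformB; first by apply: la2 => //; exact: test1_deriv.
  exact: (linform_deriv (L := fun h => Tb k1 h r3) (lb2 _ _ tk t3)).
have L10 k1 k2 : test1 k1 -> test1 k2 -> L (derive1 k1) k2 = 0.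
  move=> tk1 tk2; rewrite /L Sa// addrC addKr Pc//; exact: test1_deriv.
have L20 k1 k2 : test1 k1 -> test1 k2 -> L k1 (derive1 k2) = 0.
  move=> tk1 tk2; rewrite /L Sb// opprD addrA subrr Pc ?subr0//.
  exact: test1_deriv.
apply/eqP; rewrite -subr_eq0; apply/eqP.
rewrite -/(L h1 h2) (linform_deriv0 (L1 _ th2) _ t1 i1)//; last first.
  by move=> h th; exact: L10.
rewrite (linform_deriv0 (L2 _ t1) _ t2 i2)//; last by move=> h th; exact: L20.
by rewrite /L Pa// Pb// subrr !mulr0.
Qed.

End strain_algebra.

(** * Integrals on R^3 under permutations of the coordinates *)

Section integral3.
Context {R : realType}.
Implicit Types (F : R * R * R -> R).

Lemma bms_perm F (s : R * R * R -> R * R * R) : measurable_fun [set: R * R * R] s ->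
  (forall x, nrm3 (s x) = nrm3 x) -> bms nrm3 F -> bms nrm3 (F \o s).
Proof.
move=> ms ns [mF [N [FN F0]]]; split; first exact: measurableT_comp.
by exists N; split => x; [exact: FN|rewrite -ns; exact: F0].
Qed.

Definition s23 (x : R * R * R) := (x.1.1, x.2, x.1.2).
Definition s12 (x : R * R * R) := (x.1.2, x.1.1, x.2).

Lemma s23_meas : measurable_fun [set: R * R * R] s23.
Proof.
apply: measurable_fun_pair; last exact: measurableT_comp.
by apply: measurable_fun_pair => //; exact: measurableT_comp.
Qed.

Lemma s12_meas : measurable_fun [set: R * R * R] s12.
Proof.
apply: measurable_fun_pair => //.
by apply: measurable_fun_pair => //; exact: measurableT_comp.
Qed.

Lemma s23_nrm x : nrm3 (s23 x) = nrm3 x.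
Proof. by rewrite /nrm3 /nrm2 /nrmX/= -!maxA; congr Num.max; exact: maxC. Qed.

Lemma s12_nrm x : nrm3 (s12 x) = nrm3 x.
Proof. by rewrite /nrm3 /nrm2 /nrmX/=; congr Num.max; exact: maxC. Qed.

Lemma bms_s23 F : bms nrm3 F -> bms nrm3 (F \o s23).
Proof. by apply: bms_perm; [exact: s23_meas|exact: s23_nrm]. Qed.

Lemma bms_s12 F : bms nrm3 F -> bms nrm3 (F \o s12).
Proof. by apply: bms_perm; [exact: s12_meas|exact: s12_nrm]. Qed.

Lemma int3_int2 F : bms nrm3 F ->
  \int[leb3 R]_x F x = \int[leb2 R]_w \int[leb R]_z F (w, z).
Proof. exact: (bms_fubini1 finite_balls2 finite_balls1). Qed.

Lemma int2E (G : R * R -> R) : bms nrm2 G ->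
  \int[leb2 R]_w G w = \int[leb R]_x \int[leb R]_y G (x, y).
Proof. exact: (bms_fubini1 finite_balls1 finite_balls1). Qed.

Lemma int2_swap (G : R * R -> R) : bms nrm2 G ->
  \int[leb R]_x \int[leb R]_y G (x, y) = \int[leb R]_y \int[leb R]_x G (x, y).
Proof. exact: (bms_fubini finite_balls1 finite_balls1). Qed.

Lemma bms3_int F : bms nrm3 F -> bms nrm2 (fun w => \int[leb R]_z F (w, z)).
Proof. exact: (bms_int1 finite_balls1). Qed.

Lemma int3E F : bms nrm3 F ->
  \int[leb3 R]_x F x = \int[leb R]_x \int[leb R]_y \int[leb R]_z F (x, y, z).
Proof.
by move=> bF; rewrite int3_int2// int2E//; exact: bms3_int.
Qed.

Lemma bms3_slice F x : bms nrm3 F -> bms nrm2 (fun w => F (x, w.1, w.2)).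
Proof.
move=> [mF [N [FN F0]]]; split.
  apply: (measurableT_comp mF); apply: measurable_fun_pair => //.
  by apply: measurable_fun_pair.
exists N; split => // w; rewrite nrmX_lt => h; apply: F0.
by rewrite /nrm3 nrmX_lt/= nrmX_lt/= -orbA h orbT.
Qed.

Lemma int3_s23 F : bms nrm3 F -> \int[leb3 R]_x F (s23 x) = \int[leb3 R]_x F x.
Proof.
move=> bF; apply: (etrans (int3E (bms_s23 bF))).
apply: (etrans _ (esym (int3E bF))); apply: eq_Rintegral => x _.
exact: (esym (int2_swap (bms3_slice x bF))).
Qed.

Lemma int3_s12 F : bms nrm3 F -> \int[leb3 R]_x F (s12 x) = \int[leb3 R]_x F x.
Proof.
move=> bF; apply: (etrans (int3E (bms_s12 bF))).
apply: (etrans _ (esym (int3E bF))).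
exact: (esym (int2_swap (bms3_int bF))).
Qed.

End integral3.

(** * Pairings on R^2 and R^3, and averages in one variable *)

Section forms.
Context {R : realType}.
Implicit Types (f : R * R * R -> R) (g : R * R -> R) (h : R -> R).

Definition T2 g h1 h2 : R := \int[leb2 R]_w (g w * (h1 w.1 * h2 w.2)).
Definition T3 f h1 h2 h3 : R :=
  \int[leb3 R]_x (f x * (h1 x.1.1 * h2 x.1.2 * h3 x.2)).

(** For periodic [f] and the weight constructed in [window_exists], these are the averages over one
    period of the variable [s]. *)
Definition E1 h f (w : R * R) : R := \int[leb R]_s (f (s, w.1, w.2) * h s).
Definition E2 h f (w : R * R) : R := \int[leb R]_s (f (w.1, s, w.2) * h s).
Definition E3 h f (w : R * R) : R := \int[leb R]_s (f (w.1, w.2, s) * h s).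

Lemma bms2 h1 h2 : test1 h1 -> test1 h2 -> bms nrm2 (fun w : R * R => h1 w.1 * h2 w.2).
Proof. by move=> t1 t2; apply: bms_tensor; exact: test1_bms. Qed.

Lemma bms3 h1 h2 h3 : test1 h1 -> test1 h2 -> test1 h3 ->
  bms nrm3 (fun x : R * R * R => h1 x.1.1 * h2 x.1.2 * h3 x.2).
Proof.
move=> t1 t2 t3; apply: (bms_tensor (f := fun w : R * R => h1 w.1 * h2 w.2)).
  exact: bms2.
exact: test1_bms.
Qed.

Lemma bms2M g h1 h2 : lbd nrm2 g -> test1 h1 -> test1 h2 ->
  bms nrm2 (fun w : R * R => g w * (h1 w.1 * h2 w.2)).
Proof. by move=> lg t1 t2; apply: bmsMl => //; exact: bms2. Qed.

Lemma bms3M f h1 h2 h3 : lbd nrm3 f -> test1 h1 -> test1 h2 -> test1 h3 ->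
  bms nrm3 (fun x : R * R * R => f x * (h1 x.1.1 * h2 x.1.2 * h3 x.2)).
Proof. by move=> lg t1 t2 t3; apply: bmsMl => //; exact: bms3. Qed.

Lemma bms_int2f (F : R * R -> R) : bms nrm2 F -> (leb2 R).-integrable [set: R * R] (EFin \o F).
Proof. by move=> bF; exact: (bms_integrable finite_balls2). Qed.

Lemma bms_int3f (F : R * R * R -> R) : bms nrm3 F ->
  (leb3 R).-integrable [set: R * R * R] (EFin \o F).
Proof. by move=> bF; exact: (bms_integrable finite_balls3). Qed.

Lemma int_comb d (T : measurableType d) (m : {measure set T -> \bar R}) (F G : T -> R) c :
  m.-integrable [set: T] (EFin \o F) -> m.-integrable [set: T] (EFin \o G) ->
  \int[m]_x (F x - c * G x) = \int[m]_x F x - c * \int[m]_x G x.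
Proof.
move=> iF iG; rewrite RintegralB//; first by rewrite RintegralZl.
have := integrableZl measurableT c iG.
by apply: eq_integrable => // x _; rewrite /= EFinM.
Qed.

Lemma T3_trilin f : lbd nrm3 f -> trilin (T3 f).
Proof.
move=> lf; split=> k1 k2 t1 t2 h r c th tr; rewrite /T3 -int_comb;
  do ?[apply: bms_int3f; exact: bms3M]; apply: eq_Rintegral => x _; ring.
Qed.

Lemma bnd_int d (T : measurableType d) (k : T * R -> R) h : bnd k -> test1 h ->
  bnd (fun w => \int[leb R]_s (k (w, s) * h s)).
Proof.
move=> [mk [C hC]] th; have bh := test1_bms th; split.
  apply: (@measurable_int1 R _ _ T (measurableTypeR R) (leb R) (fun z => k z * h z.2)).
    move=> w; apply: (integrable_bms (f := fun s => k (w, s) * h s)).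
    apply: bmsMl => //; apply: bnd_lbd; split; first exact: measurable_slice1.
    by exists C.
  by apply: measurable_funM => //; apply: measurableT_comp => //; case: bh.
have [mh [N [hN h0]]] := bh.
have N0 : 0 <= N by rewrite (le_trans _ (hN 0)).
have [K hK] := bms_int_bound (Num.max (C * N) N) (@finite_balls1 R).
exists K => w; apply: hK.
- by apply: measurable_funM => //; exact: measurable_slice1.
- by move=> x; rewrite normrM le_max ler_pM.
- by move=> x; rewrite gt_max => /andP[_ /h0 ->]; rewrite mulr0.
Qed.

Definition c231 (w : R * R * R) : R * R * R := (w.2, w.1.1, w.1.2).

Lemma bnd_comp d d' (T : measurableType d) (T' : measurableType d')
    (k : T -> R) (s : T' -> T) : measurable_fun [set: T'] s -> bnd k -> bnd (k \o s).
Proof. by move=> ms [mk [C hC]]; split; [exact: measurableT_comp|exists C => x; exact: hC]. Qed.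

Lemma bnd_E3 h f : bnd f -> test1 h -> bnd (E3 h f).
Proof.
move=> bf th; rewrite (_ : E3 h f = fun w => \int[leb R]_s (f (w, s) * h s)).
  exact: bnd_int.
by apply/funext => -[x y].
Qed.

Lemma bnd_E2 h f : bnd f -> test1 h -> bnd (E2 h f).
Proof.
move=> bf th; apply: (@bnd_int _ _ (f \o s23)) => //.
by apply: bnd_comp => //; exact: s23_meas.
Qed.

Lemma s231_meas : measurable_fun [set: R * R * R] c231.
Proof.
apply: measurable_fun_pair; last exact: measurableT_comp.
by apply: measurable_fun_pair => //; exact: measurableT_comp.
Qed.

Lemma bnd_E1 h f : bnd f -> test1 h -> bnd (E1 h f).
Proof.
move=> bf th; apply: (@bnd_int _ _ (f \o c231)) => //.
by apply: bnd_comp => //; exact: s231_meas.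
Qed.

Lemma T3_E3 f h1 h2 h3 : bnd f -> test1 h1 -> test1 h2 -> test1 h3 ->
  T3 f h1 h2 h3 = T2 (E3 h3 f) h1 h2.
Proof.
move=> bf t1 t2 t3; rewrite /T3 int3_int2; last by apply: bms3M => //; exact: bnd_lbd.
apply: eq_Rintegral => -[x y] _ /=; rewrite -RintegralZr//.
  by apply: eq_Rintegral => s _; rewrite /=; ring.
apply: (integrable_bms (f := fun s => f (x, y, s) * h3 s)).
apply: bmsMl; last exact: test1_bms.
by apply: bnd_lbd; case: bf => mf [C hC]; split; [exact: measurable_slice1|exists C].
Qed.

Lemma T3_s23 f h1 h2 h3 : bnd f -> test1 h1 -> test1 h2 -> test1 h3 ->
  T3 (f \o s23) h1 h2 h3 = T3 f h1 h3 h2.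
Proof.
move=> bf t1 t2 t3; rewrite /T3 -[RHS]int3_s23; last by apply: bms3M => //; exact: bnd_lbd.
by apply: eq_Rintegral => x _ /=; ring.
Qed.

Lemma T3_s12 f h1 h2 h3 : bnd f -> test1 h1 -> test1 h2 -> test1 h3 ->
  T3 (f \o s12) h1 h2 h3 = T3 f h2 h1 h3.
Proof.
move=> bf t1 t2 t3; rewrite /T3 -[RHS]int3_s12; last by apply: bms3M => //; exact: bnd_lbd.
by apply: eq_Rintegral => x _ /=; ring.
Qed.

Lemma T3_E2 f h1 h2 h3 : bnd f -> test1 h1 -> test1 h2 -> test1 h3 ->
  T3 f h1 h2 h3 = T2 (E2 h2 f) h1 h3.
Proof.
move=> bf t1 t2 t3; rewrite -T3_s23// T3_E3//.
by apply: bnd_comp => //; exact: s23_meas.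
Qed.

Lemma T3_E1 f h1 h2 h3 : bnd f -> test1 h1 -> test1 h2 -> test1 h3 ->
  T3 f h1 h2 h3 = T2 (E1 h1 f) h2 h3.
Proof.
move=> bf t1 t2 t3; rewrite -T3_s12// T3_E2//.
by apply: bnd_comp => //; exact: s12_meas.
Qed.

Lemma T2_int g h1 h2 : lbd nrm2 g -> test1 h1 -> test1 h2 ->
  T2 g h1 h2 = \int[leb R]_x ((\int[leb R]_y (g (x, y) * h2 y)) * h1 x).
Proof.
move=> lg t1 t2; rewrite /T2 int2E; last exact: bms2M.
apply: eq_Rintegral => x _ /=; rewrite -RintegralZr//.
  by apply: eq_Rintegral => s _; ring.
apply: (integrable_bms (f := fun s => g (x, s) * h2 s)).
by apply: bmsMl; [exact: lbd_slice1 lg|exact: test1_bms].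
Qed.

Lemma T2_int' g h1 h2 : lbd nrm2 g -> test1 h1 -> test1 h2 ->
  T2 g h1 h2 = \int[leb R]_y ((\int[leb R]_x (g (x, y) * h1 x)) * h2 y).
Proof.
move=> lg t1 t2; rewrite /T2 int2E; last exact: bms2M.
apply: (etrans (int2_swap (bms2M lg t1 t2))).
apply: eq_Rintegral => y _ /=; rewrite -RintegralZr//.
  by apply: eq_Rintegral => s _; ring.
apply: (integrable_bms (f := fun s => g (s, y) * h1 s)).
apply: bmsMl; last exact: test1_bms.
have [mg hg] := lg; split; first exact: measurable_slice2.
move=> N; have [C hC] := hg (Num.max N (nrm1 y)); exists C => x xN.
by apply: hC; rewrite nrmX_le !le_max/= xN lexx orbT.
Qed.

Lemma RintegralZl_test (c : R) h : test1 h ->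
  \int[leb R]_s (c * h s) = c * \int[leb R]_s h s.
Proof. by move=> th; rewrite RintegralZl//; exact: test1_integrable. Qed.

Definition p12 g (x : R * R * R) := g (x.1.1, x.1.2).
Definition p13 g (x : R * R * R) := g (x.1.1, x.2).
Definition p23 g (x : R * R * R) := g (x.1.2, x.2).

Lemma bnd_p12 g : bnd g -> bnd (p12 g).
Proof.
apply: (bnd_comp (s := fun x : R * R * R => (x.1.1, x.1.2))).
by apply: measurable_fun_pair; exact: measurableT_comp.
Qed.

Lemma bnd_p13 g : bnd g -> bnd (p13 g).
Proof.
apply: (bnd_comp (s := fun x : R * R * R => (x.1.1, x.2))).
by apply: measurable_fun_pair => //; exact: measurableT_comp.
Qed.

Lemma bnd_p23 g : bnd g -> bnd (p23 g).
Proof.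
apply: (bnd_comp (s := fun x : R * R * R => (x.1.2, x.2))).
by apply: measurable_fun_pair => //; exact: measurableT_comp.
Qed.

Lemma T2Zr g h1 h2 (c : R) : bnd g -> test1 h1 -> test1 h2 ->
  T2 (fun w => g w * c) h1 h2 = c * T2 g h1 h2.
Proof.
move=> bg t1 t2; rewrite /T2 -RintegralZl//.
  by apply: eq_Rintegral => w _; ring.
by apply: bms_int2f; apply: bms2M => //; exact: bnd_lbd.
Qed.

Lemma T3_p12 g h1 h2 h3 : bnd g -> test1 h1 -> test1 h2 -> test1 h3 ->
  T3 (p12 g) h1 h2 h3 = (\int[leb R]_x h3 x) * T2 g h1 h2.
Proof.
move=> bg t1 t2 t3; rewrite T3_E3//; last exact: bnd_p12.
rewrite -T2Zr//; congr (T2 _ _ _); apply/funext => -[x y].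
by rewrite /E3 /p12/= RintegralZl_test.
Qed.

Lemma T3_p13 g h1 h2 h3 : bnd g -> test1 h1 -> test1 h2 -> test1 h3 ->
  T3 (p13 g) h1 h2 h3 = (\int[leb R]_x h2 x) * T2 g h1 h3.
Proof.
move=> bg t1 t2 t3; rewrite T3_E2//; last exact: bnd_p13.
rewrite -T2Zr//; congr (T2 _ _ _); apply/funext => -[x y].
by rewrite /E2 /p13/= RintegralZl_test.
Qed.

Lemma T2_cst (c : R) h1 h2 : test1 h1 -> test1 h2 ->
  T2 (cst c) h1 h2 = c * ((\int[leb R]_x h1 x) * (\int[leb R]_x h2 x)).
Proof.
move=> t1 t2; rewrite T2_int//; last exact/bnd_lbd/bnd_cst.
by rewrite /= RintegralZl_test// RintegralZl_test//; ring.
Qed.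

Lemma T3_cst (c : R) h1 h2 h3 : test1 h1 -> test1 h2 -> test1 h3 ->
  T3 (cst c) h1 h2 h3 =
  c * ((\int[leb R]_x h1 x) * (\int[leb R]_x h2 x) * (\int[leb R]_x h3 x)).
Proof.
move=> t1 t2 t3; rewrite -/(p12 (cst c)) T3_p12//; last exact: bnd_cst.
by rewrite T2_cst//; ring.
Qed.

Lemma T3_add f f' h1 h2 h3 : bnd f -> bnd f' -> test1 h1 -> test1 h2 -> test1 h3 ->
  T3 (fun x => f x + f' x) h1 h2 h3 = T3 f h1 h2 h3 + T3 f' h1 h2 h3.
Proof.
move=> bf bf' t1 t2 t3; rewrite /T3 -RintegralD//.
- by apply: eq_Rintegral => x _; ring.
- by apply: bms_int3f; apply: bms3M => //; exact: bnd_lbd.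
- by apply: bms_int3f; apply: bms3M => //; exact: bnd_lbd.
Qed.

Lemma T3_opp f h1 h2 h3 : bnd f -> test1 h1 -> test1 h2 -> test1 h3 ->
  T3 (fun x => - f x) h1 h2 h3 = - T3 f h1 h2 h3.
Proof.
move=> bf t1 t2 t3; rewrite /T3 -mulN1r -RintegralZl//.
  by apply: eq_Rintegral => x _; ring.
by apply: bms_int3f; apply: bms3M => //; exact: bnd_lbd.
Qed.

Lemma T2_add g g' h1 h2 : lbd nrm2 g -> lbd nrm2 g' -> test1 h1 -> test1 h2 ->
  T2 (fun x => g x + g' x) h1 h2 = T2 g h1 h2 + T2 g' h1 h2.
Proof.
move=> bf bf' t1 t2; rewrite /T2 -RintegralD//.
- by apply: eq_Rintegral => x _; ring.
- by apply: bms_int2f; exact: bms2M.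
- by apply: bms_int2f; exact: bms2M.
Qed.

Lemma T2_opp g h1 h2 : lbd nrm2 g -> test1 h1 -> test1 h2 ->
  T2 (fun x => - g x) h1 h2 = - T2 g h1 h2.
Proof.
move=> bf t1 t2; rewrite /T2 -mulN1r -RintegralZl//.
  by apply: eq_Rintegral => x _; ring.
by apply: bms_int2f; exact: bms2M.
Qed.

Lemma fund3_T (f : R * R * R -> R) : bnd f ->
  (forall h1 h2 h3, test1 h1 -> test1 h2 -> test1 h3 -> T3 f h1 h2 h3 = 0) ->
  {ae leb3 R, forall x, f x = 0}.
Proof. by move=> bf f0; apply: fund3 => //; exact: bnd_lbd. Qed.

Lemma fund2_T (g : R * R -> R) : lbd nrm2 g ->
  (forall h1 h2, test1 h1 -> test1 h2 -> T2 g h1 h2 = 0) ->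
  {ae leb2 R, forall x, g x = 0}.
Proof. by move=> bg g0; apply: fund2 => // _ [h1 [h2 [t1 t2 ->]]]; exact: g0. Qed.

End forms.

(** * Smooth weights that average over a period *)

Section window.
Context {R : realType}.

Lemma test1_shift (h : R -> R) c : test1 h -> test1 (fun y => h (y + c)).
Proof.
move=> [Ch [N hN]]; split.
  rewrite (_ : (fun y => _) = fun y => h (1 * y + c)); first exact: smooth1_affine.
  by apply/funext => y; rewrite mul1r.
exists (N + `|c|) => y Ny; apply: hN; have := ler_normB (y + c) c.
rewrite addrK; lra.
Qed.

Lemma derive1_shift (h : R -> R) c : test1 h ->
  derive1 (fun y => h (y + c)) = fun y => derive1 h (y + c).
Proof.
move=> [Ch _]; apply: is_derive_fun => y.
have := smooth1_is_derive Ch (1 * y + c) => /is_derive_affine; rewrite mul1r => H.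
rewrite (_ : (fun y => _) = fun y => h (1 * y + c)); last first.
  by apply/funext => z; rewrite mul1r.
by move: H; rewrite mul1r.
Qed.

(* [r] is, up to a factor, a bump convolved with the indicator of a period, so the
   integral of [f r'] is a difference of two translates. *)
Lemma window_exists (l : R) : 0 < l ->
  exists r : R -> R, [/\ mean_test r, forall x, 0 <= r x,
    forall x, 0 < x < l -> 0 < r x &
    forall f : R -> R, bnd f -> (forall x, f (x + l) = f x) ->
      \int[leb R]_x (f x * derive1 r x) = 0].
Proof.
move=> l0; pose xi := eta 0 0 l : R -> R.
have txi : test1 xi := eta_test 0 0 l.
have bxi := test1_bnd txi.
have Cxi : continuous xi by exact: smooth1_continuous txi.1.
pose th (x : R) := prim xi x - prim xi (x - l).
have thE x : th x = \int[leb R]_t (xi t * (x - l < t <= x)%R%:R).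
  by rewrite /th primB// lerBlDr lerDl ltW.
have bint x : bms nrm1 (fun t => xi t * (x - l < t <= x)%R%:R).
  rewrite (_ : (fun t => _) = fun t => xi t * kern t x - xi t * kern t (x - l)).
    by apply: bmsB; exact: prim_bms.
  by apply/funext => t; rewrite -mulrBr kernB// lerBlDr lerDl ltW.
have th0 x : 0 <= th x.
  rewrite thE; apply: Rintegral_ge0 => t _; rewrite mulr_ge0 ?eta_ge0//.
have thgt0 x : 0 < x < l -> 0 < th x.
  move=> /andP[x0 xl]; rewrite lt_neqAle th0 andbT; apply/negP => /eqP/esym.
  rewrite thE => /(Rintegral_eq0_ge0 finite_balls1 (bint x)) H.
  have {H} : {ae leb R, forall t, ~ (0 < t < x)}.
    have := H (fun t => mulr_ge0 (eta_ge0 0 0 l t) (ler0n _ _)).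
    apply: aeS => t /[swap] /andP[t0 tx].
    rewrite (lt_trans _ t0) ?subr_lt0// ltW//= mulr1 => /eqP; rewrite gt_eqF//.
    by apply: eta_gt0; rewrite t0 (lt_trans tx).
  move=> [A [mA A0 HA]].
  have : (leb R (`]0%R, x[%classic : set R) <= leb R A)%E.
    by apply: le_measure; rewrite ?inE// => t /=; rewrite in_itv/= => tx; apply: HA => /=; apply.
  by rewrite A0 lebesgue_measure_itv/= lte_fin x0 sube0 lee_fin leNgt x0.
have dth x : is_derive (x : R) (1 : R) th (xi x - xi (x - l)).
  have d1 := prim_continuous_is_derive bxi Cxi x.
  have d2 := prim_continuous_is_derive bxi Cxi (1 * x + - l).
  have := is_deriveB d1 (is_derive_affine d2); rewrite !mul1r => d.
  rewrite (_ : th = prim xi - (fun y => prim xi (1 * y - l))).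
    exact: d.
  by apply/funext => y; rewrite /th [RHS]/(prim xi y - prim xi (1 * y - l)) mul1r.
have Cth : smooth1 th.
  apply: (smooth1_prim _ dth).
  rewrite (_ : (fun x => _) = fun x => xi x + (- 1) * xi (1 * x + - l)); last first.
    by apply/funext => x; rewrite mul1r mulN1r.
  apply: smooth1D; first by case: txi.
  by apply: smooth1M; [exact: smooth1_cst|apply: smooth1_affine; case: txi].
have tth : test1 th.
  split => //; exists (2 * l) => x xl; rewrite thE.
  rewrite (_ : (fun t => _) = cst 0) ?Rintegral_cst ?mul0r//.
  apply/funext => t; case: (boolP (x - l < t <= x)) => [/andP[xt tx]|_]; last by rewrite mulr0.
  rewrite /xi eta_out ?mul0r//; apply/negP => /andP[t0 tl].
  have x0 : 0 <= x by rewrite (le_trans (ltW t0)).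
  by move: xl; rewrite ger0_norm// => xl; move: xt tl; lra.
pose c := \int[leb R]_x th x.
have c0 : c != 0.
  apply/eqP => /(Rintegral_eq0_ge0 finite_balls1 (test1_bms tth) th0) [A [mA A0 HA]].
  have : (leb R (`]0%R, l[%classic : set R) <= leb R A)%E.
    apply: le_measure; rewrite ?inE// => t /=; rewrite in_itv/= => tx; apply: HA => /= /eqP.
    by rewrite gt_eqF// thgt0.
  by rewrite A0 lebesgue_measure_itv/= lte_fin l0 sube0 lee_fin leNgt l0.
have cgt0 : 0 < c.
  by rewrite lt_neqAle eq_sym c0 Rintegral_ge0.
pose r x := c^-1 * th x.
have Dr : derive1 r = fun x => c^-1 * (xi x - xi (x - l)).
  apply: is_derive_fun => x; exact: (is_deriveZ c^-1 (dth x)).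
exists r; split.
- split.
    split; first by apply: smooth1M => //; exact: smooth1_cst.
    by have [_ [N hN]] := tth; exists N => x /hN; rewrite /r => ->; rewrite mulr0.
  by rewrite /r RintegralZl_test// mulVf.
- by move=> x; rewrite mulr_ge0// invr_ge0 ltW.
- by move=> x xl; rewrite mulr_gt0// ?invr_gt0//; exact: thgt0.
- move=> f bf fl; rewrite Dr.
  have bfx : bms nrm1 (fun x => f x * xi x).
    by apply: bmsMl; [exact: bnd_lbd|exact: test1_bms].
  rewrite (_ : (fun x => _) =
     fun x => c^-1 * (f x * xi x - f (x + - l) * xi (x + - l))); last first.
    apply/funext => x; rewrite (_ : f (x - l) = f x); first by ring.
    by rewrite -[in RHS](subrK l x) fl.
  have bfx' := bms_shift (- l) bfx.
  rewrite RintegralZl//; last by apply: integrable_bms; exact: bmsB bfx bfx'.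
  rewrite RintegralB//; [|exact: integrable_bms bfx|exact: integrable_bms bfx'].
  by rewrite (Rintegral_shift (- l) bfx) subrr mulr0.
Qed.

End window.

(** * Planar potentials and transport *)

Section planar.
Context {R : realType}.
Implicit Types (al be g : R * R -> R) (h k : R -> R).

Lemma mean_test_exists : exists r : R -> R, mean_test r.
Proof. by have [r []] := window_exists (@ltr01 R); exists r. Qed.

(** The product of the Lipschitz primitive and the test function is Lipschitz with bounded support,
    so its almost everywhere derivative integrates to zero. *)
Lemma prim_ibp (a h : R -> R) : bnd a -> test1 h ->
  \int[leb R]_y (prim a y * derive1 h y) = - \int[leb R]_y (a y * h y).
Proof.
move=> ba th; have th' := test1_deriv th.
have b1 : bms nrm1 (fun y => prim a y * derive1 h y).
  by apply: bmsMl; [apply: Lip_lbd; exact: prim_Lip|exact: test1_bms].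
have b2 : bms nrm1 (fun y => a y * h y).
  by apply: bmsMl; [exact: bnd_lbd|exact: test1_bms].
apply/eqP; rewrite -subr_eq0 opprK addrC -RintegralD//;
  [|exact: integrable_bms b2|exact: integrable_bms b1].
apply/eqP; apply: (@Rintegral_deriv_Lip _ (fun y => prim a y * h y)).
- by apply: LipM; [exact: prim_Lip|exact: test1_Lip|case: th].
- by have [_ [N hN]] := th; exists N => x /hN ->; rewrite mulr0.
- exact: bmsD.
- move: (prim_ae ba); apply: aeS => x ax; apply: is_deriveMR => //.
  exact: smooth1_is_derive th.1 x.
Qed.

Lemma T2_linform1 g h2 : lbd nrm2 g -> test1 h2 -> linform (fun h => T2 g h h2).
Proof.
move=> lg t2 h r c th tr; rewrite /T2 -int_comb;
  do ?[apply: bms_int2f; exact: bms2M]; apply: eq_Rintegral => x _; ring.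
Qed.

Lemma T2_linform2 g h1 : lbd nrm2 g -> test1 h1 -> linform (fun h => T2 g h1 h).
Proof.
move=> lg t2 h r c th tr; rewrite /T2 -int_comb;
  do ?[apply: bms_int2f; exact: bms2M]; apply: eq_Rintegral => x _; ring.
Qed.

Lemma lbd_swap g : lbd nrm2 g -> lbd nrm2 (fun z => g (z.2, z.1)).
Proof.
move=> [mg hg]; split.
  by apply: (measurableT_comp mg); exact: measurable_fun_pair.
move=> N; have [C hC] := hg N; exists C => -[x y]; rewrite nrmX_le/= => /andP[xN yN].
by apply: hC; rewrite nrmX_le yN.
Qed.

Lemma T2_fst (f : R -> R) h1 h2 : lbd nrm1 f -> test1 h1 -> test1 h2 ->
  T2 (fun z => f z.1) h1 h2 = (\int[leb R]_x h2 x) * \int[leb R]_x (f x * h1 x).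
Proof.
move=> lf t1 t2; rewrite T2_int//; last exact: lbd_fst.
rewrite -RintegralZl//.
  by apply: eq_Rintegral => x _ /=; rewrite RintegralZl_test//; ring.
by apply: integrable_bms; apply: bmsMl => //; exact: test1_bms.
Qed.

Lemma T2_snd (f : R -> R) h1 h2 : lbd nrm1 f -> test1 h1 -> test1 h2 ->
  T2 (fun z => f z.2) h1 h2 = (\int[leb R]_x h1 x) * \int[leb R]_x (f x * h2 x).
Proof.
move=> lf t1 t2; rewrite T2_int'//; last exact: lbd_snd.
rewrite -RintegralZl//.
  by apply: eq_Rintegral => x _ /=; rewrite RintegralZl_test//; ring.
by apply: integrable_bms; apply: bmsMl => //; exact: test1_bms.
Qed.

Lemma lbd_int_fst g h : lbd nrm2 g -> test1 h ->
  lbd nrm1 (fun y => \int[leb R]_x (g (x, y) * h x)).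
Proof.
by move=> lg th; apply: (lbd_int finite_balls1 (lbd_swap lg)); exact: test1_bms.
Qed.

Lemma lbd_int_snd g h : lbd nrm2 g -> test1 h ->
  lbd nrm1 (fun x => \int[leb R]_y (g (x, y) * h y)).
Proof.
by move=> lg th; apply: (lbd_int finite_balls1 lg); exact: test1_bms.
Qed.

Lemma weak_indep1 g r : lbd nrm2 g -> mean_test r ->
  (forall h1 h2, test1 h1 -> test1 h2 -> T2 g (derive1 h1) h2 = 0) ->
  {ae leb2 R, forall z : R * R, g z = \int[leb R]_x (g (x, z.2) * r x)}.
Proof.
move=> lg [tr ir] g0; pose n y := \int[leb R]_x (g (x, y) * r x).
have ln : lbd nrm1 n by exact: lbd_int_fst.
have ln2 : lbd (@nrm2 R) (fun z => - n z.2) by apply: lbdN; exact: lbd_snd.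
suff : {ae leb2 R, forall z, g z + - n z.2 = 0}.
  by apply: aeS => z /eqP; rewrite addr_eq0 opprK => /eqP.
apply: fund2_T; first exact: lbdD.
move=> h1 h2 t1 t2; rewrite T2_add// T2_opp//; last exact: lbd_snd.
rewrite T2_snd// (linform_deriv0 (T2_linform1 lg t2) _ tr ir)//; last first.
  by move=> h th; exact: g0.
by rewrite T2_int'// subrr.
Qed.

Lemma weak_indep2 g r : lbd nrm2 g -> mean_test r ->
  (forall h1 h2, test1 h1 -> test1 h2 -> T2 g h1 (derive1 h2) = 0) ->
  {ae leb2 R, forall z : R * R, g z = \int[leb R]_y (g (z.1, y) * r y)}.
Proof.
move=> lg [tr ir] g0; pose n x := \int[leb R]_y (g (x, y) * r y).
have ln : lbd nrm1 n by exact: lbd_int_snd.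
have ln2 : lbd (@nrm2 R) (fun z => - n z.1) by apply: lbdN; exact: lbd_fst.
suff : {ae leb2 R, forall z, g z + - n z.1 = 0}.
  by apply: aeS => z /eqP; rewrite addr_eq0 opprK => /eqP.
apply: fund2_T; first exact: lbdD.
move=> h1 h2 t1 t2; rewrite T2_add// T2_opp//; last exact: lbd_fst.
rewrite T2_fst// (linform_deriv0 (T2_linform2 lg t1) _ tr ir)//; last first.
  by move=> h th; exact: g0.
by rewrite T2_int// subrr.
Qed.

(** D'Alembert's splitting, with weighted averages for [P] and [Q]; [P] carries the constant -m
    because the two averages together count the total mean twice. *)
Lemma weak_mixed g : lbd nrm2 g ->
  (forall h1 h2, test1 h1 -> test1 h2 -> T2 g (derive1 h1) (derive1 h2) = 0) ->
  exists P Q : R -> R, [/\ lbd nrm1 P, lbd nrm1 Q &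
    {ae leb2 R, forall z : R * R, g z = P z.1 + Q z.2}].
Proof.
move=> lg g0; have [r mr] := mean_test_exists; have [tr ir] := mr.
pose m := T2 g r r.
pose P x := \int[leb R]_y (g (x, y) * r y) + - m.
pose Q y := \int[leb R]_x (g (x, y) * r x).
have lP0 : lbd nrm1 (fun x => \int[leb R]_y (g (x, y) * r y)) by exact: lbd_int_snd.
have lP : lbd nrm1 P by apply: lbdD => //; exact/bnd_lbd/bnd_cst.
have lQ : lbd nrm1 Q by exact: lbd_int_fst.
have lPf : lbd nrm2 (fun z : R * R => - P z.1) by apply: lbdN; exact: lbd_fst.
have lQs : lbd nrm2 (fun z : R * R => - Q z.2) by apply: lbdN; exact: lbd_snd.
exists P, Q; split => //.
suff : {ae leb2 R, forall z, g z + - P z.1 + - Q z.2 = 0}.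
  by apply: aeS => z ze; lra.
apply: fund2_T; first by apply: lbdD => //; exact: lbdD.
move=> h1 h2 t1 t2; rewrite T2_add//; last exact: lbdD.
rewrite T2_add// !T2_opp//; [|exact: lbd_snd|exact: lbd_fst].
rewrite T2_fst// T2_snd//.
have -> : \int[leb R]_x (P x * h1 x) = T2 g h1 r - m * \int[leb R]_x h1 x.
  rewrite T2_int// -int_comb; [|exact/integrable_bms/bmsMl/test1_bms|exact: test1_integrable].
  by apply: eq_Rintegral => x _; rewrite /P; ring.
have -> : \int[leb R]_x (Q x * h2 x) = T2 g r h2 by rewrite T2_int'.
have lT : linform (fun h => T2 g h1 h - (\int[leb R]_x h1 x) * T2 g r h).
  move=> h k c th tk; rewrite (T2_linform2 lg t1)// (T2_linform2 lg tr)//; ring.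
have E : T2 g h1 h2 - (\int[leb R]_x h1 x) * T2 g r h2 =
    (\int[leb R]_x h2 x) * (T2 g h1 r - (\int[leb R]_x h1 x) * T2 g r r).
  apply: (linform_deriv0 lT _ tr ir) => // h th.
  have th' := test1_deriv th.
  rewrite (linform_deriv0 (T2_linform1 lg th') _ tr ir)// ?subrr//.
  by move=> k tk; exact: g0.
rewrite -[T2 g h1 h2](subrK ((\int[leb R]_x h1 x) * T2 g r h2)) E /m; ring.
Qed.

(** The weak form of d_1 al = d_2 be, that is, closedness of the form be dx + al dy. *)
Definition weak_potential al be := forall h1 h2, test1 h1 -> test1 h2 ->
  T2 al (derive1 h1) h2 = T2 be h1 (derive1 h2).

Definition primy al (z : R * R) := prim (fun t => al (z.1, t)) z.2.
Definition primx be (z : R * R) := prim (fun t => be (t, z.2)) z.1.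

Lemma bnd_swap g : bnd g -> bnd (fun z => g (z.2, z.1)).
Proof.
move=> [mg [C hC]]; split; last by exists C.
by apply: (measurableT_comp mg); exact: measurable_fun_pair.
Qed.

Lemma primy_lbd al : bnd al -> lbd nrm2 (primy al).
Proof. exact: lbd_prim2. Qed.

Lemma primx_lbd be : bnd be -> lbd nrm2 (primx be).
Proof. by move=> bb; apply: (lbd_swap (g := primy (fun z => be (z.2, z.1)))); exact/primy_lbd/bnd_swap. Qed.

(* A potential [phi] of (be, al) is both [primy al - P] and [primx be + Q]. *)
Lemma potential al be : bnd al -> bnd be -> weak_potential al be ->
  exists P Q : R -> R, [/\ lbd nrm1 P, lbd nrm1 Q &
    {ae leb2 R, forall z : R * R, primy al z - P z.1 = primx be z + Q z.2}].
Proof.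
move=> ba bb wp.
have [||P [Q [lP lQ PQ]]] := @weak_mixed (fun z => primy al z + - primx be z).
- by apply: lbdD; [exact: primy_lbd|apply: lbdN; exact: primx_lbd].
- move=> h1 h2 t1 t2; have t1' := test1_deriv t1; have t2' := test1_deriv t2.
  have la := primy_lbd ba; have lb := primx_lbd bb.
  rewrite T2_add//; last exact: lbdN.
  rewrite T2_opp//.
  have -> : T2 (primy al) (derive1 h1) (derive1 h2) = - T2 al (derive1 h1) h2.
    rewrite T2_int// T2_int//; last exact: bnd_lbd.
    rewrite -mulN1r -RintegralZl//.
      apply: eq_Rintegral => x _.
      by rewrite (prim_ibp (bnd_slice1 x ba) t2); ring.
    apply: integrable_bms; apply: bmsMl; last exact: test1_bms.
    exact: lbd_int_snd (bnd_lbd _ ba) t2.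
  have -> : T2 (primx be) (derive1 h1) (derive1 h2) = - T2 be h1 (derive1 h2).
    rewrite T2_int'// T2_int'//; last exact: bnd_lbd.
    rewrite -mulN1r -RintegralZl//.
      apply: eq_Rintegral => x _.
      by rewrite (prim_ibp (bnd_slice2 x bb) t1); ring.
    apply: integrable_bms; apply: bmsMl; last exact: test1_bms.
    exact: lbd_int_fst (bnd_lbd _ bb) t1.
  by rewrite wp// subrr.
- by exists P, Q; split => //; apply: aeS PQ => z; lra.
Qed.

Lemma prim_ae0 (h : R -> R) : bnd h -> {ae leb R, forall t : R, h t = 0} ->
  forall x, prim h x = 0.
Proof.
move=> bh h0 x; rewrite /prim -[RHS](_ : \int[leb R]_(t in [set: R]) cst 0 t = 0); last first.
  by rewrite Rintegral_cst// mul0r.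
apply: ae_eq_Rintegral => //; first by case: (prim_bms x bh).
by apply: aeS h0 => t ->; rewrite mul0r.
Qed.

Lemma ae_witness (Z G : R -> Prop) : ~ {ae leb R, forall x : R, ~ Z x} ->
  {ae leb R, forall x : R, G x} -> exists2 x, Z x & G x.
Proof.
move=> nZ aG; apply: contrapT => nx; apply: nZ; apply: aeS aG => x Gx Zx.
by apply: nx; exists x.
Qed.

Lemma ae2_prod (Pr : R * R -> Prop) : {ae leb2 R, forall z, Pr z} ->
  {ae leb R, forall x, {ae leb R, forall y, Pr (x, y)}}.
Proof. exact: ae_prod. Qed.

Lemma ae2_prod_swap (Pr : R * R -> Prop) : {ae leb2 R, forall z, Pr z} ->
  {ae leb R, forall y, {ae leb R, forall x, Pr (x, y)}}.
Proof. exact: ae_prod_swap. Qed.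

(* If [al] vanishes on a non-null family of vertical lines and [be] on the
   horizontal lines y in W, then the potential is constant on the union of
   these lines, so its y-derivative [al] vanishes for y in W. *)
Lemma crossing_lines al be : bnd al -> bnd be -> weak_potential al be ->
  ~ {ae leb R, forall x : R, ~ {ae leb R, forall y : R, al (x, y) = 0}} ->
  {ae leb R, forall x : R, {ae leb R, forall y : R,
    {ae leb R, forall s : R, be (s, y) = 0} -> al (x, y) = 0}}.
Proof.
move=> ba bb wp nZ; have [P [Q [_ _ PQ]]] := potential ba bb wp.
have PQ1 := ae2_prod PQ.
have [x0 Zx0 PQx0] := ae_witness nZ PQ1.
have Bx0 y x : {ae leb R, forall s : R, be (s, y) = 0} -> primx be (x, y) = 0.
  by move=> Wy; apply: prim_ae0 => //; exact: bnd_slice2.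
move: PQ1; apply: aeS => x PQx.
apply: (prim_const_zero (K := P x - P x0)); first exact: bnd_slice1.
apply: aeS2 PQx0 PQx => y; rewrite /= !{1}/primy /= => h0 h1 Wy.
move: h0 h1; rewrite !Bx0// (prim_ae0 (bnd_slice1 x0 ba) Zx0); lra.
Qed.

End planar.

(** * Transport along characteristics *)

Section transport.
Context {R : realType}.
Implicit Types (al be : R * R -> R).

Lemma test1_int_shift (h : R -> R) c : test1 h ->
  \int[leb R]_y derive1 h (y + c) = 0.
Proof. by move=> th; rewrite -derive1_shift// test1_int_deriv//; exact: test1_shift. Qed.

Lemma bms_sheared (h k Gam : R -> R) : test1 h -> test1 k -> Lip Gam ->
  bms nrm2 (fun z : R * R => k z.1 * h (z.2 + Gam z.1)).
Proof.
move=> th tk LG; have [_ [N hN]] := th; have [_ [M kM]] := tk.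
have [mh [C hC]] := test1_bnd th; have [mk [D kD]] := test1_bnd tk.
have C0 : 0 <= C by rewrite (le_trans _ (hC 0)).
have D0 : 0 <= D by rewrite (le_trans _ (kD 0)).
have [G GC] := Lip_bounded LG M.
split.
  apply: measurable_funM; first exact: measurableT_comp.
  apply: (measurableT_comp mh); apply: measurable_funD => //.
  by apply: measurableT_comp => //; exact: Lip_measurable.
exists (Num.max (D * C) (Num.max M (N + G))); split => -[x y].
  by rewrite normrM le_max ler_pM.
rewrite gt_max => /andP[_].
have [xM|xM _] := leP `|x| M; last by rewrite /= kM// mul0r.
rewrite nrmX_lt/= !gt_max => /orP[/andP[]|/andP[_ yN]].
  by rewrite /nrm1 ltNge xM.
rewrite hN ?mulr0//; have := ler_normB (y + Gam x) (Gam x); rewrite addrK.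
by have := GC _ xM; move: yN; rewrite /nrm1; lra.
Qed.

(* Along y + Gam x = const, the equation d_x al = d_y (gam al + del) with
   Gam' = gam becomes d_x al = 0. *)
Lemma transport al be (gam del Gam : R -> R) : bnd al -> bnd be ->
  weak_potential al be -> bnd gam -> bnd del ->
  Lip Gam -> {ae leb R, forall x : R, is_derive x (1 : R) Gam (gam x)} ->
  {ae leb2 R, forall z : R * R, be z = gam z.1 * al z + del z.1} ->
  exists2 n : R -> R, measurable_fun [set: R] n &
    {ae leb2 R, forall z : R * R, al (z.1, z.2 - Gam z.1) = n z.2}.
Proof.
move=> ba bb wp bg bd LG Gg beE.
have [P [Q [lP lQ PQ]]] := potential ba bb wp.
have mG := Lip_measurable LG.
pose N (z : R * R) := al (z.1, z.2 - Gam z.1).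
have bN : bnd N.
  have [ma [C hC]] := ba; split; last by exists C => z; exact: hC.
  apply: (measurableT_comp ma); apply: measurable_fun_pair => //.
  by apply: measurable_funB => //; exact: measurableT_comp.
have [r mr] := @mean_test_exists R.
have lN := bnd_lbd nrm2 bN.
exists (fun y => \int[leb R]_x (N (x, y) * r x)).
  by case: (lbd_int_fst lN mr.1).
apply: (weak_indep1 lN mr) => xi ze txi tze.
have txi' := test1_deriv txi; have tze' := test1_deriv tze.
(* Two representatives of one potential: [phi1] is Lipschitz in y with derivative [al], [phi2] is
   Lipschitz in x with derivative [be]. Each integration by parts uses the one that is regular in
   its own variable, and they are exchanged under double integrals. *)
pose phi1 (z : R * R) := primy al z - P z.1.
pose phi2 (z : R * R) := primx be z + Q z.2.
have l1 : lbd nrm2 phi1 by apply: lbdB; [exact: primy_lbd|exact: lbd_fst].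
have l2 : lbd nrm2 phi2 by apply: lbdD; [exact: primx_lbd|exact: lbd_snd].
have inner h x : test1 h -> \int[leb R]_y (phi1 (x, y) * derive1 h (y + Gam x)) =
    - \int[leb R]_y (al (x, y) * h (y + Gam x)).
  move=> th; have th' := test1_deriv th.
  have tsh := test1_shift (Gam x) th; have tsh' := test1_deriv tsh.
  rewrite -(prim_ibp (bnd_slice1 x ba) tsh) derive1_shift//.
  rewrite -[RHS]subr0 -(mulr0 (P x)) -(test1_int_shift (Gam x) th) -int_comb//.
  - by apply: eq_Rintegral => y _; rewrite /phi1 /primy /=; ring.
  - apply: integrable_bms; apply: bmsMl; last by apply: test1_bms; exact: test1_shift.
    by apply: Lip_lbd; apply: prim_Lip; exact: bnd_slice1.
  - by apply: test1_integrable; exact: test1_shift.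
have bK h k : test1 h -> test1 k -> bms nrm2 (fun z : R * R => k z.1 * h (z.2 + Gam z.1)).
  by move=> th tk; exact: (bms_sheared th tk LG).
pose K (z : R * R) := derive1 xi z.1 * derive1 ze (z.2 + Gam z.1).
have bmK : bms nrm2 K by exact: bK.
(* On each vertical line the shear is undone by a translation, and integration by parts in y moves
   the pairing to the potential. *)
have T2E : T2 N (derive1 xi) ze = - \int[leb2 R]_z (phi1 z * K z).
  rewrite T2_int// int2E; last exact: bmsMl.
  rewrite -mulN1r -RintegralZl//; last first.
    apply: integrable_bms.
    exact: (bms_int1 (n1 := @nrm1 R) finite_balls1 (bmsMl l1 bmK)).
  apply: eq_Rintegral => x _.
  rewrite (_ : \int[leb R]_y (phi1 (x, y) * K (x, y)) =
     derive1 xi x * \int[leb R]_y (phi1 (x, y) * derive1 ze (y + Gam x))).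
    rewrite inner// -(Rintegral_shift (Gam x)); last first.
      by apply: bmsMl; [exact: lbd_slice1 lN|exact: test1_bms].
    rewrite mulrN mulN1r opprK mulrC; congr (_ * _).
    by apply: eq_Rintegral => y _; rewrite /N/= addrK.
  rewrite -RintegralZl//.
    by apply: eq_Rintegral => y _; rewrite /K/=; ring.
  apply: integrable_bms; apply: bmsMl; first exact: lbd_slice1 l1.
  by apply: test1_bms; exact: test1_shift.
rewrite T2E.
have -> : \int[leb2 R]_z (phi1 z * K z) = \int[leb2 R]_z (phi2 z * K z).
  apply: ae_eq_Rintegral.
  - by apply: measurable_funM; [case: l1|case: bmK].
  - by apply: measurable_funM; [case: l2|case: bmK].
  - by apply: aeS PQ => z ez; rewrite /phi1 ez.
pose S1 (z : R * R) := xi z.1 * derive1 ze (z.2 + Gam z.1).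
pose S2 (z : R * R) := xi z.1 * derive1 (derive1 ze) (z.2 + Gam z.1).
have bS1 : bms nrm2 S1 by exact: bK.
have bS2 : bms nrm2 S2 by apply: bK => //; exact: test1_deriv.
have lg1 : lbd nrm2 (fun z : R * R => gam z.1) by apply/lbd_fst/bnd_lbd.
have ld1 : lbd nrm2 (fun z : R * R => del z.1) by apply/lbd_fst/bnd_lbd.
(* [J + phi2 K] is the x-derivative of phi2(x, y) xi(x) ze'(y + Gam x), so it integrates to zero on
   almost every horizontal line. *)
pose J (z : R * R) := be z * S1 z + phi2 z * (gam z.1 * S2 z).
have bJ : bms nrm2 J.
  apply: bmsD; first by apply: bmsMl => //; exact: bnd_lbd.
  by apply: bmsMl => //; exact: bmsMl.
have bpK : bms nrm2 (fun z => phi2 z * K z) by exact: bmsMl.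
have outer : \int[leb2 R]_z (J z + phi2 z * K z) = 0.
  have bJK : bms nrm2 (fun z => J z + phi2 z * K z) by exact: bmsD.
  rewrite int2E// (int2_swap bJK).
  transitivity (\int[leb R]_(y in [set: R]) cst 0 y); last by rewrite Rintegral_cst// mul0r.
  apply: eq_Rintegral => y _.
  have Lph : Lip (fun x => phi2 (x, y)) :=
    LipD (prim_Lip (bnd_slice2 y bb)) (Lip_cst (Q y)).
  have Lz : Lip (fun x => derive1 ze (y + Gam x)).
    exact: (Lip_comp (test1_Lip tze') (LipD (Lip_cst y) LG)).
  have [_ [M xiM]] := txi.
  have supp : exists M, forall x, M < `|x| -> xi x * derive1 ze (y + Gam x) = 0.
    by exists M => x /xiM ->; rewrite mul0r.
  apply: (Rintegral_deriv_Lip (G := fun x => phi2 (x, y) * (xi x * derive1 ze (y + Gam x)))).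
  - apply: LipM => //; rewrite (_ : (fun x => _) = fun x => derive1 ze (y + Gam x) * xi x).
      by apply: LipM => //; [exact: test1_Lip|exists M].
    by apply/funext => x; rewrite mulrC.
  - by have [M' hM'] := supp; exists M' => x /hM' ->; rewrite mulr0.
  - exact: (bms_slice2 y bJK).
  - apply: aeS2 (prim_ae (bnd_slice2 y bb)) Gg => x dB dG.
    have dphi : is_derive (x : R) (1 : R) (fun x => phi2 (x, y)) (be (x, y)).
      exact: (is_derive_eq (is_deriveD dB (is_derive_cst (Q y) (x : R) (1 : R))) (addr0 _)).
    have dze : is_derive (x : R) (1 : R) (fun x => derive1 ze (y + Gam x))
        (derive1 (derive1 ze) (y + Gam x) * gam x).
      have dy : is_derive (x : R) (1 : R) (fun x => y + Gam x) (gam x) :=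
        is_derive_eq (is_deriveD (is_derive_cst y (x : R) (1 : R)) dG) (add0r _).
      exact: (@is_derive1_comp R (derive1 ze) (fun x => y + Gam x) x _ _
        (smooth1_is_derive tze'.1 (y + Gam x)) dy).
    have dxi := smooth1_is_derive txi.1 x.
    apply: (is_derive_eq (is_deriveMR dphi (is_deriveMR dxi dze))).
    by rewrite /J /S1 /S2 /K/=; ring.
(* Inserting be = gam al + del turns [J] into gam xi times the y-derivative of phi1 ze'(y + Gam),
   plus del xi ze'(y + Gam); both integrate to zero on vertical lines. The shear is chosen for this
   cancellation. *)
have JE : \int[leb2 R]_z J z = 0.
  pose J' (z : R * R) := gam z.1 * (al z * S1 z) + gam z.1 * (phi1 z * S2 z) + del z.1 * S1 z.
  have b1 : bms nrm2 (fun z => al z * S1 z) by apply: bmsMl => //; exact: bnd_lbd.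
  have b2 : bms nrm2 (fun z => phi1 z * S2 z) by exact: bmsMl.
  have bJ' : bms nrm2 J'.
    by apply: bmsD; [apply: bmsD|]; exact: bmsMl.
  transitivity (\int[leb2 R]_z J' z).
    apply: ae_eq_Rintegral; [by case: bJ|by case: bJ'|].
    apply: aeS2 PQ beE => z ez bz; rewrite /J /J' bz.
    rewrite (_ : phi2 z = phi1 z); last by rewrite /phi1 ez.
    ring.
  rewrite int2E//.
  transitivity (\int[leb R]_(y in [set: R]) cst 0 y); last by rewrite Rintegral_cst// mul0r.
  apply: eq_Rintegral => x _.
  have t0 := test1_shift (Gam x) tze'.
  have t1 := test1_shift (Gam x) (test1_deriv tze').
  have i1 : (leb R).-integrable [set: R] (EFin \o (fun y => al (x, y) * derive1 ze (y + Gam x))).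
    by apply: integrable_bms; apply: bmsMl; [apply/bnd_lbd; exact: bnd_slice1|exact: test1_bms].
  have i2 : (leb R).-integrable [set: R] (EFin \o (fun y => phi1 (x, y) * derive1 (derive1 ze) (y + Gam x))).
    by apply: integrable_bms; apply: bmsMl; [exact: lbd_slice1 l1|exact: test1_bms].
  rewrite (_ : (fun y => J' (x, y)) = fun y =>
    (gam x * xi x) * (al (x, y) * derive1 ze (y + Gam x)) +
    (gam x * xi x) * (phi1 (x, y) * derive1 (derive1 ze) (y + Gam x)) +
    (del x * xi x) * derive1 ze (y + Gam x)); last first.
    by apply/funext => y; rewrite /J' /S1 /S2/=; ring.
  have iZ c F : (leb R).-integrable [set: R] (EFin \o F) ->
      (leb R).-integrable [set: R] (EFin \o (fun y => c * F y)).
    by move=> iF; have := integrableZl measurableT c iF; apply: eq_integrable.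
  have i3 := test1_integrable t0.
  rewrite RintegralD//; [|by have := integrableD measurableT (iZ (gam x * xi x) _ i1) (iZ (gam x * xi x) _ i2); exact: eq_integrable|exact: iZ].
  rewrite RintegralD//; [|exact: iZ|exact: iZ].
  rewrite !RintegralZl// test1_int_shift// inner//.
  by rewrite /=; ring.
move: outer; rewrite RintegralD//; [|exact: bms_int2f|exact: bms_int2f].
by rewrite JE add0r => ->; rewrite oppr0.
Qed.

End transport.

(** * The combinatorics of the wells *)

Section ae_nested.
Context {R : realType}.

Lemma ae_ex (P : R -> Prop) : {ae leb R, forall x : R, P x} -> exists x, P x.
Proof.
move=> aP; apply: contrapT => nP.
have : {ae leb R, forall x : R, False} by apply: aeS aP => x Px; apply: nP; exists x.
move=> [A [mA A0 HA]].
have : (leb R (`]0%R, 1%R[%classic : set R) <= leb R A)%E.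
  by apply: le_measure; rewrite ?inE// => t _; exact: HA.
by rewrite A0 lebesgue_measure_itv/= lte_fin ltr01 sube0 lee_fin ler10.
Qed.

Lemma ae_cst (P : Prop) : {ae leb R, forall x : R, P} -> P.
Proof. by move/ae_ex => []. Qed.

Lemma ae3_nest (P : R * R * R -> Prop) : {ae leb3 R, forall x, P x} ->
  {ae leb R, forall x, {ae leb R, forall y, {ae leb R, forall z, P (x, y, z)}}}.
Proof.
move=> aP; have := @ae_prod _ _ _ _ _ (leb2 R) (leb R) _ aP.
by move/ae2_prod. Qed.

Lemma ae3_of_nest (P : R * R * R -> Prop) : measurable [set x | P x] ->
  {ae leb R, forall x, {ae leb R, forall y, {ae leb R, forall z, P (x, y, z)}}} ->
  {ae leb3 R, forall x, P x}.
Proof.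
move=> mP aP; apply: (@prod_ae _ _ _ _ _ (leb2 R) (leb R)) => //.
(* The condition that almost every z be good is replaced by the vanishing of the measure of a
   section, which is measurable in [w], so that the two-dimensional statement applies to it. *)
pose B : set (R * R) := [set w | (leb R (xsection (~` [set x | P x]) w) = 0)%E].
have mB : measurable B.
  have := measurable_fun_xsection (leb R) (measurableC mP).
  move=> /(_ measurableT [set 0%E]) /=; rewrite setTI.
  by apply; exact: emeasurable_set1.
have BP w : B w <-> {ae leb R, forall z, P (w, z)}.
  have mx : measurable (xsection (~` [set x | P x]) w).
    by apply: measurable_xsection; exact: measurableC.
  have xE : xsection (~` [set x | P x]) w = ~` [set z | P (w, z)].
    by apply/seteqP; split => z; rewrite /xsection/= inE.
  rewrite /B/= xE; rewrite xE in mx; split => [B0|[A [mA A0 PA]]].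
    by exists (~` [set z | P (w, z)]); split => //; exact: B0.
  by apply/eqP; rewrite -measure_le0 -A0 le_measure ?inE.
suff : {ae leb2 R, forall w, B w} by apply: aeS => w /BP.
by apply: prod_ae => //; apply: aeS aP => x; apply: aeS => y /BP.
Qed.

Lemma ae_swap2 (P : R * R -> Prop) : measurable [set z | P z] ->
  {ae leb R, forall x, {ae leb R, forall y, P (x, y)}} ->
  {ae leb R, forall y, {ae leb R, forall x, P (x, y)}}.
Proof. exact: (@ae_swap _ _ _ _ _ (leb R) (leb R)). Qed.

(** Passing to a measurable subset of full measure is what makes the converse of Fubini, and with it
    the exchange of variables, available for any [P]. *)
Lemma ae3_measurable (P : R * R * R -> Prop) : {ae leb3 R, forall x, P x} ->
  exists Q : set (R * R * R), [/\ measurable Q, Q `<=` [set x | P x] &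
    {ae leb3 R, forall x, Q x}].
Proof.
move=> [A [mA A0 PA]]; exists (~` A); split; first exact: measurableC.
  by move=> x nA; apply: contrapT => /PA.
by exists A; split => // x /= /contrapT.
Qed.

Lemma ae3_s23 (P : R * R * R -> Prop) : {ae leb3 R, forall x, P x} ->
  {ae leb3 R, forall x, P (s23 x)}.
Proof.
move=> /ae3_measurable[Q [mQ QP aQ]].
suff : {ae leb3 R, forall x, Q (s23 x)} by apply: aeS => x /QP.
have mQs : measurable [set x | Q (s23 x)].
  by have := s23_meas measurableT mQ; rewrite setTI.
apply: ae3_of_nest => //; have := ae3_nest aQ; apply: aeS => x.
apply: (@ae_swap2 (fun w => Q (x, w.1, w.2))).
have ms : measurable_fun [set: R * R] (fun w : R * R => (x, w.1, w.2)).
  by apply: measurable_fun_pair => //; apply: measurable_fun_pair.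
by have := ms measurableT _ mQ; rewrite setTI.
Qed.

Lemma ae3_s12 (P : R * R * R -> Prop) : {ae leb3 R, forall x, P x} ->
  {ae leb3 R, forall x, P (s12 x)}.
Proof.
move=> /ae3_measurable[Q [mQ QP aQ]].
suff : {ae leb3 R, forall x, Q (s12 x)} by apply: aeS => x /QP.
have mQs : measurable [set x | Q (s12 x)].
  by have := s12_meas measurableT mQ; rewrite setTI.
apply: ae3_of_nest => //.
have [A [mA A0 QA]] := @ae_prod _ _ _ _ _ (leb2 R) (leb R) _ aQ.
have aA : {ae leb2 R, forall w, (~` A) w}.
  by exists A; split => // w /= /contrapT.
apply: aeS (ae2_prod_swap aA) => x; apply: aeS => y nA.
by apply: contrapT => h; apply: nA; apply: QA.
Qed.

Lemma measurable_eq d (T : measurableType d) (f g : T -> R) :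
  measurable_fun [set: T] f -> measurable_fun [set: T] g ->
  measurable [set x | f x = g x].
Proof.
move=> mf mg; rewrite (_ : [set x | _] = [set: T] `&` (f \- g) @^-1` [set 0]).
  by apply: measurable_funB.
rewrite setTI; apply/seteqP; split => x /=; first by move=> ->; rewrite subrr.
by move=> /eqP; rewrite subr_eq0 => /eqP.
Qed.

End ae_nested.

(** * Sums of functions of separate variables with values -1 and 1 *)

Section dichotomy.
Context {R : realType}.
Implicit Types (f g : R -> R).

Definition slice_mean (al : R * R -> R) (m : R) := exists r, mean_test r /\
  {ae leb R, forall x, \int[leb R]_y (al (x, y) * r y) = m}.

Lemma mean_cst f r m k : bnd f -> mean_test r -> \int[leb R]_y (f y * r y) = m ->
  {ae leb R, forall y : R, f y = k} -> k = m.
Proof.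
move=> bf [tr ir] <- fk; rewrite -[LHS]mulr1 -ir -RintegralZl_test//.
apply: ae_eq_Rintegral.
- by case: (test1_bnd tr) => mr _; exact: measurable_funM.
- by case: (test1_bnd tr) => mr _; apply: measurable_funM => //; case: bf.
- by apply: aeS fk => y ->.
Qed.

Definition sgn1 (x : R) := x = 1 \/ x = -1.

(** If [f] takes two different values, then for almost every z the two sums with the same [g z] are
    opposite signs; the sign of the jump of [f] tells which sum is 1, and this determines [g z]. *)
Lemma sum_sign_dichotomy f g m : bnd f -> bnd g ->
  {ae leb R, forall y : R, {ae leb R, forall z : R, sgn1 (f y + g z - m)}} ->
  (exists k, {ae leb R, forall y : R, f y = k}) \/
  (exists k, {ae leb R, forall z : R, g z = k}).
Proof.
move=> bf bg H; have [gk|ng] := pselect (exists k, {ae leb R, forall z : R, g z = k}).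
  by right.
left; have [y0 H0] := ae_ex H; exists (f y0); apply: aeS H => y Hy.
apply: contrapT => fy; apply: ng.
(* A jump of 2 means that the sum is -1 at [y] and 1 at [y0]; otherwise the jump is -2 and the signs
   are reversed. *)
exists (if f y0 == f y + 2 then m - 1 - f y else m + 1 - f y).
apply: aeS2 H0 Hy => z; rewrite /sgn1 => h0 hy.
case: ifPn => [/eqP e|/eqP e]; first by case: h0 => h0; case: hy => hy; lra.
case: h0 => h0; case: hy => hy; try lra; exfalso;
  by first [apply: fy; lra|apply: e; lra].
Qed.

End dichotomy.

(** * Which variable each shear component loses *)

Section core.
Context {R : realType}.
Implicit Types (al be : R * R -> R).

Definition tr al (z : R * R) := al (z.2, z.1).

Definition Zl al (m x : R) := {ae leb R, forall y : R, al (x, y) = m}.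
Definition ZZ al m := {ae leb R, forall x : R, Zl al m x}.
(** Its negation says that the lines on which [al] equals [m] form a non-null set, without asserting
    that this set is measurable. *)
Definition nZ al m := {ae leb R, forall x : R, ~ Zl al m x}.

(* The first argument of each function is the variable which decides, line by
   line, on which of the other two variables the strain component depends:
   e_23 = a12(x1,x2) + a13(x1,x3) - ma, e_13 = b21(x2,x1) + b23(x2,x3) - mb,
   e_12 = c31(x3,x1) + c32(x3,x2) - mc. *)
Record core (a12 a13 b21 b23 c31 c32 : R * R -> R) (ma mb mc : R) : Prop := Core {
  core_bnd : [/\ bnd a12, bnd a13 & bnd b21] /\ [/\ bnd b23, bnd c31 & bnd c32];
  core12 : weak_potential a12 (tr b21);
  core13 : weak_potential a13 (tr c31);
  core23 : weak_potential b23 (tr c32);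
  core_mean : [/\ slice_mean a12 ma, slice_mean a13 ma & slice_mean b21 mb] /\
    [/\ slice_mean b23 mb, slice_mean c31 mc & slice_mean c32 mc];
  core_sgn : {ae leb3 R, forall x : R * R * R,
    let a := a12 (x.1.1, x.1.2) + a13 (x.1.1, x.2) - ma in
    let b := b21 (x.1.2, x.1.1) + b23 (x.1.2, x.2) - mb in
    let c := c31 (x.2, x.1.1) + c32 (x.2, x.1.2) - mc in
    [/\ sgn1 a, sgn1 b, sgn1 c & a * b * c = 1]};
  core_ext : [/\ sgn1 ma -> ZZ a12 ma /\ ZZ a13 ma,
    sgn1 mb -> ZZ b21 mb /\ ZZ b23 mb & sgn1 mc -> ZZ c31 mc /\ ZZ c32 mc]
}.

Lemma bnd_tr al : bnd al -> bnd (tr al).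
Proof. exact: bnd_swap. Qed.

Lemma T2_tr al h1 h2 : bnd al -> test1 h1 -> test1 h2 ->
  T2 (tr al) h1 h2 = T2 al h2 h1.
Proof.
move=> ba t1 t2; rewrite T2_int; [|by apply: bnd_lbd; exact: bnd_tr|by []|by []].
by rewrite T2_int'//; exact: bnd_lbd.
Qed.

Lemma weak_potential_tr al be : bnd al -> bnd be ->
  weak_potential al (tr be) -> weak_potential be (tr al).
Proof.
move=> ba bb wp h1 h2 t1 t2; have t1' := test1_deriv t1; have t2' := test1_deriv t2.
by rewrite T2_tr// wp// T2_tr.
Qed.

(** Exchanging x1 and x2 exchanges e_23 with e_13 and the two parts of e_12. With [core_swap23] it
    generates all permutations of the coordinates, so that each fact is proved for one component
    only. *)
Lemma core_swap12 a12 a13 b21 b23 c31 c32 ma mb mc :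
  core a12 a13 b21 b23 c31 c32 ma mb mc -> core b21 b23 a12 a13 c32 c31 mb ma mc.
Proof.
move=> [[[ba12 ba13 bb21] [bb23 bc31 bc32]] w12 w13 w23
  [[mn1 mn2 mn3] [mn4 mn5 mn6]] sg [e1 e2 e3]]; split => //.
- exact: weak_potential_tr.
- apply: aeS (ae3_s12 sg) => -[[x y] z]; rewrite /s12/= => -[sa sb sc p].
  rewrite (addrC (c32 _)); split => //.
  by rewrite -[RHS]p; ring.
- by split => // /e3[].
Qed.

Lemma core_swap23 a12 a13 b21 b23 c31 c32 ma mb mc :
  core a12 a13 b21 b23 c31 c32 ma mb mc -> core a13 a12 c31 c32 b21 b23 ma mc mb.
Proof.
move=> [[[ba12 ba13 bb21] [bb23 bc31 bc32]] w12 w13 w23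
  [[mn1 mn2 mn3] [mn4 mn5 mn6]] sg [e1 e2 e3]]; split => //.
- exact: weak_potential_tr.
- apply: aeS (ae3_s23 sg) => -[[x y] z]; rewrite /s23/= => -[sa sb sc p].
  rewrite (addrC (a13 _)); split => //.
  by rewrite -[RHS]p; ring.
- by split => // /e1[].
Qed.

(** All lines have the same mean, so on a line where [al] is constant the constant can only be
    [m]. *)
Lemma slice_mean_cst al m : bnd al -> slice_mean al m ->
  {ae leb R, forall x, forall k, {ae leb R, forall y : R, al (x, y) = k} -> Zl al m x}.
Proof.
move=> ba [r [mr am]]; apply: aeS am => x ax k ak.
by rewrite /Zl -(mean_cst (bnd_slice1 x ba) mr ax ak).
Qed.

Lemma ZZ_swap al m : bnd al -> ZZ al m ->
  {ae leb R, forall y, {ae leb R, forall x, al (x, y) = m}}.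
Proof.
move=> ba; apply: (@ae_swap2 R (fun z => al z = m)).
by apply: measurable_eq => //; case: ba.
Qed.

Section core_facts.
Context (a12 a13 b21 b23 c31 c32 : R * R -> R) (ma mb mc : R).
Hypothesis C : core a12 a13 b21 b23 c31 c32 ma mb mc.

Lemma core_nest : {ae leb R, forall x, {ae leb R, forall y, {ae leb R, forall z,
    let a := a12 (x, y) + a13 (x, z) - ma in
    let b := b21 (y, x) + b23 (y, z) - mb in
    let c := c31 (z, x) + c32 (z, y) - mc in
    [/\ sgn1 a, sgn1 b, sgn1 c & a * b * c = 1]}}}.
Proof. exact: ae3_nest (core_sgn C). Qed.

Lemma core_nest' : {ae leb R, forall x, {ae leb R, forall z, {ae leb R, forall y,
    let a := a12 (x, y) + a13 (x, z) - ma in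
    let b := b21 (y, x) + b23 (y, z) - mb in
    let c := c31 (z, x) + c32 (z, y) - mc in
    [/\ sgn1 a, sgn1 b, sgn1 c & a * b * c = 1]}}}.
Proof. exact: ae3_nest (ae3_s23 (core_sgn C)). Qed.

Lemma core_dich : {ae leb R, forall x, Zl a12 ma x \/ Zl a13 ma x}.
Proof.
have [[[ba12 ba13 _] _] _ _ _ [[m12 m13 _] _] _ _] := C.
apply: aeS3 core_nest (slice_mean_cst ba12 m12) (slice_mean_cst ba13 m13).
move=> x sx h12 h13.
have [] := sum_sign_dichotomy (m := ma) (bnd_slice1 x ba12) (bnd_slice1 x ba13) _.
- by apply: aeS sx => y; apply: aeS => z [].
- by move=> [k /h12]; left.
- by move=> [k /h13]; right.
Qed.

Lemma core_nZ12 : nZ a12 ma -> ZZ a13 ma.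
Proof. by move=> n; apply: aeS2 core_dich n => x []. Qed.

Lemma core_nZ13 : nZ a13 ma -> ZZ a12 ma.
Proof. by move=> n; apply: aeS2 core_dich n => x []. Qed.

End core_facts.

Lemma T2_ae al be h1 h2 : bnd al -> bnd be -> test1 h1 -> test1 h2 ->
  {ae leb2 R, forall z, al z = be z} -> T2 al h1 h2 = T2 be h1 h2.
Proof.
move=> ba bb t1 t2 e; apply: ae_eq_Rintegral.
- by case: (bms2M (bnd_lbd nrm2 ba) t1 t2).
- by case: (bms2M (bnd_lbd nrm2 bb) t1 t2).
- by apply: aeS e => z ->.
Qed.

Lemma T2_subc al c h1 h2 : bnd al -> test1 h1 -> test1 h2 ->
  T2 (fun z => al z - c) h1 h2 =
  T2 al h1 h2 - c * ((\int[leb R]_x h1 x) * (\int[leb R]_x h2 x)).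
Proof.
move=> ba t1 t2; rewrite T2_add//; [|exact: bnd_lbd|exact/bnd_lbd/(bnd_cst (- c))].
by rewrite -/(cst (- c)) T2_cst// mulNr.
Qed.

Lemma weak_potential_subc al be c c' : bnd al -> bnd be -> weak_potential al be ->
  weak_potential (fun z => al z - c) (fun z => be z - c').
Proof.
move=> ba bb wp h1 h2 t1 t2; have t1' := test1_deriv t1; have t2' := test1_deriv t2.
by rewrite !T2_subc// !test1_int_deriv// mul0r !mulr0 !subr0 wp.
Qed.

Lemma bnd_subc al c : bnd al -> bnd (fun z => al z - c).
Proof. by move=> ba; apply: bndB => //; exact: bnd_cst. Qed.

(** On a slice where a12 is not constant, a13 = ma and hence a12 = +-1. By [crossing_lines], a12 =
    ma wherever such a slice meets a transversal line on which b21 is constant. If ma is not a sign,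
    almost no such transversal line can exist, against the hypothesis on b21; if ma is a sign, e_23
    is constant by [core_ext]. *)
Lemma core_star a12 a13 b21 b23 c31 c32 ma mb mc :
  core a12 a13 b21 b23 c31 c32 ma mb mc ->
  ~ nZ a12 ma -> ~ nZ b21 mb -> ZZ a12 ma.
Proof.
move=> C nA nB; have [[[ba12 ba13 bb21] _] w12 _ _ _ _ [e1 _ _]] := C.
have [sma|nsma] := pselect (sgn1 ma); first by have [] := e1 sma.
have := crossing_lines (bnd_subc ma ba12) (bnd_subc mb (bnd_tr bb21))
  (weak_potential_subc ma mb ba12 (bnd_tr bb21) w12).
have nA' : ~ {ae leb R, forall x, ~ {ae leb R, forall y, a12 (x, y) - ma = 0}}.
  move=> h; apply: nA; apply: aeS h => x nx Zx; apply: nx.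
  by apply: aeS Zx => y ->; rewrite subrr.
move=> /(_ nA') H; apply: aeS3 H (core_dich C) (core_nest C).
move=> x hx [//|Z13] sx; exfalso; apply: nB.
have s1 : {ae leb R, forall y : R, sgn1 (a12 (x, y))}.
  apply: aeS sx => y sy; apply: ae_cst; apply: aeS2 sy Z13 => z [h _ _ _] e.
  by move: h; rewrite e addrK.
apply: aeS2 hx s1 => y hy sy By; apply: nsma.
rewrite (_ : ma = a12 (x, y))//; apply/eqP; rewrite eq_sym -subr_eq0; apply/eqP/hy.
by apply: aeS By => s; rewrite /tr/= => ->; rewrite subrr.
Qed.

(* Otherwise e_13 = gam (e_23 - ma) + del with gam and del depending on x1 only,
   and [transport] carries the vanishing of a12 - ma from one line x1 = const to
   all the others. *)
Lemma core_partial a12 a13 b21 b23 c31 c32 ma mb mc :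
  core a12 a13 b21 b23 c31 c32 ma mb mc -> ~ ZZ a12 ma -> ~ ZZ a13 ma -> False.
Proof.
move=> C n12 n13; have [[[ba12 ba13 bb21] [bb23 bc31 bc32]] w12 _ _
  [[[r [mr ar]] m13 m21] [m23 [r' [mr' cr]] m32]] _ _] := C.
have nn12 : ~ nZ a12 ma by move=> /(core_nZ12 C).
have nn13 : ~ nZ a13 ma by move=> /(core_nZ13 C).
(* Were b21 constant on a non-null set of lines, [core_star] would make a12 constant on almost every
   line; so the alternative for e_13 always falls on b23. *)
have Z23 : ZZ b23 mb.
  apply: (core_nZ12 (core_swap12 C)); apply: contrapT => h.
  by apply: n12; exact: core_star C _ h.
have Z32 : ZZ c32 mc.
  apply: (core_nZ12 (core_swap12 (core_swap23 C))); apply: contrapT => h.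
  by apply: n13; exact: core_star (core_swap23 C) _ h.
(* The coefficients are written as averages to be measurable in x1; their values are computed on the
   two kinds of slices separately. *)
pose gam x := \int[leb R]_z (c31 (z, x) * r' z).
pose del x := \int[leb R]_y (b21 (y, x) * r y).
have bgam : bnd gam by exact: (bnd_int (bnd_tr bc31) mr'.1).
have bdel : bnd del by exact: (bnd_int (bnd_tr bb21) mr.1).
have bal := bnd_subc ma ba12.
pose al z := a12 z - ma; pose be := tr b21.
have avg (f : R -> R) k q : bnd f -> mean_test q -> {ae leb R, forall y : R, f y = k} ->
    \int[leb R]_y (f y * q y) = k.
  by move=> bf mq fk; rewrite -(mean_cst bf mq erefl fk).
have key : {ae leb R, forall x, {ae leb R, forall y,
    b21 (y, x) = gam x * (a12 (x, y) - ma) + del x}}.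
  have N1 : {ae leb R, forall x, {ae leb R, forall y, {ae leb R, forall z,
      [/\ sgn1 (b21 (y, x)), sgn1 (c31 (z, x)) &
      (a12 (x, y) + a13 (x, z) - ma) * b21 (y, x) * c31 (z, x) = 1]}}}.
    apply: aeS (core_nest C) => x; apply: aeS3 Z23 (ZZ_swap bc32 Z32) => y.
    apply: aeS3 => z e1 e2 [_]; rewrite e1 e2 !addrK => *; split => //.
  have N2 : {ae leb R, forall x, {ae leb R, forall z, {ae leb R, forall y,
      [/\ sgn1 (b21 (y, x)), sgn1 (c31 (z, x)) &
      (a12 (x, y) + a13 (x, z) - ma) * b21 (y, x) * c31 (z, x) = 1]}}}.
    apply: aeS (core_nest' C) => x; apply: aeS3 Z32 (ZZ_swap bb23 Z23) => z.
    apply: aeS3 => y e1 e2 [_]; rewrite e1 e2 !addrK => *; split => //.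
  have N12 : {ae leb R, forall x, {ae leb R, forall y, {ae leb R, forall z,
      [/\ sgn1 (b21 (y, x)), sgn1 (c31 (z, x)) &
      (a12 (x, y) + a13 (x, z) - ma) * b21 (y, x) * c31 (z, x) = 1]}} /\
      {ae leb R, forall z, {ae leb R, forall y,
      [/\ sgn1 (b21 (y, x)), sgn1 (c31 (z, x)) &
      (a12 (x, y) + a13 (x, z) - ma) * b21 (y, x) * c31 (z, x) = 1]}}}.
    by apply: aeS2 N1 N2 => x.
  apply: aeS3 (core_dich C) N12 ar => x [Z12|Z13] [n1 n2] arx.
  (* On a slice with a12 = ma, the relation abc = 1 at a fixed z0 shows that b21 does not depend on
     y; it then equals its mean [del]. *)
  - have [z0 n2z] := ae_ex n2.
    have bE : {ae leb R, forall y : R, b21 (y, x) = a13 (x, z0) * c31 (z0, x)}.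
      apply: aeS2 Z12 n2z => y -> [sb sc]; rewrite (addrC ma) addrK.
      by case: sb => ->; case: sc => ->; lra.
    rewrite /del (avg _ _ _ (bnd_slice2 x bb21) mr bE).
    by apply: aeS2 Z12 bE => y -> ->; rewrite subrr mulr0 add0r.
  (* On a slice with a13 = ma, the relation at a fixed y0 makes c31 constant in z, with value [gam];
     then b21 = gam a12, whose mean is del = gam ma. *)
  - have n1' : {ae leb R, forall y, {ae leb R, forall z,
        [/\ sgn1 (b21 (y, x)), sgn1 (c31 (z, x)) &
        a12 (x, y) * b21 (y, x) * c31 (z, x) = 1]}}.
      by apply: aeS n1 => y; apply: aeS2 Z13 => z ->; rewrite addrK.
    have [y0 n1y] := ae_ex n1'.
    pose sg := a12 (x, y0) * b21 (y0, x).
    have cE : {ae leb R, forall z : R, c31 (z, x) = sg}.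
      by apply: aeS n1y => z [_ sc]; rewrite -/sg; case: sc => ->; lra.
    have bE : {ae leb R, forall y : R, b21 (y, x) = sg * a12 (x, y)}.
      apply: aeS n1' => y n1y'; have [z [cz [sb _]]] := ae_ex (aeS2 (fun z => @conj _ _) cE n1y').
      by rewrite cz; case: sb => ->; lra.
    rewrite /gam (avg _ _ _ (bnd_slice2 x bc31) mr' cE).
    have -> : del x = sg * ma.
      rewrite -arx -RintegralZl//; last first.
        apply: integrable_bms; apply: bmsMl; last exact: test1_bms mr.1.
        by apply: bnd_lbd; exact: bnd_slice1.
      apply: ae_eq_Rintegral.
      - apply: measurable_funM; first by case: (bnd_slice2 x bb21).
        by case: (test1_bnd mr.1).
      - apply: measurable_funM => //; apply: measurable_funM.
          by case: (bnd_slice1 x ba12).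
        by case: (test1_bnd mr.1).
      - by apply: aeS bE => y ->; rewrite mulrA.
    by apply: aeS bE => y ->; ring.
have wp : weak_potential al be.
  have := weak_potential_subc ma 0 ba12 (bnd_tr bb21) w12.
  rewrite /al /be (_ : (fun z => tr b21 z - 0) = tr b21)//.
  by apply/funext => z; rewrite subr0.
have beE : {ae leb2 R, forall z, be z = gam z.1 * al z + del z.1}.
  apply: (@prod_ae _ _ _ _ _ (leb R) (leb R)); last by apply: aeS key => x; apply: aeS => y.
  apply: measurable_eq; first by case: (bnd_tr bb21).
  apply: measurable_funD; last by apply: measurableT_comp => //; case: bdel.
  apply: measurable_funM; last by case: bal.
  by apply: measurableT_comp => //; case: bgam.
have [n _ aln] := transport bal (bnd_tr bb21) wp bgam bdel (prim_Lip bgam) (prim_ae bgam) beE.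
have aln2 := ae2_prod aln.
have [x0 Zx0 nx0] := ae_witness nn12 aln2.
have n0 : {ae leb R, forall t : R, n t = 0}.
  apply: aeS2 (ae_shift (- prim gam x0) Zx0) nx0 => t /= e <-.
  by rewrite /al e subrr.
apply: n12; apply: aeS aln2 => x alx.
have : {ae leb R, forall t : R, al (x, t - prim gam x) = 0}.
  by apply: aeS2 alx n0 => t /= e e'; rewrite /al e e'.
move/(ae_shift (prim gam x)); apply: aeS => y; rewrite addrK /al.
by move=> /eqP; rewrite subr_eq0 => /eqP.
Qed.

(* Here e_23, e_13, e_12 are functions of x2, x3, x1 alone with product 1, hence
   constant. *)
Lemma core_cyclic a12 a13 b21 b23 c31 c32 ma mb mc :
  core a12 a13 b21 b23 c31 c32 ma mb mc ->
  ZZ a13 ma -> ZZ b21 mb -> ZZ c32 mc -> ZZ a12 ma.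
Proof.
move=> C Z13 Z21 Z32; have [[[ba12 ba13 bb21] [bb23 bc31 bc32]] w12 w13 w23
  [[m12 _ _] _] _ _] := C.
have [r mr] := @mean_test_exists R.
have prod0 al m : bnd al -> ZZ al m -> {ae leb2 R, forall z, al z = m}.
  move=> ba Zal; apply: (@prod_ae _ _ _ _ _ (leb R) (leb R)) => //.
  by apply: measurable_eq => //; case: ba.
have trprod0 al m : bnd al -> ZZ al m -> {ae leb2 R, forall z, tr al z = cst m z}.
  move=> ba Zal; apply: (@prod_ae _ _ _ _ _ (leb R) (leb R)).
    by apply: measurable_eq => //; case: (bnd_tr ba).
  exact: ZZ_swap Zal.
have T2c1 m h1 h2 : test1 h1 -> test1 h2 -> T2 (cst m) (derive1 h1) h2 = 0 :> R.
  by move=> t1 t2; rewrite T2_cst ?test1_int_deriv ?mul0r ?mulr0//; exact: test1_deriv.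
have T2c2 m h1 h2 : test1 h1 -> test1 h2 -> T2 (cst m) h1 (derive1 h2) = 0 :> R.
  by move=> t1 t2; rewrite T2_cst ?test1_int_deriv ?mulr0//; exact: test1_deriv.
(* As b21, c32 and a13 are constant, each planar relation says that one derivative of a12, b23 or
   c31 vanishes; so these depend on x2, x3 and x1 only. *)
have A : {ae leb2 R, forall z, a12 z = \int[leb R]_x (a12 (x, z.2) * r x)}.
  apply: weak_indep1 => //; first exact: bnd_lbd.
  move=> h1 h2 t1 t2; rewrite w12//.
  rewrite (T2_ae (bnd_tr bb21) (bnd_cst mb) _ _ (trprod0 _ _ bb21 Z21))//; last exact: test1_deriv.
  exact: T2c2.
have B : {ae leb2 R, forall z, b23 z = \int[leb R]_x (b23 (x, z.2) * r x)}.
  apply: weak_indep1 => //; first exact: bnd_lbd.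
  move=> h1 h2 t1 t2; rewrite w23//.
  rewrite (T2_ae (bnd_tr bc32) (bnd_cst mc) _ _ (trprod0 _ _ bc32 Z32))//; last exact: test1_deriv.
  exact: T2c2.
have D : {ae leb2 R, forall z, tr c31 z = \int[leb R]_y (tr c31 (z.1, y) * r y)}.
  apply: weak_indep2 => //; first by apply: bnd_lbd; exact: bnd_tr.
  move=> h1 h2 t1 t2; rewrite -w13//.
  rewrite (T2_ae ba13 (bnd_cst ma) _ _ (prod0 _ _ ba13 Z13))//; last exact: test1_deriv.
  exact: T2c1.
set n2 := fun y => \int[leb R]_x (a12 (x, y) * r x).
set n3 := fun z => \int[leb R]_x (b23 (x, z) * r x).
set n1 := fun x => \int[leb R]_y (tr c31 (x, y) * r y).
have N : {ae leb R, forall x, {ae leb R, forall z, {ae leb R, forall y,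
    sgn1 (n2 y) /\ n2 y * n3 z * n1 x = 1}}}.
  have h1 := core_nest' C.
  have h2 : {ae leb R, forall x, {ae leb R, forall y, a12 (x, y) = n2 y /\ b21 (y, x) = mb}}.
    apply: aeS2 (ae2_prod A) (ZZ_swap bb21 Z21) => x.
    by apply: aeS2 => y.
  have h3 : {ae leb R, forall x, {ae leb R, forall z, a13 (x, z) = ma /\ c31 (z, x) = n1 x}}.
    apply: aeS2 Z13 (ae2_prod D) => x.
    by apply: aeS2 => z.
  have h4 : {ae leb R, forall z, {ae leb R, forall y, b23 (y, z) = n3 z /\ c32 (z, y) = mc}}.
    apply: aeS2 (ae2_prod_swap B) Z32 => z.
    by apply: aeS2 => y.
  apply: aeS3 h1 h2 h3 => x h1x h2x h3x; apply: aeS3 h1x h3x h4 => z h1z [e13 e31] h4z.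
  apply: aeS3 h1z h2x h4z => y [] + + + + [e12 e21] [e23 e32].
  rewrite e13 e31 e12 e21 e23 e32 !addrK (addrC mb) addrK => sa sb sc p.
  by split.
have [x1 Nx] := ae_ex N; have [z1 Nz] := ae_ex Nx.
have n2E : {ae leb R, forall y : R, n2 y = n3 z1 * n1 x1}.
  by apply: aeS Nz => y [[->|->]]; lra.
apply: aeS2 (slice_mean_cst ba12 m12) (ae2_prod A) => x h Ax.
by apply: (h (n3 z1 * n1 x1)); apply: aeS2 Ax n2E => y e e'; rewrite e; exact: e'.
Qed.

(** Each component loses one of two variables. Of the eight combinations all but two contain a
    repeated variable; in the two cyclic ones [core_cyclic] makes a further component lose a second
    variable. *)
Lemma core_main a12 a13 b21 b23 c31 c32 ma mb mc :
  core a12 a13 b21 b23 c31 c32 ma mb mc ->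
  [\/ ZZ a12 ma /\ ZZ c32 mc, ZZ b21 mb /\ ZZ c31 mc | ZZ a13 ma /\ ZZ b23 mb].
Proof.
move=> C; have C' := core_swap12 C; have C'' := core_swap12 (core_swap23 C).
have part al al' m : (~ ZZ al m -> ~ ZZ al' m -> False) -> ZZ al m \/ ZZ al' m.
  by move=> h; apply: contrapT => /not_orP[]; exact: h.
have [Z12|Z13] := part _ _ _ (core_partial C).
  have [Z31|Z32] := part _ _ _ (core_partial C''); last by constructor 1.
  have [Z21|Z23] := part _ _ _ (core_partial C'); first by constructor 2.
  constructor 2; split => //; exact: core_cyclic C' _ _ _.
have [Z21|Z23] := part _ _ _ (core_partial C'); last by constructor 3.
have [Z31|Z32] := part _ _ _ (core_partial C''); first by constructor 2.
by constructor 1; split => //; exact: core_cyclic C _ _ _.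
Qed.

End core.

(** * From the strain to its planar averages *)

Section periodic.
Context {R : realType}.

Lemma ae_periodic1 (Q : R -> Prop) l : 0 < l -> (forall x, Q (x + l) <-> Q x) ->
  {ae leb R, forall x : R, 0 < x < l -> Q x} -> {ae leb R, forall x : R, Q x}.
Proof.
move=> l0 Ql aQ.
have Qn n x : Q (x + n%:R * l) <-> Q x.
  elim: n => [|n IH]; first by rewrite mul0r addr0.
  by rewrite -natr1 mulrDl mul1r addrA; split => [/Ql/IH|/IH/Ql].
have Qk (k : int) x : Q (x - k%:~R * l) <-> Q x.
  case: k => n; first by have := Qn n (x - n%:R * l); rewrite subrK => H; split => /H.
  by rewrite NegzE mulrNz mulNr opprK; exact: Qn.
have H (k : int) : {ae leb R, forall x : R, 0 < x - k%:~R * l < l -> Q x}.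
  by apply: aeS (ae_shift (- (k%:~R * l)) aQ) => x h /h /Qk.
(* The translated hypothesis covers open cells; the countably many end points are removed as null
   sets. *)
have H' (k : int) : {ae leb R, forall x : R, x <> k%:~R * l} by exact: ae_neq.
apply: aeS2 (ae_countable H) (ae_countable H') => x h h'.
apply: (h (Num.floor (x / l))).
have := floor_itv (x / l); rewrite ler_pdivlMr// ltr_pdivrMr// intrD mulrDl mul1r => /andP[x1 x2].
rewrite ltrBlDl x2 andbT subr_gt0 lt_neqAle x1 andbT eq_sym.
by apply/eqP; exact: h'.
Qed.

Lemma ae3_periodic (P : R * R * R -> Prop) l1 l2 l3 : 0 < l1 -> 0 < l2 -> 0 < l3 ->
  measurable [set x | P x] ->
  (forall x y z, P (x + l1, y, z) <-> P (x, y, z)) ->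
  (forall x y z, P (x, y + l2, z) <-> P (x, y, z)) ->
  (forall x y z, P (x, y, z + l3) <-> P (x, y, z)) ->
  {ae leb3 R, forall x, 0 < x.1.1 < l1 -> 0 < x.1.2 < l2 -> 0 < x.2 < l3 -> P x} ->
  {ae leb3 R, forall x, P x}.
Proof.
move=> l10 l20 l30 mP P1 P2 P3 aP; apply: ae3_of_nest => //.
apply: (ae_periodic1 l10) => [x|].
  by split; apply: aeS => y; apply: aeS => z /P1.
apply: aeS (ae3_nest aP) => x hx x1.
apply: (ae_periodic1 l20) => [y|].
  by split; apply: aeS => z /P2.
apply: aeS hx => y hy y1; apply: (ae_periodic1 l30) => [z|]; first exact: P3.
by apply: aeS hy => z; apply.
Qed.

End periodic.

(** * Periodic functions paired with averaging weights *)

Section periodic_mean.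
Context {R : realType}.
Variables (l1 l2 l3 : R).
Hypotheses (l10 : 0 < l1) (l20 : 0 < l2) (l30 : 0 < l3).

Definition periodic3 (f : R * R * R -> R) := [/\
  forall x y z, f (x + l1, y, z) = f (x, y, z),
  forall x y z, f (x, y + l2, z) = f (x, y, z) &
  forall x y z, f (x, y, z + l3) = f (x, y, z)].

Definition unit_bounded (f : R * R * R -> R) := measurable_fun [set: R * R * R] f /\
  forall x, `|f x| <= 1.

(** The six Saint-Venant equations for e_23, e_13, e_12, tested against products and with the
    constant diagonal entries dropped. There is no change of sign, since every term moves two
    derivatives to the test function. *)
Definition compatible (a b c : R * R * R -> R) := [/\
  forall h1 h2 h3, test1 h1 -> test1 h2 -> test1 h3 ->
    T3 a h1 (derive1 h2) (derive1 h3) = 0,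
  forall h1 h2 h3, test1 h1 -> test1 h2 -> test1 h3 ->
    T3 b (derive1 h1) h2 (derive1 h3) = 0 &
  forall h1 h2 h3, test1 h1 -> test1 h2 -> test1 h3 ->
    T3 c (derive1 h1) (derive1 h2) h3 = 0] /\ [/\
  forall h1 h2 h3, test1 h1 -> test1 h2 -> test1 h3 ->
    T3 a (derive1 (derive1 h1)) h2 h3 =
    T3 b (derive1 h1) (derive1 h2) h3 + T3 c (derive1 h1) h2 (derive1 h3),
  forall h1 h2 h3, test1 h1 -> test1 h2 -> test1 h3 ->
    T3 b h1 (derive1 (derive1 h2)) h3 =
    T3 a (derive1 h1) (derive1 h2) h3 + T3 c h1 (derive1 h2) (derive1 h3) &
  forall h1 h2 h3, test1 h1 -> test1 h2 -> test1 h3 ->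
    T3 c h1 h2 (derive1 (derive1 h3)) =
    T3 a (derive1 h1) h2 (derive1 h3) + T3 b h1 (derive1 h2) (derive1 h3)].

Lemma unit_bounded_bnd f : unit_bounded f -> bnd f.
Proof. by move=> [mf f1]; split => //; exists 1. Qed.

(** Positivity serves to recognise a function from an extremal mean; the last clause says that
    averaging a periodic function annihilates derivatives in the averaging variable. *)
Definition window (l : R) (r : R -> R) := [/\ mean_test r, forall x, 0 <= r x,
    forall x, 0 < x < l -> 0 < r x &
    forall f : R -> R, bnd f -> (forall x, f (x + l) = f x) ->
      \int[leb R]_x (f x * derive1 r x) = 0].

Lemma T2_0 h1 h2 : T2 (cst 0) h1 h2 = 0 :> R.
Proof.
rewrite /T2 (_ : (fun w => _) = cst 0) ?Rintegral_cst ?mul0r//.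
by apply/funext => w; rewrite mul0r.
Qed.

Lemma T3_window3 f r h1 h2 : unit_bounded f -> periodic3 f -> window l3 r ->
  test1 h1 -> test1 h2 -> T3 f h1 h2 (derive1 r) = 0.
Proof.
move=> /unit_bounded_bnd bf [_ _ p] [[tr _] _ _ w] t1 t2.
rewrite T3_E3//; last exact: test1_deriv.
rewrite (_ : E3 _ _ = cst 0) ?T2_0//; apply/funext => z; apply: w => [|x]; last exact: p.
by case: bf => mf [C hC]; split; [exact: measurable_slice1|exists C].
Qed.

Lemma T3_window2 f r h1 h3 : unit_bounded f -> periodic3 f -> window l2 r ->
  test1 h1 -> test1 h3 -> T3 f h1 (derive1 r) h3 = 0.
Proof.
move=> /unit_bounded_bnd bf [_ p _] [[tr _] _ _ w] t1 t2.
rewrite T3_E2//; last exact: test1_deriv.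
rewrite (_ : E2 _ _ = cst 0) ?T2_0//; apply/funext => z; apply: w => [|x]; last exact: p.
have bf' : bnd (f \o s23) by apply: bnd_comp => //; exact: s23_meas.
case: bf' => mf [C hC]; split; last by exists C => s; exact: (hC (z.1, z.2, s)).
by have := measurable_slice1 (z.1, z.2) mf.
Qed.

Lemma T3_window1 f r h2 h3 : unit_bounded f -> periodic3 f -> window l1 r ->
  test1 h2 -> test1 h3 -> T3 f (derive1 r) h2 h3 = 0.
Proof.
move=> /unit_bounded_bnd bf [p _ _] [[tr _] _ _ w] t1 t2.
rewrite T3_E1//; last exact: test1_deriv.
rewrite (_ : E1 _ _ = cst 0) ?T2_0//; apply/funext => z; apply: w => [|x]; last exact: p.
have bf' : bnd (f \o c231) by apply: bnd_comp => //; exact: s231_meas.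
case: bf' => mf [C hC]; split; last by exists C => s; exact: (hC (z.1, z.2, s)).
by have := measurable_slice1 (z.1, z.2) mf.
Qed.

Lemma trilin_perm13 (T : (R -> R) -> (R -> R) -> (R -> R) -> R) :
  trilin T -> trilin (fun h1 h2 h3 => T h1 h3 h2).
Proof. by move=> [t1 t2 t3]; split => k1 k2 tk1 tk2; [exact: t1|exact: t3|exact: t2]. Qed.

Lemma trilin_rot (T : (R -> R) -> (R -> R) -> (R -> R) -> R) :
  trilin T -> trilin (fun h1 h2 h3 => T h3 h1 h2).
Proof. by move=> [t1 t2 t3]; split => k1 k2 tk1 tk2; [exact: t2|exact: t3|exact: t1]. Qed.

Lemma mean_ae (f : R -> R) m : lbd nrm1 f ->
  (forall h, test1 h -> \int[leb R]_x (f x * h x) = m * \int[leb R]_x h x) ->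
  {ae leb R, forall x : R, f x = m}.
Proof.
move=> lf fm; have lm : lbd (@nrm1 R) (cst m) by exact/bnd_lbd/bnd_cst.
suff : {ae leb R, forall x : R, f x - m = 0}.
  by apply: aeS => x /eqP; rewrite subr_eq0 => /eqP.
apply: fund1; first exact: (lbdB lf lm).
move=> n p q; have te := eta_test n (ratr p : R) (ratr q).
rewrite -[RHS](subrr (m * \int[leb R]_x eta n (ratr p) (ratr q) x)) -{1}fm//.
rewrite -int_comb; [|exact/integrable_bms/bmsMl/test1_bms|exact: test1_integrable].
by apply: eq_Rintegral => x _; ring.
Qed.

Lemma trK (g : R * R -> R) : tr (tr g) = g.
Proof. by apply/funext => -[]. Qed.

Lemma E3_ae (f : R * R * R -> R) r m : bnd f -> mean_test r ->
  {ae leb3 R, forall x, f x = m} -> {ae leb2 R, forall w : R * R, E3 r f w = m}.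
Proof.
move=> bf [tr ir] /(@ae_prod _ _ _ _ _ (leb2 R) (leb R)); apply: aeS => -[x y] e.
rewrite /E3/= -[RHS]mulr1 -ir -RintegralZl_test//.
have [mr _] := test1_bnd tr.
apply: ae_eq_Rintegral; last by apply: aeS e => s ->.
  by apply: measurable_funM => //; case: bf => mf _; exact: measurable_slice1.
exact: measurable_funM.
Qed.

(* The weighted mean of a function with values in [-1, 1] is extremal only if the
   function is constant where the weight is positive. *)
Lemma extremal_mean f r1 r2 r3 : unit_bounded f -> periodic3 f ->
  window l1 r1 -> window l2 r2 -> window l3 r3 -> sgn1 (T3 f r1 r2 r3) ->
  {ae leb3 R, forall x, f x = T3 f r1 r2 r3}.
Proof.
move=> lf [p1 p2 p3] [m1 n1 q1 _] [m2 n2 q2 _] [m3 n3 q3 _] s.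
set m := T3 f r1 r2 r3; have bf := unit_bounded_bnd lf.
have m2E : m * m = 1 by case: s; rewrite -/m => ->; ring.
have bfm : bnd (fun x => - (m * f x)).
  by apply: bndN; apply: (@bndM _ _ _ (cst m)) => //; exact: bnd_cst.
have b1 : bnd (fun x => 1 + - (m * f x)).
  by apply: (@bndD _ _ _ (cst 1)) => //; exact: bnd_cst.
have pos x : 0 <= 1 + - (m * f x).
  have := lf.2 x; rewrite ler_norml => /andP[].
  by case: s; rewrite -/m => ->; lra.
have F0 : \int[leb3 R]_x ((1 + - (m * f x)) * (r1 x.1.1 * r2 x.1.2 * r3 x.2)) = 0.
  have T1 : T3 (cst 1) r1 r2 r3 = 1.
    by rewrite T3_cst ?m1.2 ?m2.2 ?m3.2 ?mulr1//; [exact: m1.1|exact: m2.1|exact: m3.1].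
  rewrite -[LHS]/(T3 (fun x => cst 1 x + - (m * f x)) r1 r2 r3).
  rewrite T3_add//; [|exact: bnd_cst|exact: m1.1|exact: m2.1|exact: m3.1].
  rewrite T1.
  have -> : T3 (fun x => - (m * f x)) r1 r2 r3 = - m * T3 f r1 r2 r3.
    rewrite /T3 -RintegralZl//; first by apply: eq_Rintegral => x _; ring.
    by apply: bms_int3f; apply: bms3M; [exact: bnd_lbd|exact: m1.1|exact: m2.1|exact: m3.1].
  by rewrite -/m mulNr m2E subrr.
have bF : bms nrm3 (fun x : R * R * R => (1 + - (m * f x)) * (r1 x.1.1 * r2 x.1.2 * r3 x.2)).
  by apply: bms3M; [exact: bnd_lbd|exact: m1.1|exact: m2.1|exact: m3.1].
have := Rintegral_eq0_ge0 finite_balls3 bF _ F0.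
move=> /(_ (fun x => mulr_ge0 (pos x) (mulr_ge0 (mulr_ge0 (n1 _) (n2 _)) (n3 _)))) ae0.
apply: (ae3_periodic l10 l20 l30).
- by apply: measurable_eq => //; case: bf.
- by move=> x y z; rewrite p1.
- by move=> x y z; rewrite p2.
- by move=> x y z; rewrite p3.
apply: aeS ae0 => x /eqP + /q1 h1 /q2 h2 /q3 h3.
rewrite mulf_eq0 => /orP[/eqP e|]; last by rewrite !mulf_eq0 !gt_eqF.
have mf : m * f x = 1 by lra.
by rewrite -[LHS]mul1r -m2E -mulrA mf mulr1.
Qed.

End periodic_mean.

(** * The planar averages of a compatible strain *)

Section strain_slices.
Context {R : realType}.

Section component.
Variables (f : R * R * R -> R) (r1 r2 r3 : R -> R).
Hypotheses (bf : bnd f) (mr1 : mean_test r1) (mr2 : mean_test r2) (mr3 : mean_test r3).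
Hypothesis f23 : forall h1 h2 h3, test1 h1 -> test1 h2 -> test1 h3 ->
  T3 f h1 (derive1 h2) (derive1 h3) = 0.
Hypothesis f1 : forall h, test1 h -> T3 f (derive1 h) r2 r3 = 0.

Lemma T3_mean h : test1 h -> T3 f h r2 r3 = T3 f r1 r2 r3 * \int[leb R]_x h x.
Proof.
move=> th; have [T1 _ _] := T3_trilin (bnd_lbd nrm3 bf).
rewrite mulrC; apply: (linform_deriv0 (L := fun h => T3 f h r2 r3)) => //.
- exact: T1 mr2.1 mr3.1.
- exact: mr1.1.
- exact: mr1.2.
Qed.

(** The last term of [mixed_decomposition] is a priori a function of x1; [f1] says that its
    derivative vanishes, which leaves the constant m. *)
Lemma slice_decomposition : {ae leb3 R, forall x, f x =
  E3 r3 f (x.1.1, x.1.2) + E2 r2 f (x.1.1, x.2) - T3 f r1 r2 r3}.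
Proof.
have [[t1 _] [t2 _] [t3 _]] := And3 mr1 mr2 mr3.
set m := T3 f r1 r2 r3.
pose g x := p12 (E3 r3 f) x + p13 (E2 r2 f) x.
have b12 : bnd (p12 (E3 r3 f)) by exact/bnd_p12/bnd_E3.
have b13 : bnd (p13 (E2 r2 f)) by exact/bnd_p13/bnd_E2.
have bg : bnd g by exact: bndD.
have bm : bnd (cst (- m) : R * R * R -> R) by exact: bnd_cst.
have bg' : bnd (fun x => g x + cst (- m) x) by exact: bndD.
suff : {ae leb3 R, forall x, f x + - (g x + cst (- m) x) = 0}.
  by apply: aeS => x /eqP; rewrite subr_eq0 => /eqP.
apply: fund3_T => [|h1 h2 h3 th1 th2 th3]; first exact: bndB.
rewrite T3_add//; last exact: bndN.
rewrite T3_opp// T3_add// T3_add// T3_cst// T3_p12//; last exact: bnd_E3.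
rewrite T3_p13//; last exact: bnd_E2.
rewrite -T3_E3// -T3_E2//.
rewrite (mixed_decomposition (T3_trilin (bnd_lbd nrm3 bf)) mr2 mr3 f23 th1 th2 th3).
by rewrite (T3_mean th1) -/m; ring.
Qed.

Lemma slice_mean3 : slice_mean (E3 r3 f) (T3 f r1 r2 r3).
Proof.
have [[t2 _] [t3 _]] := conj mr2 mr3; have bE := bnd_E3 bf t3.
exists r2; split => //; apply: mean_ae; first exact/bnd_lbd/bnd_int.
by move=> h th; rewrite -T2_int//; [rewrite -T3_E3// T3_mean|exact: bnd_lbd].
Qed.

Lemma slice_mean2 : slice_mean (E2 r2 f) (T3 f r1 r2 r3).
Proof.
have [[t2 _] [t3 _]] := conj mr2 mr3; have bE := bnd_E2 bf t2.
exists r3; split => //; apply: mean_ae; first exact/bnd_lbd/bnd_int.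
by move=> h th; rewrite -T2_int//; [rewrite -T3_E2// T3_mean|exact: bnd_lbd].
Qed.

Lemma slice_cst m : {ae leb3 R, forall x, f x = m} -> ZZ (E3 r3 f) m /\ ZZ (E2 r2 f) m.
Proof.
move=> fm; split; first exact: (@ae2_prod R (fun w => E3 r3 f w = m) (E3_ae bf mr3 fm)).
apply: (@ae2_prod R (fun w => E2 r2 f w = m)).
apply: (@E3_ae R (f \o s23) r2 m _ mr2 (ae3_s23 fm)).
by apply: bnd_comp => //; exact: s23_meas.
Qed.

End component.

Lemma unit_bounded_comp f s : measurable_fun [set: R * R * R] s -> unit_bounded f -> unit_bounded (f \o s : R * R * R -> R).
Proof. by move=> ms [mf f1]; split => [|x]; [exact: measurableT_comp|exact: f1]. Qed.

Definition s231 (x : R * R * R) := s23 (s12 x).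

Section strain_core.
Variables (a b c : R * R * R -> R) (l1 l2 l3 : R) (r1 r2 r3 : R -> R).
Hypotheses (l10 : 0 < l1) (l20 : 0 < l2) (l30 : 0 < l3).
Hypotheses (w1 : window l1 r1) (w2 : window l2 r2) (w3 : window l3 r3).
Hypotheses (la : unit_bounded a) (lb : unit_bounded b) (lc : unit_bounded c).
Hypotheses (pa : periodic3 l1 l2 l3 a) (pb : periodic3 l1 l2 l3 b) (pc : periodic3 l1 l2 l3 c).
Hypothesis sgn : {ae leb3 R, forall x,
  [/\ sgn1 (a x), sgn1 (b x), sgn1 (c x) & a x * b x * c x = 1]}.
Hypothesis comp : compatible a b c.

Let ba := unit_bounded_bnd la.
Let bb := unit_bounded_bnd lb.
Let bc := unit_bounded_bnd lc.
Let mr1 : mean_test r1. Proof. by case: w1. Qed.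
Let mr2 : mean_test r2. Proof. by case: w2. Qed.
Let mr3 : mean_test r3. Proof. by case: w3. Qed.

(** The distinguished variable of the splitting, x2 for e_13 and x3 for e_12, is moved to the first
    place, so that the results on one component apply to all three. *)
Let b' := b \o s12.
Let c' := c \o s231.
Let lb' : unit_bounded b'. Proof. exact: unit_bounded_comp s12_meas lb. Qed.
Let ms231 : measurable_fun [set: R * R * R] s231.
Proof. exact: measurableT_comp s23_meas s12_meas. Qed.
Let lc' : unit_bounded c'. Proof. exact: unit_bounded_comp lc. Qed.
Let bb' := unit_bounded_bnd lb'.
Let bc' := unit_bounded_bnd lc'.

Let T3b' h1 h2 h3 : test1 h1 -> test1 h2 -> test1 h3 -> T3 b' h1 h2 h3 = T3 b h2 h1 h3.
Proof. exact: T3_s12. Qed.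

Let T3c' h1 h2 h3 : test1 h1 -> test1 h2 -> test1 h3 -> T3 c' h1 h2 h3 = T3 c h2 h3 h1.
Proof.
move=> t1 t2 t3; rewrite (_ : c' = (c \o s23) \o s12)// T3_s12//.
  by rewrite T3_s23.
by apply: bnd_comp => //; exact: s23_meas.
Qed.

Let pot12 h1 h2 : test1 h1 -> test1 h2 -> T3 a (derive1 h1) h2 r3 = T3 b h1 (derive1 h2) r3.
Proof.
have [_ [c1 c2 _]] := comp.
apply: (averaged_compatibility (T3_trilin (bnd_lbd nrm3 ba)) (T3_trilin (bnd_lbd nrm3 bb))
  mr1 mr2 mr3 c1 c2) => k1 k2 t1 t2.
- exact: (T3_window3 lc pc w3).
- exact: (T3_window1 la pa w1).
- exact: (T3_window2 lb pb w2).
Qed.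

Let pot13 h1 h3 : test1 h1 -> test1 h3 -> T3 a (derive1 h1) r2 h3 = T3 c h1 r2 (derive1 h3).
Proof.
have [_ [c1 _ c3]] := comp.
apply: (@averaged_compatibility R (fun h1 h2 h3 => T3 a h1 h3 h2)
  (fun h1 h2 h3 => T3 c h1 h3 h2) (fun h1 h2 h3 => T3 b h1 h3 h2) r1 r3 r2 (trilin_perm13 (T3_trilin (bnd_lbd nrm3 ba)))
  (trilin_perm13 (T3_trilin (bnd_lbd nrm3 bc))) mr1 mr3 mr2).
- by move=> k1 k2 k3 t1 t2 t3; rewrite addrC; exact: c1.
- by move=> k1 k2 k3 t1 t2 t3; exact: c3.
- by move=> k1 k2 t1 t2; exact: (T3_window2 lb pb w2).
- by move=> k1 k2 t1 t2; exact: (T3_window1 la pa w1).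
- by move=> k1 k2 t1 t2; exact: (T3_window3 lc pc w3).
Qed.

Let pot23 h2 h3 : test1 h2 -> test1 h3 -> T3 b r1 (derive1 h2) h3 = T3 c r1 h2 (derive1 h3).
Proof.
have [_ [_ c2 c3]] := comp.
apply: (@averaged_compatibility R (fun h1 h2 h3 => T3 b h3 h1 h2)
  (fun h1 h2 h3 => T3 c h3 h1 h2) (fun h1 h2 h3 => T3 a h3 h1 h2) r2 r3 r1 (trilin_rot (T3_trilin (bnd_lbd nrm3 bb)))
  (trilin_rot (T3_trilin (bnd_lbd nrm3 bc))) mr2 mr3 mr1).
- by move=> k1 k2 k3 t1 t2 t3; rewrite addrC; exact: c2.
- by move=> k1 k2 k3 t1 t2 t3; rewrite addrC; exact: c3.
- by move=> k1 k2 t1 t2; exact: (T3_window1 la pa w1).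
- by move=> k1 k2 t1 t2; exact: (T3_window2 lb pb w2).
- by move=> k1 k2 t1 t2; exact: (T3_window3 lc pc w3).
Qed.

Let a23 h1 h2 h3 : test1 h1 -> test1 h2 -> test1 h3 -> T3 a h1 (derive1 h2) (derive1 h3) = 0.
Proof. by have [[c1 _ _] _] := comp; exact: c1. Qed.

Let b23 h1 h2 h3 : test1 h1 -> test1 h2 -> test1 h3 -> T3 b' h1 (derive1 h2) (derive1 h3) = 0.
Proof.
have [[_ c2 _] _] := comp; move=> t1 t2 t3.
by rewrite T3b'; [exact: c2|by []|exact: test1_deriv|exact: test1_deriv].
Qed.

Let c23 h1 h2 h3 : test1 h1 -> test1 h2 -> test1 h3 -> T3 c' h1 (derive1 h2) (derive1 h3) = 0.
Proof.
have [[_ _ c3] _] := comp; move=> t1 t2 t3.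
by rewrite T3c'; [exact: c3|by []|exact: test1_deriv|exact: test1_deriv].
Qed.

(** The planar relation trades the x1-derivative of e_23 for a derivative of the weight [r2] against
    e_13, and periodicity in x2 makes that pairing vanish. *)
Let a1 h : test1 h -> T3 a (derive1 h) r2 r3 = 0.
Proof. by move=> th; rewrite pot12//; [exact: (T3_window2 lb pb w2 th mr3.1)|exact: mr2.1]. Qed.

Let b1 h : test1 h -> T3 b' (derive1 h) r1 r3 = 0.
Proof.
move=> th; rewrite T3b'; [|exact: test1_deriv|exact: mr1.1|exact: mr3.1].
by rewrite -pot12//; [exact: (T3_window1 la pa w1 th mr3.1)|exact: mr1.1].
Qed.

Let c1 h : test1 h -> T3 c' (derive1 h) r1 r2 = 0.
Proof.
move=> th; rewrite T3c'; [|exact: test1_deriv|exact: mr1.1|exact: mr2.1].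
by rewrite -pot13//; [exact: (T3_window1 la pa w1 mr2.1 th)|exact: mr1.1].
Qed.

Let mb : T3 b' r2 r1 r3 = T3 b r1 r2 r3.
Proof. by rewrite T3b'; [|exact: mr2.1|exact: mr1.1|exact: mr3.1]. Qed.

Let mc : T3 c' r3 r1 r2 = T3 c r1 r2 r3.
Proof. by rewrite T3c'; [|exact: mr3.1|exact: mr1.1|exact: mr2.1]. Qed.

Lemma strain_decomposition : {ae leb3 R, forall x, [/\
  a x = E3 r3 a (x.1.1, x.1.2) + E2 r2 a (x.1.1, x.2) - T3 a r1 r2 r3,
  b x = tr (E3 r3 b) (x.1.2, x.1.1) + E1 r1 b (x.1.2, x.2) - T3 b r1 r2 r3 &
  c x = tr (E2 r2 c) (x.2, x.1.1) + tr (E1 r1 c) (x.2, x.1.2) - T3 c r1 r2 r3]}.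
Proof.
have Da := slice_decomposition ba mr1 mr2 mr3 a23 a1.
have Db := ae3_s12 (slice_decomposition bb' mr2 mr1 mr3 b23 b1).
have Dc := ae3_s23 (ae3_s12 (slice_decomposition bc' mr3 mr1 mr2 c23 c1)).
by apply: aeS3 Da Db Dc => -[[x y] z] /=; rewrite mb mc.
Qed.

Lemma strain_core : core (E3 r3 a) (E2 r2 a) (tr (E3 r3 b)) (E1 r1 b)
  (tr (E2 r2 c)) (tr (E1 r1 c)) (T3 a r1 r2 r3) (T3 b r1 r2 r3) (T3 c r1 r2 r3).
Proof.
split.
- split; split; do ?[exact/bnd_E3/mr3.1|exact/bnd_E2/mr2.1|exact/bnd_E1/mr1.1].
  + exact/bnd_tr/bnd_E3/mr3.1.
  + exact/bnd_tr/bnd_E2/mr2.1.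
  + exact/bnd_tr/bnd_E1/mr1.1.
- move=> h1 h2 t1 t2; have t1' := test1_deriv t1; have t2' := test1_deriv t2.
  by have t3 := mr3.1; rewrite trK -!T3_E3//; exact: pot12.
- move=> h1 h2 t1 t2; have t1' := test1_deriv t1; have t2' := test1_deriv t2.
  by have t3 := mr2.1; rewrite trK -!T3_E2//; exact: pot13.
- move=> h1 h2 t1 t2; have t1' := test1_deriv t1; have t2' := test1_deriv t2.
  by have t3 := mr1.1; rewrite trK -!T3_E1//; exact: pot23.
- split; split.
  + exact: slice_mean3 ba mr1 mr2 mr3 a1.
  + exact: slice_mean2 ba mr1 mr2 mr3 a1.
  + by rewrite -mb; exact: slice_mean3 bb' mr2 mr1 mr3 b1.
  + by rewrite -mb; exact: slice_mean2 bb' mr2 mr1 mr3 b1.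
  + by rewrite -mc; exact: slice_mean3 bc' mr3 mr1 mr2 c1.
  + by rewrite -mc; exact: slice_mean2 bc' mr3 mr1 mr2 c1.
- by apply: aeS2 strain_decomposition sgn => x /= [<- <- <-].
- split.
  + move=> s; have e := extremal_mean l10 l20 l30 la pa w1 w2 w3 s.
    exact: (slice_cst ba mr2 mr3 e).
  + move=> s; have e := extremal_mean l10 l20 l30 lb pb w1 w2 w3 s.
    exact: (slice_cst bb' mr1 mr3 (ae3_s12 e)).
  + move=> s; have e := extremal_mean l10 l20 l30 lc pc w1 w2 w3 s.
    exact: (slice_cst bc' mr1 mr2 (ae3_s12 (ae3_s23 e))).
Qed.

End strain_core.

End strain_slices.

(** * Saint-Venant compatibility *)

Section lines.
Context {R : realType} {V : normedModType R}.
Implicit Types (f : V -> R) (a v : V).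

Lemma is_derive_line f a v t : derivable f (a + t *: v) v ->
  is_derive (t : R) (1 : R) (fun s => f (a + s *: v)) ('D_v f (a + t *: v)).
Proof.
have E : (fun h : R => h^-1 *: (((fun s => f (a + s *: v)) \o shift t) (h *: 1) - f (a + t *: v))) =
    fun h : R => h^-1 *: ((f \o shift (a + t *: v)) (h *: v) - f (a + t *: v)).
  apply/funext => h; rewrite /= !/(shift _ _)/= (_ : a + (h *: 1 + t) *: v = h *: v + (a + t *: v))//.
  by rewrite [h *: 1]mulr1 scalerDl addrCA.
move=> df; split; last by rewrite /derive E.
by rewrite /derivable E.
Qed.

Lemma derive_line f a v (df : R) :
  is_derive (0 : R) (1 : R) (fun s => f (a + s *: v)) df -> 'D_v f a = df.
Proof.
have E : (fun h : R => h^-1 *: (((fun s => f (a + s *: v)) \o shift (0 : R)) (h *: 1) -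
      f (a + (0 : R) *: v))) = fun h : R => h^-1 *: ((f \o shift a) (h *: v) - f a).
  apply/funext => h; rewrite /= !/(shift _ _)/= addr0 scale0r addr0.
  by rewrite [h *: 1]mulr1 (addrC a).
by move=> [_ <-]; rewrite /derive E.
Qed.

End lines.

Section tensor_tests.
Context {R : realType}.
Implicit Types (h : R -> R).

Definition tens h1 h2 h3 (x : R * R * R) := h1 x.1.1 * h2 x.1.2 * h3 x.2.

Lemma smooth1_differentiable h x : smooth1 h -> differentiable (h : R -> R) x.
Proof. by move=> sh; apply/derivable1_diffP; case: (smooth1_is_derive sh x). Qed.

Lemma smooth1_line h (a c : R) : smooth1 h ->
  is_derive (0 : R) (1 : R) (fun s => h (a + s * c)) (c * derive1 h a).
Proof.
move=> sh; rewrite (_ : (fun s => _) = fun s => h (c * s + a)); last first.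
  by apply/funext => s; rewrite addrC mulrC.
by apply: is_derive_affine; rewrite mulr0 add0r; exact: smooth1_is_derive.
Qed.

Lemma pderiv_tens h1 h2 h3 i : smooth1 h1 -> smooth1 h2 -> smooth1 h3 ->
  pderiv i (tens h1 h2 h3) =
  [:: tens (derive1 h1) h2 h3; tens h1 (derive1 h2) h3; tens h1 h2 (derive1 h3)]`_i.
Proof.
move=> s1 s2 s3; apply/funext => -[[x y] z]; apply: derive_line.
have d1 := smooth1_line x (i == i1)%:R s1.
have d2 := smooth1_line y (i == i2)%:R s2.
have d3 := smooth1_line z (i == i3)%:R s3.
have := is_deriveMR (is_deriveMR d1 d2) d3; rewrite !mul0r !addr0 => d.
rewrite (_ : (fun s => _) = fun s => h1 (x + s * (i == i1)%:R) *
  h2 (y + s * (i == i2)%:R) * h3 (z + s * (i == i3)%:R)); last by apply/funext.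
apply: (is_derive_eq d).
by case: i {d1 d2 d3 d} => -[|[|[|//]]] ?; rewrite /tens/=; ring.
Qed.

Lemma differentiable_tens h1 h2 h3 x : smooth1 h1 -> smooth1 h2 -> smooth1 h3 ->
  differentiable (tens h1 h2 h3) x.
Proof.
move=> s1 s2 s3.
have f12 : differentiable (fst : R * R * R -> R * R) x.
  by apply: linear_differentiable => y; exact: cvg_fst.
have f3 : differentiable (snd : R * R * R -> R) x.
  by apply: linear_differentiable => y; exact: cvg_snd.
have f1 : differentiable (fst : R * R -> R) x.1.
  by apply: linear_differentiable => y; exact: cvg_fst.
have f2 : differentiable (snd : R * R -> R) x.1.
  by apply: linear_differentiable => y; exact: cvg_snd.
have d1 := differentiable_comp (differentiable_comp f12 f1) (smooth1_differentiable x.1.1 s1).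
have d2 := differentiable_comp (differentiable_comp f12 f2) (smooth1_differentiable x.1.2 s2).
have d3 := differentiable_comp f3 (smooth1_differentiable x.2 s3).
exact: differentiableM (differentiableM d1 d2) d3.
Qed.

Lemma smooth_tens h1 h2 h3 : smooth1 h1 -> smooth1 h2 -> smooth1 h3 ->
  smooth (tens h1 h2 h3).
Proof.
move=> s1 s2 s3 s x.
suff [k1 [k2 [k3 [t1 t2 t3 ->]]]] : exists k1 k2 k3, [/\ smooth1 k1, smooth1 k2, smooth1 k3 &
    foldr (@pderiv R) (tens h1 h2 h3) s = tens k1 k2 k3] by exact: differentiable_tens.
elim: s => [|i s [k1 [k2 [k3 [t1 t2 t3 E]]]]]; first by exists h1, h2, h3.
rewrite /= E pderiv_tens//; case: i => -[|[|[|//]]] ? /=.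
- by exists (derive1 k1), k2, k3; split => //; exact: smooth1_deriv.
- by exists k1, (derive1 k2), k3; split => //; exact: smooth1_deriv.
- by exists k1, k2, (derive1 k3); split => //; exact: smooth1_deriv.
Qed.

Definition box (N : R) : set (R * R * R) := (`[- N, N] `*` `[- N, N]) `*` `[- N, N].

Lemma boxE N x : box N x <-> nrm3 x <= N.
Proof.
rewrite !nrmX_le /box/= !in_itv/= /nrm1 !ler_norml.
by split=> [[[-> ->] ->]//|/andP[/andP[-> ->] ->]].
Qed.

Lemma box_compact N : compact (box N).
Proof. by do 2?apply: compact_setX; exact: segment_compact. Qed.

Lemma test_support (phi : R * R * R -> R) N : (forall x, N < nrm3 x -> phi x = 0) ->
  compact (closure [set x | phi x != 0]).
Proof.
move=> p0; apply: (@subclosed_compact _ _ (box N)) => [||]; [exact: closed_closure|exact: box_compact|].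
have cb : closed (box N) by apply: compact_closed; [exact: norm_hausdorff|exact: box_compact].
rewrite ((closure_id (box N)).1 cb); apply: closure_subset => x /= px; apply/boxE.
by rewrite leNgt; apply: contra px => /p0 ->.
Qed.

Lemma tens_test h1 h2 h3 : test1 h1 -> test1 h2 -> test1 h3 ->
  test_function (tens h1 h2 h3).
Proof.
move=> t1 t2 t3; split; first by apply: smooth_tens; [case: t1|case: t2|case: t3].
have [_ [N [_ hN]]] := bms3 t1 t2 t3.
exact: (test_support hN).
Qed.

(** On a box containing the support of [psi], the product is dominated by N (1 + |f|^p), because |f|
    <= 1 + |f|^p for p > 1. *)
Lemma Lp_loc_integrable (p : R) (f psi : R * R * R -> R) : 1 < p -> Lp_loc p f ->
  bms nrm3 psi -> (leb3 R).-integrable [set: R * R * R] (fun x => (f x * psi x)%:E).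
Proof.
move=> p1 fp [mpsi [N [psiN psi0]]].
pose g := (f \* \1_(box N) : R * R * R -> R).
have gp : g \in Lfun (leb3 R) p%:E by exact/fp/box_compact.
have mg : measurable_fun setT g by have := sub_Lfun_mfun gp; rewrite inE.
have mbox : measurable (box N) by do 2?apply: measurableX.
have ig := Lfun_integrable (ltW p1) gp.
have i1 : (leb3 R).-integrable setT (fun x => (\1_(box N) x : R)%:E).
  apply: (bms_int3f (F := \1_(box N))); split; first exact: measurable_indic.
  exists (Num.max N 1); split => x.
    by rewrite indicE ger0_norm ?ler0n// le_max lern1 leq_b1 orbT.
  by rewrite gt_max => /andP[xN _]; rewrite indicE memNset// => /boxE; rewrite leNgt xN.
have E : (fun x => (f x * psi x)%:E) = (fun x => (g x * psi x)%:E).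
  apply/funext => x; rewrite /g/= indicE; case: (boolP (x \in box N)); first by rewrite mulr1.
  rewrite notin_setE => xN; rewrite psi0 ?mulr0//.
  by rewrite ltNge; apply/negP => /boxE.
rewrite E; apply: (le_integrable measurableT _ _ (integrableZl measurableT N (integrableD measurableT i1 ig))).
  by apply/measurable_EFinP; exact: measurable_funM.
move=> x _; rewrite /= lee_fin normrM.
have N0 : 0 <= N by exact: le_trans (psiN (0, 0, 0)).
rewrite [leRHS]ger0_norm; last first.
  by rewrite mulr_ge0// addr_ge0// ?powR_ge0// indicE ler0n.
rewrite mulrC ler_pM//.
rewrite /g /= indicE; case: (boolP (x \in box N)) => _.
  rewrite mulr1/=; have [f1|f1] := leP `|f x| 1; first by rewrite (le_trans f1)// lerDl powR_ge0.
  by rewrite (le_trans _ (_ : `|f x| `^ p <= _))// ?lerDr// -[leLHS]powRr1// ler_powR// ltW.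
by rewrite mulr0 normr0 addr_ge0// powR_ge0.
Qed.

End tensor_tests.

(** * Saint-Venant's equations from a displacement field *)

Section saint_venant.
Context {R : realType}.
Variables (e : R * R * R -> 'M[R]_3) (p : R) (u : R * R * R -> 'rV[R]_3)
  (Du : R * R * R -> 'M[R]_3).
Hypotheses (p1 : 1 < p) (uDu : W1p_loc p u Du)
  (eDu : {ae leb3 R, forall x, e x = sym_part (Du x)}).

(** The derivative sits on the test function: for tensors, partial derivatives commute by
    computation, so that second derivatives can be regrouped without differentiating [u]. *)
Definition disp_pairing (i j : 'I_3) k1 k2 k3 :=
  \int[leb3 R]_x (u x 0 i * pderiv j (tens k1 k2 k3) x).

Lemma strain_pairing (f : R * R * R -> R) i j k1 k2 k3 : bnd f ->
  {ae leb3 R, forall x, e x i j = f x} -> test1 k1 -> test1 k2 -> test1 k3 ->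
  T3 f k1 k2 k3 = - (2^-1 * (disp_pairing i j k1 k2 k3 + disp_pairing j i k1 k2 k3)).
Proof.
move=> bf ef t1 t2 t3; have tt := tens_test t1 t2 t3; have bt := bms3 t1 t2 t3.
have iD i' j' := Lp_loc_integrable p1 (uDu.2 i' j').1 bt.
rewrite /disp_pairing (uDu.2 i j).2// (uDu.2 j i).2//.
rewrite -opprD mulrN opprK -RintegralD//; [|exact: iD|exact: iD].
rewrite -RintegralZl//; last first.
  by have := integrableD measurableT (iD i j) (iD j i); apply: eq_integrable.
apply: ae_eq_Rintegral.
- by case: (bms3M (bnd_lbd nrm3 bf) t1 t2 t3).
- apply: measurable_funM => //; apply: measurable_funD.
    by have /integrableP[/measurable_EFinP] := iD i j.
  by have /integrableP[/measurable_EFinP] := iD j i.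
- apply: aeS2 ef eDu => x <- ->; rewrite /sym_part !mxE -[tens _ _ _ _]/(_ * _ * _); ring.
Qed.

(** A constant diagonal entry pairs to a multiple of the integral of the test function, and this is
    zero as soon as one factor is a derivative. *)
Lemma disp_pairing_pure i k1 k2 k3 (d : R) : {ae leb3 R, forall x, e x i i = d} ->
  test1 k1 -> test1 k2 -> test1 k3 ->
  (\int[leb R]_x k1 x) * (\int[leb R]_x k2 x) * (\int[leb R]_x k3 x) = 0 ->
  disp_pairing i i k1 k2 k3 = 0.
Proof.
move=> ed t1 t2 t3 k0; have := strain_pairing (bnd_cst d) ed t1 t2 t3.
by rewrite T3_cst// k0 mulr0; lra.
Qed.

(** Both sides are expanded into integrals of a displacement component against third derivatives of
    the test. Terms that regroup into a diagonal entry vanish by [disp_pairing_pure]; the others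
    cancel. *)
Lemma saint_venant (a b c : R * R * R -> R) (d1 d2 d3 : R) : bnd a -> bnd b -> bnd c ->
  {ae leb3 R, forall x, [/\ e x i1 i1 = d1, e x i2 i2 = d2 & e x i3 i3 = d3] /\
    [/\ e x i2 i3 = a x, e x i1 i3 = b x & e x i1 i2 = c x]} ->
  compatible a b c.
Proof.
move=> ba bb bc E.
have e1 : {ae leb3 R, forall x, e x i1 i1 = d1} by apply: aeS E => x [[]].
have e2 : {ae leb3 R, forall x, e x i2 i2 = d2} by apply: aeS E => x [[]].
have e3 : {ae leb3 R, forall x, e x i3 i3 = d3} by apply: aeS E => x [[]].
have ea : {ae leb3 R, forall x, e x i2 i3 = a x} by apply: aeS E => x [_ []].
have eb : {ae leb3 R, forall x, e x i1 i3 = b x} by apply: aeS E => x [_ []].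
have ec : {ae leb3 R, forall x, e x i1 i2 = c x} by apply: aeS E => x [_ []].
have P1 k1 k2 k3 (t1 : test1 k1) (t2 : test1 k2) (t3 : test1 k3) i :
    disp_pairing i i1 k1 k2 k3 = \int[leb3 R]_x (u x 0 i * tens (derive1 k1) k2 k3 x).
  by rewrite /disp_pairing pderiv_tens//; [case: t1|case: t2|case: t3].
have P2 k1 k2 k3 (t1 : test1 k1) (t2 : test1 k2) (t3 : test1 k3) i :
    disp_pairing i i2 k1 k2 k3 = \int[leb3 R]_x (u x 0 i * tens k1 (derive1 k2) k3 x).
  by rewrite /disp_pairing pderiv_tens//; [case: t1|case: t2|case: t3].
have P3 k1 k2 k3 (t1 : test1 k1) (t2 : test1 k2) (t3 : test1 k3) i :
    disp_pairing i i3 k1 k2 k3 = \int[leb3 R]_x (u x 0 i * tens k1 k2 (derive1 k3) x).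
  by rewrite /disp_pairing pderiv_tens//; [case: t1|case: t2|case: t3].
have D := @test1_deriv R.
have I0 k : test1 k -> \int[leb R]_x derive1 k x = 0 := @test1_int_deriv R k.
split; split=> h1 h2 h3 t1 t2 t3;
  have t1' := D _ t1; have t2' := D _ t2; have t3' := D _ t3;
  have t1'' := D _ t1'; have t2'' := D _ t2'; have t3'' := D _ t3'.
- rewrite (strain_pairing ba ea)// P3// P2//.
  have := disp_pairing_pure e2 t1 t2 t3''; rewrite I0// mulr0 => /(_ erefl); rewrite P2// => ->.
  have := disp_pairing_pure e3 t1 t2'' t3; rewrite I0// mulr0 mul0r => /(_ erefl); rewrite P3// => ->.
  by rewrite addr0 mulr0 oppr0.
- rewrite (strain_pairing bb eb)// P3// P1//.
  have := disp_pairing_pure e1 t1 t2 t3''; rewrite I0// mulr0 => /(_ erefl); rewrite P1// => ->.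
  have := disp_pairing_pure e3 t1'' t2 t3; rewrite I0// !mul0r => /(_ erefl); rewrite P3// => ->.
  by rewrite addr0 mulr0 oppr0.
- rewrite (strain_pairing bc ec)// P2// P1//.
  have := disp_pairing_pure e1 t1 t2'' t3; rewrite I0// mulr0 mul0r => /(_ erefl); rewrite P1// => ->.
  have := disp_pairing_pure e2 t1'' t2 t3; rewrite I0// !mul0r => /(_ erefl); rewrite P2// => ->.
  by rewrite addr0 mulr0 oppr0.
- rewrite (strain_pairing ba ea)// (strain_pairing bb eb)// (strain_pairing bc ec)//.
  rewrite !(P1, P2, P3)//.
  have := disp_pairing_pure e1 t1 t2' t3'; rewrite I0// mulr0 mul0r => /(_ erefl).
  by rewrite P1// => ->; ring.
- rewrite (strain_pairing ba ea)// (strain_pairing bb eb)// (strain_pairing bc ec)//.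
  rewrite !(P1, P2, P3)//.
  have := disp_pairing_pure e2 t1' t2 t3'; rewrite I0// mul0r mul0r => /(_ erefl).
  by rewrite P2// => ->; ring.
- rewrite (strain_pairing ba ea)// (strain_pairing bb eb)// (strain_pairing bc ec)//.
  rewrite !(P1, P2, P3)//.
  have := disp_pairing_pure e3 t1' t2' t3; rewrite I0// mul0r mul0r => /(_ erefl).
  by rewrite P3// => ->; ring.
Qed.

End saint_venant.

(** * Distributional independence of a variable *)

Section smooth_test_functions.
Context {R : realType}.

(* A function measurable in one variable and continuous in the other is the
   limit of its samples on finer and finer grids of the latter. *)
Lemma caratheodory_measurable d (T : measurableType d) (F : T * R -> R) :
  (forall y, measurable_fun [set: T] (fun w => F (w, y))) ->
  (forall w, continuous (fun y => F (w, y))) -> measurable_fun [set: T * R] F.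
Proof.
move=> mF cF; pose q n (y : R) : R := (Num.floor (n.+1%:R * y))%:~R / n.+1%:R.
have q_cvg y : q n y @[n --> \oo] --> y.
  apply/cvgrPdist_lt => eps e0; near=> n.
  have n0 : 0 < n.+1%:R :> R by rewrite ltr0n.
  have := floor_itv (n.+1%:R * y) => /andP[f1 f2].
  have q1 : q n y <= y by rewrite ler_pdivrMr// [leRHS]mulrC.
  rewrite ger0_norm ?subr_ge0// ltrBlDr.
  have q2 : y < q n y + n.+1%:R^-1.
    rewrite -[X in _ + X]mul1r -mulrDl ltr_pdivlMr// [ltLHS]mulrC.
    by move: f2; rewrite intrD.
  apply: (lt_trans q2); rewrite addrC ltrD2r.
  by near: n; exact: near_infty_natSinv_lt (PosNum e0).
apply: (measurable_fun_cvg (h := fun n z => F (z.1, q n z.2))); last first.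
  by move=> [w y] _ /=; apply: (cvg_comp _ (fun y : R => F (w, y)) (q_cvg y)); exact: cF.
move=> n _ Y mY; rewrite setTI.
have n0 : 0 < n.+1%:R :> R by rewrite ltr0n.
pose D (k : int) : set (T * R) := [set w | Y (F (w, k%:~R / n.+1%:R))] `*`
  [set y : R | Num.floor (n.+1%:R * y) = k].
rewrite (_ : _ @^-1` Y = \bigcup_k D k); last first.
  apply/seteqP; split => [[w y] Yw|[w y] [k _ [/= Yw kE]]]; last by rewrite /q kE.
  by exists (Num.floor (n.+1%:R * y)).
apply: countable_bigcupT_measurable => [|k]; first exact: countableP.
apply: measurableX.
  by have := mF (k%:~R / n.+1%:R) measurableT Y mY; rewrite setTI.
rewrite (_ : [set y : R | _] = `[k%:~R / n.+1%:R, (k + 1)%:~R / n.+1%:R[%classic)//.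
apply/seteqP; split => y /=; rewrite in_itv/= ler_pdivrMr// ltr_pdivlMr// (mulrC y).
  by move=> <-; exact: floor_itv.
by move=> ?; exact: floor_def.
Unshelve. all: by end_near. Qed.

Lemma continuous_slice1 (U V : topologicalType) (f : U * V -> R) y :
  continuous f -> continuous (fun x => f (x, y)).
Proof.
move=> cf x; apply: (@cvg_comp2 _ _ _ _ _ (nbhs x) (nbhs y) _ _ _ _ id (cst y)
  (fun a b => f (a, b))) => //.
  exact: cvg_cst.
by rewrite (_ : (fun z => _) = f); [exact: cf|apply/funext => -[]].
Qed.

Lemma continuous_slice2 (U V : topologicalType) (f : U * V -> R) x :
  continuous f -> continuous (fun y => f (x, y)).
Proof.
move=> cf y; apply: (@cvg_comp2 _ _ _ _ _ (nbhs x) (nbhs y) _ _ _ _ (cst x) id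
  (fun a b => f (a, b))) => //.
  exact: cvg_cst.
by rewrite (_ : (fun z => _) = f); [exact: cf|apply/funext => -[]].
Qed.

Lemma continuous_measurable2 (f : R * R -> R) : continuous f ->
  measurable_fun [set: R * R] f.
Proof.
move=> cf; apply: caratheodory_measurable => [y|x].
  apply: continuous_measurable_fun; exact: (@continuous_slice1 _ _ f y cf).
exact: (@continuous_slice2 _ _ f x cf).
Qed.

Lemma continuous_measurable3 (f : R * R * R -> R) : continuous f ->
  measurable_fun [set: R * R * R] f.
Proof.
move=> cf; apply: caratheodory_measurable => [y|x].
  apply: continuous_measurable2; exact: (@continuous_slice1 _ _ f y cf).
exact: (@continuous_slice2 _ _ f x cf).
Qed.

Lemma continuous_bms (f : R * R * R -> R) N : continuous f ->
  (forall x, N < nrm3 x -> f x = 0) -> bms nrm3 f.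
Proof.
move=> cf f0; split; first exact: continuous_measurable3.
have : compact (f @` box N).
  apply: continuous_compact; last exact: box_compact.
  exact: continuous_subspaceT.
move/compact_bounded => [M [_ fM]].
exists (Num.max N (Num.max 0 (M + 1))); split => x; last first.
  by rewrite gt_max => /andP[/f0].
have [xN|/f0 ->] := leP (nrm3 x) N; last by rewrite normr0 !le_max lexx !orbT.
rewrite !le_max (fM (M + 1)) ?orbT ?ltrDl//; exists x => //; exact/boxE.
Qed.

End smooth_test_functions.

(** * Smooth functions of three variables restricted to coordinate lines *)

Section test_functions.
Context {R : realType}.
Implicit Types (phi psi : R * R * R -> R).

Lemma nrm3_norm (x : R * R * R) : nrm3 x = `|x|.
Proof. by rewrite !prod_normE. Qed.

Lemma smooth_pderiv phi i : smooth phi -> smooth (pderiv i phi).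
Proof. by move=> sphi s x; have := sphi (rcons s i) x; rewrite foldr_rcons. Qed.

Lemma smooth_continuous phi : smooth phi -> continuous phi.
Proof. by move=> sphi x; apply: differentiable_continuous; exact: (sphi [::] x). Qed.

Lemma pderiv_out phi i N : (forall x, N < nrm3 x -> phi x = 0) ->
  forall x, N < nrm3 x -> pderiv i phi x = 0.
Proof.
move=> p0 x; rewrite nrm3_norm => Nx; apply: derive_line.
apply: (@is_derive_near R (cst 0)); near=> s.
rewrite p0// nrm3_norm.
have : `|s| * `|Defs.basis R i| < `|x| - N.
  have b0 : 0 < `|Defs.basis R i| + 1 by rewrite ltr_wpDl.
  apply: (@le_lt_trans _ _ (`|s| * (`|Defs.basis R i| + 1))).
    by rewrite ler_wpM2l// lerDl.
  rewrite -ltr_pdivlMr//; near: s.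
  exists ((`|x| - N) / (`|Defs.basis R i| + 1)); first by rewrite /= divr_gt0// subr_gt0.
  by move=> s /=; rewrite sub0r normrN.
rewrite -normrZ; have := ler_normB (x + s *: Defs.basis R i) (s *: Defs.basis R i).
by rewrite addrK; lra.
Unshelve. all: by end_near. Qed.

Lemma test_support_bound phi : test_function phi ->
  exists N, forall x, N < nrm3 x -> phi x = 0.
Proof.
move=> [_ /compact_bounded [M [_ hM]]]; exists (M + 1) => x xM.
apply/eqP/negPn/negP => px; have := hM (M + 1); rewrite ltrDl ltr01 => /(_ isT x).
have cx : closure [set x | phi x != 0] x by exact: (@subset_closure _ [set x | phi x != 0]).
move=> /(_ cx); rewrite /= -nrm3_norm leNgt.
by rewrite xM.
Qed.

Lemma bms_pderiv phi i : test_function phi -> bms nrm3 (pderiv i phi).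
Proof.
move=> tphi; have [N hN] := test_support_bound tphi.
apply: (@continuous_bms _ _ N); last exact: pderiv_out.
by apply: smooth_continuous; apply: smooth_pderiv; case: tphi.
Qed.

Lemma smooth_line_Cn phi i a n : smooth phi ->
  Cn n (fun s : R => phi (a + s *: Defs.basis R i)).
Proof.
elim: n phi => [|n IH] phi sphi;
  have d (s : R) := is_derive_line (diff_derivable (v := Defs.basis R i) (sphi [::] (a + s *: Defs.basis R i))).
  exact: Cn0 d.
by apply: (CnS d); apply: (IH (pderiv i phi)); exact: smooth_pderiv.
Qed.

(** On a coordinate line the partial derivative of a test function is the derivative of a
    one-variable test function, so its integral along the line is zero. *)
Lemma pderiv_line phi i a : test_function phi ->
  exists2 h, test1 h & forall s : R, pderiv i phi (a + s *: Defs.basis R i) = derive1 h s.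
Proof.
move=> tphi; have [N hN] := test_support_bound tphi; have [sphi _] := tphi.
have d (s : R) := is_derive_line (diff_derivable (v := Defs.basis R i) (sphi [::] (a + s *: Defs.basis R i))).
exists (fun s : R => phi (a + s *: Defs.basis R i)); last by rewrite (is_derive_fun d).
split; first by move=> n; exact: smooth_line_Cn.
exists (N + `|a|) => s sN; apply: hN; rewrite nrm3_norm.
have : `|s| <= `|s *: Defs.basis R i|.
  rewrite normrZ ler_peMr// -nrm3_norm /nrm3 /nrm2 /nrmX /nrm1 /Defs.basis/=.
  by case: i {d} => -[|[|[|//]]] ?; rewrite /= ?normr1 !le_max lexx ?orbT.
have := ler_normB (a + s *: Defs.basis R i) a; rewrite addrAC subrr add0r; lra.
Qed.

Lemma line_coord (x y z s : R) i : (x, y, z) + s *: Defs.basis R i =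
  (x + s * (i == i1)%:R, y + s * (i == i2)%:R, z + s * (i == i3)%:R).
Proof. by []. Qed.

Lemma int3_lines (G : R * R * R -> R) i : bms nrm3 G ->
  (forall a, \int[leb R]_s G (a + s *: Defs.basis R i) = 0) -> \int[leb3 R]_x G x = 0.
Proof.
have H0 F : bms nrm3 F -> (forall w, \int[leb R]_s F (w, s) = 0) -> \int[leb3 R]_x F x = 0.
  move=> bF F0; rewrite int3_int2// (_ : (fun w => _) = cst 0) ?Rintegral_cst ?mul0r//.
  exact/funext.
move=> bG; case: i => -[|[|[|//]]] lti G0.
- apply: etrans (esym (int3_s12 bG)) _; have bG' := bms_s12 bG.
  apply: etrans (esym (int3_s23 bG')) _; apply: H0 (bms_s23 bG') _ => -[y z].
  rewrite -[RHS](G0 (0, y, z)); apply: eq_Rintegral => s _; congr G.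
  by rewrite line_coord mulr1 !mulr0 !addr0 add0r.
- apply: etrans (esym (int3_s23 bG)) _; apply: H0 (bms_s23 bG) _ => -[y z].
  rewrite -[RHS](G0 (y, 0, z)); apply: eq_Rintegral => s _; congr G.
  by rewrite line_coord mulr1 !mulr0 !addr0 add0r.
- apply: H0 bG _ => -[y z].
  rewrite -[RHS](G0 (y, z, 0)); apply: eq_Rintegral => s _; congr G.
  by rewrite line_coord mulr1 !mulr0 !addr0 add0r.
Qed.

(** Fubini with direction [j] innermost takes [F] out of the inner integral, and what remains is the
    integral of a derivative. *)
Lemma independent_weak_pderiv (f F : R * R * R -> R) j : measurable_fun [set: R * R * R] f ->
  bnd F -> (forall a (s : R), F (a + s *: Defs.basis R j) = F a) ->
  {ae leb3 R, forall x, f x = F x} -> weak_pderiv j f (cst 0).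
Proof.
move=> mf bF Fj fF phi tphi; have bp := bms_pderiv j tphi.
rewrite (_ : \int[leb3 R]_x (cst 0 x * phi x) = 0); last first.
  rewrite (_ : (fun x => _) = cst 0) ?Rintegral_cst ?mul0r//.
  by apply/funext => x; rewrite mul0r.
rewrite oppr0; have bG : bms nrm3 (fun x => F x * pderiv j phi x).
  by apply: bmsMl => //; exact: bnd_lbd.
transitivity (\int[leb3 R]_x (F x * pderiv j phi x)).
  apply: ae_eq_Rintegral; last by apply: aeS fF => x ->.
    by apply: measurable_funM => //; case: bp.
  by case: bG.
apply: (int3_lines (i := j)) => // a.
have [h th hE] := pderiv_line j a tphi.
rewrite (_ : (fun s => _) = fun s => F a * derive1 h s); last first.
  by apply/funext => s; rewrite Fj hE.
by rewrite RintegralZl_test ?test1_int_deriv ?mulr0//; exact: test1_deriv.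
Qed.

End test_functions.

Section lifting.
Context {R : realType}.

Lemma lipschitz_Lip (F : R -> R) : lipschitz F -> Lip F.
Proof.
move=> [M [_ hM]]; exists (M + 1) => x y.
by have := hM (M + 1); rewrite ltrDl ltr01 => /(_ isT (x, y)); apply.
Qed.

Lemma ae_measurable1 (P : R -> Prop) : {ae leb R, forall x : R, P x} ->
  exists Q : set R, [/\ measurable Q, Q `<=` [set x | P x] & {ae leb R, forall x : R, Q x}].
Proof.
move=> [A [mA A0 PA]]; exists (~` A); split; first exact: measurableC.
  by move=> x nA; apply: contrapT => /PA.
by exists A; split => // x /= /contrapT.
Qed.

Lemma ae_lift1 (P : R -> Prop) : {ae leb R, forall x : R, P x} ->
  {ae leb2 R, forall z : R * R, P z.1}.
Proof.
move=> /ae_measurable1[Q [mQ QP aQ]].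
suff : {ae leb2 R, forall z : R * R, Q z.1} by apply: aeS => z /QP.
apply: (@prod_ae _ _ _ _ _ (leb R) (leb R)).
  have := @measurable_fst _ _ R R measurableT _ mQ; rewrite setTI; exact.
by apply: aeS aQ => x Qx; exact: aeW.
Qed.

Lemma ae_lift_p12 (g : R * R -> R) m : bnd g -> ZZ g m ->
  {ae leb3 R, forall x : R * R * R, g (x.1.1, x.1.2) = m}.
Proof.
move=> bg Zg; apply: ae3_of_nest.
  by apply: measurable_eq => //; case: (bnd_p12 bg).
by apply: aeS Zg => x; apply: aeS => y gE; exact: aeW.
Qed.

Lemma ae_lift_p13 (P : R * R -> Prop) : measurable [set w | P w] ->
  {ae leb R, forall x : R, {ae leb R, forall z : R, P (x, z)}} ->
  {ae leb3 R, forall x : R * R * R, P (x.1.1, x.2)}.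
Proof.
move=> mP aP.
have : {ae leb3 R, forall x : R * R * R, P (x.1.1, x.1.2)}.
  apply: ae3_of_nest.
    have m12 : measurable_fun [set: R * R * R] (fun x : R * R * R => (x.1.1, x.1.2)).
      by apply: measurable_fun_pair; exact: measurableT_comp.
    by have := m12 measurableT _ mP; rewrite setTI.
  by apply: aeS aP => x; apply: aeS => y Pxy; exact: aeW.
by move/ae3_s23.
Qed.

End lifting.

Section periodize.
Context {R : realType}.

Lemma periodize_in (l : R) (f : R -> R) t : 0 <= t < l -> periodize l f t = f t.
Proof.
move=> /andP[t0 tl]; have l0 : 0 < l := le_lt_trans t0 tl.
rewrite /periodize (floor_def (m := 0)) ?mul0r ?subr0//.
by rewrite add0r ltr_pdivrMr// mul1r tl andbT divr_ge0// ltW.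
Qed.

Lemma periodizeD (l : R) (f : R -> R) t : 0 < l -> periodize l f (t + l) = periodize l f t.
Proof.
move=> l0; rewrite /periodize mulrDl divff ?gt_eqF//.
rewrite (floor_def (m := Num.floor (t / l) + 1)).
  by rewrite intrD mulrDl mul1r opprD addrACA subrr addr0.
by rewrite !(intrD _ _ 1) lerD2r ltrD2r -intrD floor_itv.
Qed.

End periodize.

Section planar_reduction.
Context {R : realType}.
Implicit Types (f : R * R * R -> R).

Lemma T3_indep2 f r : bnd f -> mean_test r ->
  (forall h1 h2 h3, test1 h1 -> test1 h2 -> test1 h3 -> T3 f h1 (derive1 h2) h3 = 0) ->
  {ae leb3 R, forall x, f x = E2 r f (x.1.1, x.2)}.
Proof.
move=> bf [tr ir] f0; have bE := bnd_E2 bf tr; have bp := bnd_p13 bE.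
suff : {ae leb3 R, forall x, f x + - p13 (E2 r f) x = 0}.
  by apply: aeS => x /eqP; rewrite subr_eq0 => /eqP.
apply: fund3_T => [|h1 h2 h3 t1 t2 t3]; first exact: bndB.
rewrite T3_add ?T3_opp ?T3_p13 -?T3_E2//; last exact: bndN.
have [_ T2' _] := T3_trilin (bnd_lbd nrm3 bf).
rewrite (linform_deriv0 (T2' h1 h3 t1 t3) _ tr ir t2) ?subrr//.
by move=> h th; exact: f0.
Qed.

Lemma pderiv_zero_T3 (e : R * R * R -> 'M[R]_3) i k f : bnd f ->
  measurable_fun [set: R * R * R] (fun x => e x i k) ->
  {ae leb3 R, forall x, e x i k = f x} -> pderiv_zero i2 e ->
  forall h1 h2 h3, test1 h1 -> test1 h2 -> test1 h3 -> T3 f h1 (derive1 h2) h3 = 0.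
Proof.
move=> bf me ef e0 h1 h2 h3 t1 t2 t3; have t2' := test1_deriv t2.
have bt := bms3 t1 t2' t3.
have := e0 i k _ (tens_test t1 t2 t3).
rewrite [X in _ = - X -> _](_ : _ = 0) ?oppr0; last first.
  rewrite (_ : (fun x => _) = cst 0) ?Rintegral_cst ?mul0r//.
  by apply/funext => x; rewrite mul0r.
move=> <-; rewrite pderiv_tens; [|by case: t1|by case: t2|by case: t3].
apply: ae_eq_Rintegral.
- by case: (bms3M (bnd_lbd nrm3 bf) t1 t2' t3).
- by apply: measurable_funM => //; case: bt.
- by apply: aeS ef => x ->.
Qed.

Lemma E2_periodic l1 l2 l3 f r : periodic3 l1 l2 l3 f ->
  (forall z, E2 r f (z.1 + l1, z.2) = E2 r f z) /\
  (forall z, E2 r f (z.1, z.2 + l3) = E2 r f z).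
Proof.
by move=> [p1 _ p3]; split => z; apply: eq_Rintegral => s _; rewrite /= ?p1 ?p3.
Qed.

End planar_reduction.

(** * The periodic strain *)

Section wells.
Context {R : realType}.

Lemma ord3P (i : 'I_3) : [\/ i = i1, i = i2 | i = i3].
Proof.
by case: i => -[|[|[|//]]] ?; [constructor 1|constructor 2|constructor 3]; exact: val_inj.
Qed.

Lemma sgn1E (x : R) : sgn1 x <-> x * x = 1.
Proof.
split; first by case=> ->; ring.
move=> h; have /eqP : (x - 1) * (x + 1) = 0 by rewrite -subr_sqr expr1n expr2 h subrr.
by rewrite mulf_eq0 subr_eq0 addr_eq0 => /orP[/eqP|/eqP]; [left|right].
Qed.

Lemma measurable_and d (T : measurableType d) (P Q : T -> Prop) :
  measurable [set x | P x] -> measurable [set x | Q x] -> measurable [set x | P x /\ Q x].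
Proof. by move=> mP mQ; exact: measurableI. Qed.

(** The wells enter only through these polynomial identities between entries, whose solution set in
    x is measurable, as the passage from the torus to R^3 requires. *)
Definition well_entries (d1 d2 d3 : R) (A : 'M[R]_3) :=
  A i1 i1 = d1 /\ A i2 i2 = d2 /\ A i3 i3 = d3 /\
  A i3 i2 = A i2 i3 /\ A i3 i1 = A i1 i3 /\ A i2 i1 = A i1 i2 /\
  A i2 i3 * A i2 i3 = 1 /\ A i1 i3 * A i1 i3 = 1 /\ A i1 i2 * A i1 i2 = 1 /\
  A i2 i3 * A i1 i3 * A i1 i2 = 1.

Lemma mem_wells (d1 d2 d3 : R) (A : 'M[R]_3) :
  A \in [:: strain1 d1 d2 d3; strain2 d1 d2 d3; strain3 d1 d2 d3; strain4 d1 d2 d3] ->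
  well_entries d1 d2 d3 A.
Proof.
by rewrite !inE => /or4P[]/eqP ->; rewrite /well_entries !mxE/=; do ?split => //; ring.
Qed.

(* Clipping changes the strain on a null set only and makes it bounded everywhere. *)
Definition clip (x : R) := Num.max (-1) (Num.min 1 x).

Lemma clip_sgn x : x * x = 1 -> clip x = x.
Proof.
move=> /sgn1E[] ->; rewrite /clip; first by rewrite minxx max_r// lerN10.
have n1 : -1 <= 1 :> R by rewrite (le_trans (lerN10 R)).
by rewrite min_r// maxxx.
Qed.

Lemma clip_norm x : `|clip x| <= 1.
Proof. by rewrite ler_norml /clip le_max lexx ge_max ge_min lexx; lra. Qed.

Variables (lambda : 'I_3 -> R) (d1 d2 d3 : R) (e : R * R * R -> 'M[R]_3).
Hypothesis lambda_gt0 : forall i, 0 < lambda i.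
Hypothesis e_grad : periodic_sym_grad lambda e.
Hypothesis e_wells : {ae leb3 R, forall x, torus lambda x ->
  e x \in [:: strain1 d1 d2 d3; strain2 d1 d2 d3; strain3 d1 d2 d3; strain4 d1 d2 d3]}.

Definition shear i j (x : R * R * R) := clip (e x i j).

Lemma entry_measurable i j : measurable_fun [set: R * R * R] (fun x => e x i j).
Proof. by have [+ _ _] := e_grad; apply. Qed.

Lemma grad_periodic i x : e (x + lambda i *: Defs.basis R i) = e x.
Proof. by have [_ + _] := e_grad; apply. Qed.

Lemma grad_periodic1 x y z : e (x + lambda i1, y, z) = e (x, y, z).
Proof. by rewrite -[RHS](grad_periodic i1) line_coord mulr1 !mulr0 !addr0. Qed.

Lemma grad_periodic2 x y z : e (x, y + lambda i2, z) = e (x, y, z).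
Proof. by rewrite -[RHS](grad_periodic i2) line_coord mulr1 !mulr0 !addr0. Qed.

Lemma grad_periodic3 x y z : e (x, y, z + lambda i3) = e (x, y, z).
Proof. by rewrite -[RHS](grad_periodic i3) line_coord mulr1 !mulr0 !addr0. Qed.

Lemma shear_periodic i j : periodic3 (lambda i1) (lambda i2) (lambda i3) (shear i j).
Proof.
by split => x y z; rewrite /shear ?grad_periodic1 ?grad_periodic2 ?grad_periodic3.
Qed.

Lemma shear_unit_bounded i j : unit_bounded (shear i j).
Proof.
split => [|x]; last exact: clip_norm.
apply: (@measurable_maxr _ _ _ _ (cst (-1)) (fun x => Num.min 1 (e x i j))) => //.
by apply: (@measurable_minr _ _ _ _ (cst 1)) => //; exact: entry_measurable.
Qed.

Lemma well_entries_ae : {ae leb3 R, forall x, well_entries d1 d2 d3 (e x)}.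
Proof.
apply: (ae3_periodic (lambda_gt0 i1) (lambda_gt0 i2) (lambda_gt0 i3)).
- have mE := entry_measurable.
  by do ![apply: measurable_and]; apply: measurable_eq => //;
    do ?[exact: mE|apply: measurable_funM].
- by move=> x y z; rewrite grad_periodic1.
- by move=> x y z; rewrite grad_periodic2.
- by move=> x y z; rewrite grad_periodic3.
apply: aeS e_wells => x + /andP[x1 x1'] /andP[x2 x2'] /andP[x3 x3'] => h.
apply: mem_wells; apply: h => i; case: (ord3P i) => ->; rewrite /xcoord/=;
  by apply/andP; split => //; exact: ltW.
Qed.

Lemma shear_ae i j : i != j -> {ae leb3 R, forall x, e x i j = shear i j x}.
Proof.
move=> ij; apply: aeS well_entries_ae => x; rewrite /well_entries.
move=> [_ [_ [_ [e32 [e31 [e21 [a1 [b1 [c1 _]]]]]]]]].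
rewrite /shear clip_sgn//; move: ij.
by case: (ord3P i) => ->; case: (ord3P j) => -> //; rewrite ?e32 ?e31 ?e21.
Qed.

Local Notation a := (shear i2 i3).
Local Notation b := (shear i1 i3).
Local Notation c := (shear i1 i2).

Lemma shear_sgn : {ae leb3 R, forall x,
  [/\ sgn1 (a x), sgn1 (b x), sgn1 (c x) & a x * b x * c x = 1]}.
Proof.
apply: aeS well_entries_ae => x.
move=> [_ [_ [_ [_ [_ [_ [a1 [b1 [c1 p1]]]]]]]]].
by rewrite /shear !clip_sgn//; split => //; apply/sgn1E.
Qed.

Lemma shear_compatible : compatible a b c.
Proof.
have [_ _ [p [u [Du [p1 uDu eDu]]]]] := e_grad.
have bn i j := unit_bounded_bnd (shear_unit_bounded i j).
apply: (saint_venant p1 uDu eDu (d1 := d1) (d2 := d2) (d3 := d3)) => //.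
have ea := shear_ae (isT : i2 != i3); have eb := shear_ae (isT : i1 != i3).
have ec := shear_ae (isT : i1 != i2).
by apply: aeS2 well_entries_ae (aeS3 (fun x => @And3 _ _ _) ea eb ec) => x [? [? [? _]]].
Qed.

End wells.

(** * The three assertions for a periodic strain *)

Section main_parts.
Context {R : realType}.
Variables (lambda : 'I_3 -> R) (d1 d2 d3 : R) (e : R * R * R -> 'M[R]_3).
Hypothesis lambda_gt0 : forall i, 0 < lambda i.
Hypothesis e_grad : periodic_sym_grad lambda e.
Hypothesis e_wells : {ae leb3 R, forall x, torus lambda x ->
  e x \in [:: strain1 d1 d2 d3; strain2 d1 d2 d3; strain3 d1 d2 d3; strain4 d1 d2 d3]}.

Local Notation a := (shear e i2 i3).
Local Notation b := (shear e i1 i3).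
Local Notation c := (shear e i1 i2).

Let well_ae := well_entries_ae lambda_gt0 e_grad e_wells.
Let e_meas := entry_measurable e_grad.
Let lu i j := shear_unit_bounded e_grad i j.
Let bu i j := unit_bounded_bnd (lu i j).
Let pu i j := shear_periodic e_grad i j.

Lemma pderiv_zero_of j (Fa Fb Fc : R * R * R -> R) : bnd Fa -> bnd Fb -> bnd Fc ->
  (forall x (s : R), [/\ Fa (x + s *: Defs.basis R j) = Fa x,
    Fb (x + s *: Defs.basis R j) = Fb x & Fc (x + s *: Defs.basis R j) = Fc x]) ->
  {ae leb3 R, forall x, [/\ a x = Fa x, b x = Fb x & c x = Fc x]} ->
  pderiv_zero j e.
Proof.
move=> bFa bFb bFc Fj FE.
have ea := shear_ae lambda_gt0 e_grad e_wells (isT : i2 != i3).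
have eb := shear_ae lambda_gt0 e_grad e_wells (isT : i1 != i3).
have ec := shear_ae lambda_gt0 e_grad e_wells (isT : i1 != i2).
have H : {ae leb3 R, forall x, well_entries d1 d2 d3 (e x) /\
    [/\ e x i2 i3 = Fa x, e x i1 i3 = Fb x & e x i1 i2 = Fc x]}.
  apply: aeS2 (aeS3 (fun x => @And3 _ _ _) ea eb ec) (aeS2 (fun x => @conj _ _) well_ae FE).
  by move=> x [-> -> ->] [w [-> -> ->]].
have fin i k (F : R * R * R -> R) : bnd F ->
    (forall x (s : R), F (x + s *: Defs.basis R j) = F x) ->
    {ae leb3 R, forall x, e x i k = F x} -> weak_pderiv j (fun x => e x i k) (cst 0).
  move=> bF Fj'; exact: independent_weak_pderiv (e_meas i k) bF Fj'.
have Fja x s : Fa (x + s *: Defs.basis R j) = Fa x by case: (Fj x s).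
have Fjb x s : Fb (x + s *: Defs.basis R j) = Fb x by case: (Fj x s).
have Fjc x s : Fc (x + s *: Defs.basis R j) = Fc x by case: (Fj x s).
move=> i k; case: (ord3P i) => ->; case: (ord3P k) => ->.
- by apply: (fin _ _ (cst d1)) => //; [exact: bnd_cst|apply: aeS H => x [[]]].
- by apply: (fin _ _ Fc) => //; apply: aeS H => x [_ []].
- by apply: (fin _ _ Fb) => //; apply: aeS H => x [_ []].
- apply: (fin _ _ Fc) => //; apply: aeS H => x [[_ [_ [_ [_ [_ [-> _]]]]]] []] //.
- by apply: (fin _ _ (cst d2)) => //; [exact: bnd_cst|apply: aeS H => x [[_ []]]].
- by apply: (fin _ _ Fa) => //; apply: aeS H => x [_ []].
- apply: (fin _ _ Fb) => //; apply: aeS H => x [[_ [_ [_ [_ [-> _]]]]] []] //.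
- apply: (fin _ _ Fa) => //; apply: aeS H => x [[_ [_ [_ [-> _]]]] []] //.
- by apply: (fin _ _ (cst d3)) => //; [exact: bnd_cst|apply: aeS H => x [[_ [_ []]]]].
Qed.

Variables r1 r2 r3 : R -> R.
Hypotheses (w1 : window (lambda i1) r1) (w2 : window (lambda i2) r2)
  (w3 : window (lambda i3) r3).

Let mr1 : mean_test r1. Proof. by case: w1. Qed.
Let mr2 : mean_test r2. Proof. by case: w2. Qed.
Let mr3 : mean_test r3. Proof. by case: w3. Qed.

Let compat := shear_compatible lambda_gt0 e_grad e_wells.
Let usgn := shear_sgn lambda_gt0 e_grad e_wells.

Let C := strain_core (lambda_gt0 i1) (lambda_gt0 i2) (lambda_gt0 i3) w1 w2 w3
  (lu i2 i3) (lu i1 i3) (lu i1 i2) (pu i2 i3) (pu i1 i3) (pu i1 i2) usgn compat.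
Let D := strain_decomposition w1 w2 w3
  (lu i2 i3) (lu i1 i3) (lu i1 i2) (pu i2 i3) (pu i1 i3) (pu i1 i2) compat.

Lemma exists_pderiv_zero : exists j, pderiv_zero j e.
Proof.
have b12 (f : R * R * R -> R) : bnd f -> bnd (p12 (E3 r3 f)).
  by move=> bf; apply: bnd_p12; exact: bnd_E3 bf mr3.1.
have b13 (f : R * R * R -> R) : bnd f -> bnd (p13 (E2 r2 f)).
  by move=> bf; apply: bnd_p13; exact: bnd_E2 bf mr2.1.
have b23 (f : R * R * R -> R) : bnd f -> bnd (p23 (E1 r1 f)).
  by move=> bf; apply: bnd_p23; exact: bnd_E1 bf mr1.1.
case: (core_main C) => -[Z Z'].
(* Here e_23 and e_12 are functions of (x1, x3), and e_13 is their product since all three are signs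
   with product 1. The other two cases are alike. *)
- exists i2.
  apply: (@pderiv_zero_of i2 (p13 (E2 r2 a)) (fun x => p13 (E2 r2 a) x * p13 (E2 r2 c) x)
    (p13 (E2 r2 c))); [exact: b13|by apply: bndM; exact: b13|exact: b13| |].
    by move=> [[x y] z] s; rewrite line_coord /p13/= !mulr0 !addr0.
  have za := ae_lift_p12 (bnd_E3 (bu i2 i3) mr3.1) Z.
  have zc := ae3_s12 (ae3_s23 (ae3_s12 (ae_lift_p12 (bnd_tr (bnd_E1 (bu i1 i2) mr1.1)) Z'))).
  apply: aeS3 (aeS2 (fun x => @conj _ _) za zc) D usgn => -[[x y] z].
  rewrite /s12 /s23 /p13/= /tr/= => -[-> ->] [aE bE cE] [_ sb _ abc].
  have aE' : a (x, y, z) = E2 r2 a (x, z) by rewrite aE; ring.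
  have cE' : c (x, y, z) = E2 r2 c (x, z) by rewrite cE; ring.
  split => //; rewrite -aE' -cE'; move/sgn1E : sb => b2.
  by rewrite -[LHS]mul1r -abc -[RHS]mulr1 -b2; ring.
- exists i1.
  apply: (@pderiv_zero_of i1 (fun x => p23 (E1 r1 b) x * p23 (E1 r1 c) x) (p23 (E1 r1 b))
    (p23 (E1 r1 c))); [by apply: bndM; exact: b23|exact: b23|exact: b23| |].
    by move=> [[x y] z] s; rewrite line_coord /p23/= !mulr0 !addr0.
  have zb := ae3_s12 (ae_lift_p12 (bnd_tr (bnd_E3 (bu i1 i3) mr3.1)) Z).
  have zc := ae3_s23 (ae3_s12 (ae_lift_p12 (bnd_tr (bnd_E2 (bu i1 i2) mr2.1)) Z')).
  apply: aeS3 (aeS2 (fun x => @conj _ _) zb zc) D usgn => -[[x y] z].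
  rewrite /s12 /s23 /p23/= /tr/= => -[-> ->] [aE bE cE] [sa _ _ abc].
  have bE' : b (x, y, z) = E1 r1 b (y, z) by rewrite bE; ring.
  have cE' : c (x, y, z) = E1 r1 c (y, z) by rewrite cE; ring.
  split => //; rewrite -bE' -cE'; move/sgn1E : sa => a2.
  by rewrite -[LHS]mul1r -abc -[RHS]mulr1 -a2; ring.
- exists i3.
  apply: (@pderiv_zero_of i3 (p12 (E3 r3 a)) (p12 (E3 r3 b))
    (fun x => p12 (E3 r3 a) x * p12 (E3 r3 b) x));
    [exact: b12|exact: b12|by apply: bndM; exact: b12| |].
    by move=> [[x y] z] s; rewrite line_coord /p12/= !mulr0 !addr0.
  have za := ae3_s23 (ae_lift_p12 (bnd_E2 (bu i2 i3) mr2.1) Z).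
  have zb := ae3_s12 (ae3_s23 (ae_lift_p12 (bnd_E1 (bu i1 i3) mr1.1) Z')).
  apply: aeS3 (aeS2 (fun x => @conj _ _) za zb) D usgn => -[[x y] z].
  rewrite /s12 /s23 /p12/= /tr/= => -[-> ->] [aE bE cE] [_ _ sc abc].
  have aE' : a (x, y, z) = E3 r3 a (x, y) by rewrite aE; ring.
  have bE' : b (x, y, z) = E3 r3 b (x, y) by rewrite bE; ring.
  split => //; rewrite -aE' -bE'; move/sgn1E : sc => c2.
  by rewrite -[LHS]mul1r -abc -[RHS]mulr1 -c2; ring.
Qed.

Lemma planar_reduction i k : i != k -> pderiv_zero i2 e ->
  {ae leb3 R, forall x, shear e i k x = E2 r2 (shear e i k) (x.1.1, x.2)}.
Proof.
move=> ik e0; apply: T3_indep2 (bu i k) mr2 _.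
exact: (pderiv_zero_T3 (bu i k) (e_meas i k) (shear_ae lambda_gt0 e_grad e_wells ik) e0).
Qed.

(** The functions at hand are signs only almost everywhere, whereas [sign_valued] bears on every
    point. *)
Lemma to_sign_exists (h : R -> R) : measurable_fun [set: R] h ->
  exists f : R -> R, [/\ measurable_fun [set: R] f, forall t, f t = -1 \/ f t = 1 &
    forall t, sgn1 (h t) -> f t = h t].
Proof.
move=> mh; have mS : measurable [set t | h t = 1] by exact: measurable_eq.
exists (fun t => 2 * \1_[set t | h t = 1] t - 1); split.
- apply: measurable_funD => //; apply: measurable_funM => //.
- by move=> t; rewrite indicE; case: (_ \in _); [right|left]; rewrite /=; ring.
- move=> t [] ht; rewrite indicE ht; first by rewrite mem_set//=; ring.
  rewrite memNset/=; first by ring.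
  by rewrite ht => h11; have : (-1 : R) < 1 by []; rewrite h11 ltxx.
Qed.

Lemma e13_one_variable : pderiv_zero i2 e ->
  exists f1 f3 : R -> R,
    [/\ measurable_fun `[0, lambda i1[ f1 /\ sign_valued (lambda i1) f1,
        measurable_fun `[0, lambda i3[ f3 /\ sign_valued (lambda i3) f3 &
        {ae leb3 R, forall x, torus lambda x -> e x i1 i3 = f1 (xcoord i1 x)} \/
        {ae leb3 R, forall x, torus lambda x -> e x i1 i3 = f3 (xcoord i3 x)}].
Proof.
move=> e0; have bB := planar_reduction (isT : i1 != i3) e0.
have eb := shear_ae lambda_gt0 e_grad e_wells (isT : i1 != i3).
set B := E2 r2 b in bB; set m := T3 b r1 r2 r3.
have bndB : bnd B by exact: bnd_E2 mr2.1.
have bnd21 : bnd (tr (E3 r3 b)) by apply: bnd_tr; exact: bnd_E3 mr3.1.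
have bnd23 : bnd (E1 r1 b) by exact: bnd_E1 mr1.1.
have H : {ae leb3 R, forall x, sgn1 (B (x.1.1, x.2)) /\
    B (x.1.1, x.2) = tr (E3 r3 b) (x.1.2, x.1.1) + E1 r1 b (x.1.2, x.2) - m}.
  by apply: aeS3 bB D usgn => x bE [_ <- _] [_ + _ _]; rewrite -bE.
(* With x2 outermost a single good value [y] can be fixed; the splitting of e_13 then becomes g1(x1)
   + g3(x3) - m. *)
have [y Hy] := ae_ex (ae3_nest (ae3_s12 H)); rewrite /s12/= in Hy.
have b1 : bnd (fun x => tr (E3 r3 b) (y, x)) by exact: bnd_slice1.
have b3 : bnd (fun z => E1 r1 b (y, z)) by exact: bnd_slice1.
set g1 := fun x => tr (E3 r3 b) (y, x) in b1.
set g3 := fun z => E1 r1 b (y, z) in b3.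
have sg : {ae leb R, forall x : R, {ae leb R, forall z : R, sgn1 (g1 x + g3 z - m)}}.
  by apply: aeS Hy => x; apply: aeS => z [+ E]; rewrite E.
have Bm : measurable_fun [set: R * R] B by case: bndB.
have mg1 : measurable_fun [set: R] g1 by case: b1.
have mg3 : measurable_fun [set: R] g3 by case: b3.
have res (h : R * R -> R) : measurable_fun [set: R * R] h ->
    {ae leb R, forall x : R, {ae leb R, forall z : R, B (x, z) = h (x, z)}} ->
    {ae leb3 R, forall x, e x i1 i3 = h (x.1.1, x.2) /\ sgn1 (h (x.1.1, x.2))}.
  move=> mh Bh; have mP := measurable_eq Bm mh.
  have L := @ae_lift_p13 R (fun w => B w = h w) mP Bh.
  apply: aeS2 eb (aeS3 (fun x => @And3 _ _ _) L bB H) => x -> [E -> [+ _]].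
  by rewrite E.
have [[k gk]|[k gk]] := sum_sign_dichotomy b1 b3 sg.
- have [f3 [mf3 sf3 f3E]] := @to_sign_exists (fun z => k + g3 z - m)
    (measurable_funB (measurable_funD (measurable_cst k) mg3) (measurable_cst m)).
  (* Both functions must be provided although one alternative holds; the one that does not occur in
     it is the constant sign 1. *)
  exists (cst 1), f3; split.
  + by split; [exact: measurable_cst|right].
  + by split; [exact: measurable_funTS|move=> t _; exact: sf3].
  + right.
    have := res (fun w => k + g3 w.2 - m); set K := (fun x => _).
    have mh : measurable_fun [set: R * R] (fun w : R * R => k + g3 w.2 - m).
      apply: measurable_funB => //; apply: measurable_funD => //.
      exact: measurableT_comp.
    move=> /(_ mh); rewrite /K => {K} H'; apply: aeS (H' _).
      by move=> x [-> /f3E] /=.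
    by apply: aeS2 gk Hy => x gx; apply: aeS => z [_ ->]; rewrite -/(g1 x) gx.
- have [f1 [mf1 sf1 f1E]] := @to_sign_exists (fun x => g1 x + k - m)
    (measurable_funB (measurable_funD mg1 (measurable_cst k)) (measurable_cst m)).
  exists f1, (cst 1); split.
  + by split; [exact: measurable_funTS|move=> t _; exact: sf1].
  + by split; [exact: measurable_cst|right].
  + left.
    have mh : measurable_fun [set: R * R] (fun w : R * R => g1 w.1 + k - m).
      apply: measurable_funB => //; apply: measurable_funD => //.
      exact: measurableT_comp.
    apply: aeS (res (fun w => g1 w.1 + k - m) mh _).
      by move=> x [-> /f1E] /=.
    apply: aeS Hy => x; apply: aeS2 gk => z gz [_ ->].
    by rewrite -[tr _ _]/(g1 x) -[E1 _ _ _]/(g3 z) gz.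
Qed.

Lemma shear_transport : pderiv_zero i2 e -> forall f3 : R -> R,
  sign_valued (lambda i3) f3 ->
  {ae leb3 R, forall x, torus lambda x -> e x i1 i3 = f3 (xcoord i3 x)} ->
  forall F3 : R -> R, lipschitz_primitive (periodize (lambda i3) f3) F3 ->
  exists e12 e23 : R * R -> R,
    [/\ planar_version lambda (fun x => e x i1 i2) e12,
        planar_version lambda (fun x => e x i2 i3) e23 &
        exists g : R -> R, measurable_fun [set: R] g /\
          {ae leb2 R, forall z : R * R,
             (e12 \o Phi F3) z = g z.2 /\
             (e23 \o Phi F3) z = periodize (lambda i3) f3 z.1 * g z.2}].
Proof.
move=> e0 f3 sf3 ef3 F3 [/lipschitz_Lip LF dF _].
have l1 := lambda_gt0 i1; have l2 := lambda_gt0 i2; have l3 := lambda_gt0 i3.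
have aA := planar_reduction (isT : i2 != i3) e0.
have bB := planar_reduction (isT : i1 != i3) e0.
have cC := planar_reduction (isT : i1 != i2) e0.
have ea := shear_ae lambda_gt0 e_grad e_wells (isT : i2 != i3).
have eb := shear_ae lambda_gt0 e_grad e_wells (isT : i1 != i3).
have ec := shear_ae lambda_gt0 e_grad e_wells (isT : i1 != i2).
set A := E2 r2 a in aA; set B := E2 r2 b in bB; set C' := E2 r2 c in cC.
have bA : bnd A by exact: bnd_E2 mr2.1.
have bndB : bnd B by exact: bnd_E2 mr2.1.
have bC : bnd C' by exact: bnd_E2 mr2.1.
have [pB1 pB3] := E2_periodic r2 (pu i1 i3).
have Bf : {ae leb R, forall x : R, {ae leb R, forall z : R,
    B (x, z) = periodize (lambda i3) f3 z}}.
  have H : {ae leb3 R, forall x, torus lambda x -> B (x.1.1, x.2) = f3 x.2}.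
    by apply: aeS3 ef3 eb bB => x h e1 e2 /h; rewrite e1 e2.
  apply: (ae_periodic1 l1) => [x|].
    by split; apply: aeS => z; rewrite [B (x + _, z)](pB1 (x, z)).
  apply: aeS (ae3_nest H) => x Hx x1; apply: (ae_periodic1 l3) => [z|].
    by rewrite [B (x, _)](pB3 (x, z)) periodizeD.
  (* The identity does not involve x2, so one value inside the cell is enough; it exists because the
     interval has positive measure. *)
  have [y [Hy y2]] : exists y, {ae leb R, forall z : R,
      torus lambda (x, y, z) -> B (x, z) = f3 z} /\ 0 < y < lambda i2.
    apply: contrapT => ny.
    have : {ae leb R, forall y : R, ~ (0 < y < lambda i2)}.
      by apply: aeS Hx => y Hy y2; apply: ny; exists y.
    move=> [N [mN N0 HN]].
    have : (leb R (`]0%R, lambda i2[%classic : set R) <= leb R N)%E.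
      by apply: le_measure; rewrite ?inE// => t /=; rewrite in_itv/= => t2; apply: HN => /=; apply.
    by rewrite N0 lebesgue_measure_itv/= lte_fin l2 sube0 lee_fin leNgt l2.
  apply: aeS Hy => z Hz /andP[z0 z3]; rewrite periodize_in ?(ltW z0)//; apply: Hz => i.
  move: x1 y2 => /andP[x0 x1] /andP[y0 y2].
  by case: (ord3P i) => ->; rewrite /xcoord/=; apply/andP; split => //; exact: ltW.
(* [f3] comes without measurability; the coefficient of the transport equation is instead a slice of
   e_13, which is measurable and almost everywhere equal to its periodic extension. *)
have [x0 Bx0] := ae_ex Bf; set gam := fun z => B (x0, z) in Bx0.
have bgam : bnd gam by exact: bnd_slice1.
have Cb := bnd_tr bC; have Ab := bnd_tr bA.
(* The sign relations give e_23 = e_13 e_12, so the transport equation has no free term; hence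
   [cst 0] below. *)
have beE0 : {ae leb R, forall z : R, {ae leb R, forall x : R,
    tr A (z, x) = gam z * tr C' (z, x)}}.
  have mP : measurable [set w : R * R | A w = gam w.2 * C' w].
    apply: measurable_eq; first by case: bA.
    apply: measurable_funM; last by case: bC.
    by apply: measurableT_comp => //; case: bgam.
  apply: (@ae_swap2 R (fun w => A w = gam w.2 * C' w) mP).
  have H : {ae leb3 R, forall x, A (x.1.1, x.2) = B (x.1.1, x.2) * C' (x.1.1, x.2)}.
    apply: aeS2 usgn (aeS3 (fun x => @And3 _ _ _) aA bB cC) => x.
    move=> [_ /sgn1E b2 /sgn1E c2 p] [<- <- <-].
    have -> : a x = a x * (b x * b x) * (c x * c x) by rewrite b2 c2 !mulr1.
    by rewrite -[RHS]mul1r -p; ring.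
  apply: aeS2 Bf (ae3_nest (ae3_s23 H)) => x Bx Hx.
  have Hx' : {ae leb R, forall z : R, A (x, z) = B (x, z) * C' (x, z)}.
    by apply: aeS Hx => z; rewrite /s23/= => /ae_cst.
  by apply: aeS3 Bx Bx0 Hx' => z e1 e2 ->; rewrite e1 -e2.
have mshear (h : R * R -> R) : bnd h ->
    measurable_fun [set: R * R] (fun z : R * R => h (z.1, z.2 - F3 z.1)).
  move=> [mh _]; apply: (measurableT_comp mh); apply: measurable_fun_pair => //.
  apply: measurable_funB => //; apply: measurableT_comp => //.
  exact: Lip_measurable.
have beE : {ae leb2 R, forall z : R * R, tr A z = gam z.1 * tr C' z + cst 0 z.1}.
  apply: (@prod_ae _ _ _ _ _ (leb R) (leb R)).
    apply: measurable_eq; first by case: Ab.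
    apply: measurable_funD => //; apply: measurable_funM; last by case: Cb.
    by apply: measurableT_comp => //; case: bgam.
  by apply: aeS beE0 => z; apply: aeS => x ->; rewrite addr0.
have dF' : {ae leb R, forall s : R, is_derive s (1 : R) F3 (gam s)}.
  by apply: aeS2 dF Bx0 => s dFs E; rewrite /gam E.
(* The relation d_1 e_23 = d_3 e_12 is read in the variables (s, t) = (x3, x1), so that the shear of
   [transport] becomes [Phi F3] up to the order of the two coordinates. *)
have wp : weak_potential (tr C') (tr A).
  apply: weak_potential_tr => //; exact: core13 C.
have [n mn nE] := transport Cb Ab wp bgam (bnd_cst 0) LF dF' beE.
have AE : {ae leb2 R, forall z : R * R,
    tr A (z.1, z.2 - F3 z.1) = gam z.1 * tr C' (z.1, z.2 - F3 z.1)}.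
  apply: (@prod_ae _ _ _ _ _ (leb R) (leb R)).
    apply: measurable_eq; first exact: mshear.
    apply: measurable_funM; last exact: mshear.
    by apply: measurableT_comp => //; case: bgam.
  by apply: aeS beE0 => s Hs; exact: (ae_shift (- F3 s) Hs).
have [pA1 pA3] := E2_periodic r2 (pu i2 i3); have [pC1 pC3] := E2_periodic r2 (pu i1 i2).
exists C', A; split.
- split => //; first by case: bC.
  by apply: aeS2 ec cC => x ->.
- split => //; first by case: bA.
  by apply: aeS2 ea aA => x ->.
exists n; split => //; apply: aeS3 nE AE (ae_lift1 Bx0) => z nz Az gz.
by rewrite -gz -nz -Az.
Qed.

End main_parts.

Theorem theorem1 (R : realType) (lambda : 'I_3 -> R) (d1 d2 d3 : R)
    (e : R * R * R -> 'M[R]_3)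
    (lambda_gt0 : forall i, 0 < lambda i)
    (e_grad : periodic_sym_grad lambda e)
    (e_wells : {ae leb3 R, forall x, torus lambda x ->
       e x \in [:: strain1 d1 d2 d3; strain2 d1 d2 d3;
                   strain3 d1 d2 d3; strain4 d1 d2 d3]}) :
  [/\ exists j : 'I_3, pderiv_zero j e,
      pderiv_zero i2 e ->
      exists f1 f3 : R -> R,
        [/\ measurable_fun `[0, lambda i1[ f1 /\ sign_valued (lambda i1) f1,
            measurable_fun `[0, lambda i3[ f3 /\ sign_valued (lambda i3) f3 &
            {ae leb3 R, forall x, torus lambda x ->
               e x i1 i3 = f1 (xcoord i1 x)} \/
            {ae leb3 R, forall x, torus lambda x ->
               e x i1 i3 = f3 (xcoord i3 x)}] &
      pderiv_zero i2 e ->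
      forall f3 : R -> R,
        sign_valued (lambda i3) f3 ->
        {ae leb3 R, forall x, torus lambda x -> e x i1 i3 = f3 (xcoord i3 x)} ->
      forall F3 : R -> R,
        lipschitz_primitive (periodize (lambda i3) f3) F3 ->
      exists e12 e23 : R * R -> R,
        [/\ planar_version lambda (fun x => e x i1 i2) e12,
            planar_version lambda (fun x => e x i2 i3) e23 &
            exists g : R -> R, measurable_fun [set: R] g /\
              {ae leb2 R, forall z : R * R,
                 (e12 \o Phi F3) z = g z.2 /\
                 (e23 \o Phi F3) z = periodize (lambda i3) f3 z.1 * g z.2}]].
Proof.
have [r1 w1] := window_exists (lambda_gt0 i1).
have [r2 w2] := window_exists (lambda_gt0 i2).
have [r3 w3] := window_exists (lambda_gt0 i3).
split.
- exact: (exists_pderiv_zero lambda_gt0 e_grad e_wells w1 w2 w3).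
- exact: (e13_one_variable lambda_gt0 e_grad e_wells w1 w2 w3).
- exact: (shear_transport lambda_gt0 e_grad e_wells w1 w2 w3).
Qed.
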